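(* Let $u(z)$ be a meromorphic solution in $\mathbf{C}^n$ to the partial differential equation $$H(u_{z_1},u_{z_2},\ldots,u_{z_n})=P(u),$$ where $H(z_1,z_2,\ldots,z_n)$ is a nontrivial homogeneous polynomial of degree $\ell\,(\geq 1)$ in $\mathbf{C}^n$ and $P(w)$ is a polynomial of degree $\hbar$ in $\mathbf{C}$. If either (i) $\ell=1$ and $P(w)$ has a multiple zero, or (ii) $\ell=2$ and $\hbar\geq 5$, or (iii) $\ell\geq 3$ and $P(w)$ has all zeros distinct, then $u$ is pseudoprime.
   Context: A meromorphic function $u$ in $\mathbf{C}^n$ is said to admit a factorization $u(z)=f(g(z))$ with a meromorphic left factor $f:\mathbf{C}\to\mathbf{C}\cup\{\infty\}$ and an entire right factor $g:\mathbf{C}^n\to\mathbf{C}$ ($g$ is allowed to be meromorphic provided $f$ is rational). The function $u$ is called pseudoprime if every such factorization has either $f$ rational or $g$ a polynomial. $u_{z_j}$ denotes $\partial u/\partial z_j$. ''Nontrivial'' for $H$ means not identically zero. *)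

(* Defs.v *)
From HB Require Import structures.
From mathcomp Require Import all_boot all_order all_algebra.
From mathcomp Require Import complex.
From mathcomp Require Import all_classical all_reals all_analysis.
(* The notations of [mpoly] clash with those of MathComp-Analysis, so only its
   canonical structures and coercions are imported. *)
From mathcomp Require mpoly.
Import (canonicals, coercions) mpoly.

Set Implicit Arguments.
Unset Strict Implicit.
Unset Printing Implicit Defensive.

Import Order.TTheory GRing.Theory Num.Theory.
Import numFieldNormedType.Exports.

Local Open Scope classical_set_scope.
Local Open Scope ring_scope.

(* The complex numbers, with the topology of the modulus.  Differentiability
   of maps between normed modules over [Cplx R] is complex differentiability. *)
Definition Cplx (R : realType) : numClosedFieldType := complex R.

Section Meromorphic.
Variables (R : realType) (V : normedModType (Cplx R)).
Implicit Types (u h k : V -> Cplx R) (p z : V).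

Definition holomorphic_at u p := \forall z \near p, differentiable u z.

Definition entire u := forall p, holomorphic_at u p.

(* A meromorphic function is represented by a total function that is locally a
   quotient h / k of holomorphic functions, with k not the zero germ; its
   values where k vanishes are arbitrary.  In particular it has its true value
   wherever it is [holomorphic_at], which is the case on a dense open set. *)
Definition meromorphic u := forall p, exists h k,
  [/\ holomorphic_at h p, holomorphic_at k p,
      ~ (\forall z \near p, k z = 0)
    & \forall z \near p, k z != 0 -> u z = h z / k z].

(* u = f o g as meromorphic functions.  The density condition says that f o g
   makes sense: it excludes g being constant equal to a pole of f. *)
Definition is_comp u (f : Cplx R -> Cplx R) (g : V -> Cplx R) :=
  let D := [set z | [/\ holomorphic_at u z, holomorphic_at g z &
                        \forall w \near g z, differentiable f w]] in
  dense D /\ forall z, D z -> u z = f (g z).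

End Meromorphic.

Definition is_rational (R : realType) (f : Cplx R -> Cplx R) :=
  exists p q : {poly Cplx R}, q != 0 /\
    forall z, holomorphic_at f z -> q.[z] != 0 -> f z = p.[z] / q.[z].

Section SeveralVariables.
Variables (R : realType) (n : nat).
Implicit Types u g : 'rV[Cplx R]_n -> Cplx R.

Definition is_polynomial g :=
  exists p : mpoly.mpoly n (Cplx R),
    forall z, holomorphic_at g z -> g z = mpoly.meval (fun i => z 0 i) p.

Definition factorization u (f : Cplx R -> Cplx R) g :=
  [/\ meromorphic f, entire g \/ (is_rational f /\ meromorphic g)
    & is_comp u f g].

Definition pseudoprime u :=
  forall f g, factorization u f g -> is_rational f \/ is_polynomial g.

Definition partial u (j : 'I_n) (z : 'rV[Cplx R]_n) : Cplx R :=
  'D_(delta_mx 0 j) u z.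

(* The equation is imposed at the points where the representative u is
   holomorphic; this is equality of the two sides as meromorphic functions. *)
Definition meromorphic_solution (H : mpoly.mpoly n (Cplx R))
    (P : {poly Cplx R}) u :=
  meromorphic u /\
  forall z, holomorphic_at u z ->
    mpoly.meval (fun j => partial u j z) H = P.[u z].

End SeveralVariables.

Definition has_multiple_zero (R : realType) (P : {poly Cplx R}) :=
  exists a, (1 < mup a P)%N.

Definition zeros_distinct (R : realType) (P : {poly Cplx R}) :=
  forall a, root P a -> mup a P = 1%N.

(* Main.v *)
(* On the characteristic line t |-> z0 + t b with b = (grad H)(grad u(z0)), the
   second derivatives of u satisfy a linear system which forces grad u to keep
   its direction.  By Euler's identity U(t) = u(z0 + t b) = f(g(z0 + t b)) then
   solves U' ^ l = k P(U) with k != 0, near 0 and hence on all of C, because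
   f o g is meromorphic there.  Comparing pole orders and orders of zeros, and
   bounding entire solutions by a Cauchy-estimate blow-up argument (a large
   value would double within ever shorter distances), leaves only the cases
   where U or 1 / (U - a) is affine; then f is a Moebius map.  If H(grad u)
   vanishes identically, u is a root of P, so f is constant. *)
Require Import Defs.
From HB Require Import structures.
From mathcomp Require Import all_boot all_order all_algebra.
From mathcomp Require Import ring lra zify.
From mathcomp Require Import complex.
From mathcomp Require Import all_classical all_reals all_analysis.
From mathcomp Require mpoly.
Import (canonicals, coercions) mpoly.
Set Implicit Arguments.
Unset Strict Implicit.
Unset Printing Implicit Defensive.
Import Order.TTheory GRing.Theory Num.Theory.
Import numFieldNormedType.Exports.
Local Open Scope classical_set_scope.
Local Open Scope ring_scope.

(** * Complex derivatives *)

(** Characteristic curves solve z' = (grad H)(grad u). Once grad u keeps its direction, homogeneity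
    of H gives z' a constant direction too, so the curve is a line up to reparametrization. Working
    on that line from the start replaces the solution of an ODE by a statement about germs at 0: the
    part of grad u transversal to its initial value vanishes at 0 and satisfies a homogeneous linear
    inequality. This needs symmetric, locally bounded second derivatives, which come from Cauchy
    estimates in two parameters. The estimates only have to hold up to constants: the contour is a
    square, and its winding integral is never evaluated, only bounded below by 1 in modulus. Blow-up
    stands in for value distribution theory: an entire v with |v'|^l >= c |v|^(l+1) for large |v| is
    bounded, hence constant. The numerical hypotheses enter through three comparisons: (j+2) l =
    (j+1) hbar at a pole of order j+1, m l = m+1 where U takes the value of a simple zero of P with
    multiplicity m+1, and a blow-up exponent of at least l+1. *)

Local Notation cder z := (is_derive z (1 : Cplx _)).

Section Cmod.
Variable R : realType.
Local Notation C := (Cplx R).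
Implicit Types (z w a b : C) (x y : R).

Definition rc x : C := (x +i* 0)%C.
Definition cre z : R := complex.Re z.
Definition cim z : R := complex.Im z.
Definition cI : C := (0 +i* 1)%C.
(** The norm on [Cplx R] takes values in [Cplx R] itself; its real part moves every estimate to [R],
    where [lra] and [nra] apply. *)
Definition cmod z : R := cre `|z|.

Lemma cmodE z : `|z| = rc (cmod z).
Proof. by rewrite /cmod /rc; case: z => a b. Qed.
Lemma rc_inj : injective rc.
Proof. by move=> x y []. Qed.
Lemma rcD x y : rc (x + y) = rc x + rc y.
Proof. exact: (rmorphD (real_complex R)). Qed.
Lemma rcN x : rc (- x) = - rc x.
Proof. exact: (rmorphN (real_complex R)). Qed.
Lemma rcB x y : rc (x - y) = rc x - rc y.
Proof. by rewrite rcD rcN. Qed.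
Lemma rcM x y : rc (x * y) = rc x * rc y.
Proof. exact: (rmorphM (real_complex R)). Qed.
Lemma rcX x n : rc (x ^+ n) = rc x ^+ n.
Proof. exact: (rmorphXn (real_complex R)). Qed.
Lemma rc0 : rc 0 = 0. Proof. by []. Qed.
Lemma rc1 : rc 1 = 1. Proof. by []. Qed.
Lemma rcn n : rc n%:R = n%:R.
Proof. exact: (rmorph_nat (real_complex R)). Qed.
Lemma rcV x : rc (x^-1) = (rc x)^-1.
Proof. exact: (fmorphV (real_complex R)). Qed.
Lemma rc_lt x y : (rc x < rc y) = (x < y).
Proof. exact: ltcR. Qed.
Lemma rc_le x y : (rc x <= rc y) = (x <= y).
Proof. exact: lecR. Qed.
Lemma rc_gt0 (e : C) : 0 < e -> exists2 x : R, 0 < x & e = rc x.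
Proof. case: e => a b; rewrite ltcE /= => /andP[/eqP -> a0]; by exists a. Qed.

Lemma cre_rc x : cre (rc x) = x. Proof. by []. Qed.
Lemma cim_rc x : cim (rc x) = 0. Proof. by []. Qed.
Lemma creD z w : cre (z + w) = cre z + cre w. Proof. by case: z; case: w. Qed.
Lemma cimD z w : cim (z + w) = cim z + cim w. Proof. by case: z; case: w. Qed.
Lemma creN z : cre (- z) = - cre z. Proof. by case: z. Qed.
Lemma cimN z : cim (- z) = - cim z. Proof. by case: z. Qed.
Lemma creM z w : cre (z * w) = cre z * cre w - cim z * cim w.
Proof. by case: z; case: w. Qed.
Lemma cimM z w : cim (z * w) = cre z * cim w + cim z * cre w.
Proof. by case: z; case: w. Qed.
Lemma creI : cre cI = 0. Proof. by []. Qed.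
Lemma cimI : cim cI = 1. Proof. by []. Qed.
Lemma cplxE z : z = rc (cre z) + cI * rc (cim z).
Proof. exact: complexE. Qed.
Lemma cplx_eq z w : cre z = cre w -> cim z = cim w -> z = w.
Proof. by case: z w => a b [c d]; rewrite /cre /cim /= => -> ->. Qed.
Definition cE := (creD, cimD, creN, cimN, creM, cimM, cre_rc, cim_rc, creI, cimI).

Lemma cmodD z w : cmod (z + w) <= cmod z + cmod w.
Proof. by rewrite -rc_le rcD -!cmodE ler_normD. Qed.
Lemma cmodM z w : cmod (z * w) = cmod z * cmod w.
Proof. by apply: rc_inj; rewrite rcM -!cmodE normrM. Qed.
Lemma cmodN z : cmod (- z) = cmod z.
Proof. by apply: rc_inj; rewrite -!cmodE normrN. Qed.
Lemma cmodBC z w : cmod (z - w) = cmod (w - z).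
Proof. by rewrite -cmodN opprB. Qed.
Lemma cmodB z w : cmod (z - w) <= cmod z + cmod w.
Proof. by rewrite -(cmodN w) cmodD. Qed.
Lemma cmodV z : cmod z^-1 = (cmod z)^-1.
Proof. by apply: rc_inj; rewrite rcV -!cmodE normfV. Qed.
Lemma cmodX z n : cmod (z ^+ n) = cmod z ^+ n.
Proof. by apply: rc_inj; rewrite rcX -!cmodE normrX. Qed.
Lemma cmod0 : cmod 0 = 0.
Proof. by apply: rc_inj; rewrite -!cmodE normr0. Qed.
Lemma cmod1 : cmod 1 = 1.
Proof. by apply: rc_inj; rewrite -!cmodE normr1. Qed.
Lemma cmod_sqr z : cmod z ^+ 2 = cre z ^+ 2 + cim z ^+ 2.
Proof. by apply: rc_inj; rewrite rcX -cmodE -(add_Re2_Im2 z). Qed.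
Lemma cmod_ge0 z : 0 <= cmod z.
Proof. by rewrite -rc_le -cmodE normr_ge0. Qed.
Lemma cmod_rc x : cmod (rc x) = `|x|.
Proof.
apply/eqP; rewrite -(@eqrXn2 _ 2) ?cmod_ge0 // cmod_sqr !cE real_normK ?num_real //.
by rewrite expr0n addr0.
Qed.
Lemma cmodI : cmod cI = 1.
Proof.
apply/eqP; rewrite -(@eqrXn2 _ 2) ?cmod_ge0 // cmod_sqr !cE.
by rewrite expr0n add0r.
Qed.
Lemma cmod_eq0 z : (cmod z == 0) = (z == 0).
Proof. by rewrite -(inj_eq rc_inj) -cmodE rc0 normr_eq0. Qed.
Lemma cmod_gt0 z : (0 < cmod z) = (z != 0).
Proof. by rewrite lt_def cmod_ge0 andbT cmod_eq0. Qed.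
Lemma cmod_cre z : `|cre z| <= cmod z.
Proof.
rewrite -(@ler_pXn2r _ 2) ?nnegrE ?cmod_ge0 // cmod_sqr real_normK ?num_real //.
by rewrite lerDl sqr_ge0.
Qed.
Lemma cmod_cim z : `|cim z| <= cmod z.
Proof.
rewrite -(@ler_pXn2r _ 2) ?nnegrE ?cmod_ge0 // cmod_sqr real_normK ?num_real //.
by rewrite lerDr sqr_ge0.
Qed.
Lemma cmod_le_reim z : cmod z <= `|cre z| + `|cim z|.
Proof.
rewrite {1}(cplxE z) (le_trans (cmodD _ _)) // cmodM cmodI mul1r !cmod_rc //.
Qed.
Lemma cmod_sum (I : Type) (r : seq I) (P : pred I) (F : I -> C) :
  cmod (\sum_(i <- r | P i) F i) <= \sum_(i <- r | P i) cmod (F i).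
Proof.
elim/big_ind2: _ => //; first by rewrite cmod0.
by move=> x1 x2 y1 y2 h1 h2; rewrite (le_trans (cmodD _ _)) // lerD.
Qed.
Lemma cmod_revtri z w : cmod z - cmod w <= cmod (z - w).
Proof. have := cmodD (z - w) w; rewrite subrK; lra. Qed.
Lemma eps_eq z w : (forall e : R, 0 < e -> cmod (z - w) <= e) -> z = w.
Proof.
move=> h; apply/eqP; rewrite -subr_eq0 -cmod_eq0 eq_le cmod_ge0 andbT.
by apply/ler_addgt0Pr => e e0; rewrite add0r h.
Qed.

Lemma nearCP z (P : C -> Prop) : (\forall w \near z, P w) <->
  exists2 d : R, 0 < d & forall w, cmod (w - z) < d -> P w.
Proof.
split.
  move=> /nbhs_normP [e /= /rc_gt0[d d0 ->] H]; exists d => // w wd.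
  by apply: H; rewrite /= cmodE rc_lt cmodBC.
move=> [d d0 H]; apply/nbhs_normP; exists (rc d); first by rewrite /= -rc0 rc_lt.
by move=> w /=; rewrite cmodE rc_lt => h; apply: H; rewrite cmodBC.
Qed.

Lemma cvgCP (T : Type) (F : set_system T) {FF : Filter F} (f : T -> C) l :
  (f x @[x --> F] --> l) <->
  forall e : R, 0 < e -> \forall x \near F, cmod (f x - l) < e.
Proof.
split.
  move=> /cvgrPdist_lt H e e0.
  have := H (rc e); rewrite -rc0 rc_lt => /(_ e0); apply: filterS => x.
  by rewrite cmodE rc_lt cmodBC.
move=> H; apply/cvgrPdist_lt => e /rc_gt0[d d0 ->]; apply: filterS (H d d0) => x.
by rewrite cmodE rc_lt cmodBC.
Qed.

Lemma ccontP (f : C -> C) z : {for z, continuous f} <->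
  forall e : R, 0 < e -> exists2 d : R, 0 < d &
    forall w, cmod (w - z) < d -> cmod (f w - f z) < e.
Proof.
have -> : {for z, continuous f} <-> (forall e : R, 0 < e ->
    \forall w \near z, cmod (f w - f z) < e).
  exact: (@cvgCP C (nbhs z) (nbhs_filter z) f (f z)).
split=> H e e0; first by have /nearCP := H e e0.
by apply/nearCP; exact: H.
Qed.

(** The form used in all estimates: free of quotients, with a weak inequality that also covers
    [w = z]. *)
Lemma cderP (f : C -> C) z l : cder z f l <->
  forall e : R, 0 < e -> exists2 d : R, 0 < d &
    forall w, cmod (w - z) < d -> cmod (f w - f z - l * (w - z)) <= e * cmod (w - z).
Proof.
have -> : cder z f l <->
    (h^-1 *: (f (h *: (1 : C) + z) - f z)) @[h --> 0^'] --> l.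
  split.
    by move=> [] H <-; exact: H.
  move=> H; apply: DeriveDef; last exact: cvg_lim H.
  by apply: cvgP H.
apply: iff_trans (@cvgCP _ (0 : C)^' _ _ _) _; split.
  move=> H e e0; have := H e e0; rewrite near_withinE => /nearCP [d d0 D].
  exists d => // w wd; have [->|wz] := eqVneq w z.
    by rewrite !subrr mulr0 subr0 cmod0 mulr0.
  have wz0 : w - z != 0 by rewrite subr_eq0.
  have := D (w - z); rewrite subr0 => /(_ wd wz0).
  rewrite /GRing.scale /= mulr1 subrK => /ltW K.
  have -> : f w - f z - l * (w - z) = ((w - z)^-1 * (f w - f z) - l) * (w - z).
    by rewrite mulrBl mulrAC mulVf // mul1r.
  by rewrite cmodM ler_wpM2r // cmod_ge0.
move=> H e e0; have e20 : 0 < e / 2 by lra.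
have [d d0 D] := H _ e20; rewrite near_withinE; apply/nearCP; exists d => // h.
rewrite subr0 => hd h0; rewrite /GRing.scale /= mulr1.
have := D (h + z); rewrite addrK => /(_ hd) K.
have -> : h^-1 * (f (h + z) - f z) - l = (f (h + z) - f z - l * h) * h^-1.
  by rewrite mulrBl mulfK // mulrC.
rewrite cmodM cmodV; apply: le_lt_trans (_ : e / 2 < e); last by lra.
by rewrite ler_pdivrMr ?cmod_gt0.
Qed.

Lemma diff_derP (f : C -> C) z : differentiable f z <-> exists l, cder z f l.
Proof.
split; first by move=> /derivable1_diffP /derivableP H; eexists; exact: H.
by move=> [l [H _]]; apply/derivable1_diffP.
Qed.

Lemma der_unique (f : C -> C) z l l' : cder z f l -> cder z f l' -> l = l'.
Proof. by move=> [_ <-] [_ <-]. Qed.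

Lemma der_near (f g : C -> C) z l : (\forall w \near z, f w = g w) ->
  cder z f l -> cder z g l.
Proof.
move=> /nearCP [d d0 D] /cderP H; apply/cderP => e e0.
have [d' d'0 D'] := H e e0; exists (Num.min d d'); first by rewrite lt_min d0.
move=> w; rewrite lt_min => /andP[w1 w2]; rewrite -D // -D ?D' //.
by rewrite subrr cmod0.
Qed.

Lemma der_cont (f : C -> C) z l : cder z f l -> {for z, continuous f}.
Proof. by move=> h; apply: differentiable_continuous; apply/diff_derP; exists l. Qed.

Lemma der_comp (f g : C -> C) z l m : cder z g l -> cder (g z) f m ->
  cder z (f \o g) (m * l).
Proof.
move=> /[dup] hg /cderP Hg /cderP Hf; apply/cderP => e e0.
(* With relative errors at most [E <= 1] on both maps, the composite has error at most
   [E * (cmod l + 1) + cmod m * E = E * A] times [cmod (w - z)]. *)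
pose A := cmod l + cmod m + 1.
have A0 : 0 < A by have := cmod_ge0 l; have := cmod_ge0 m; rewrite /A; lra.
pose E := Num.min 1 (e / A).
have E0 : 0 < E by rewrite lt_min ltr01 divr_gt0.
have [E1 EA] : E <= 1 /\ E * A <= e.
  by split; [rewrite /E ge_min lexx | rewrite -ler_pdivlMr // /E ge_min lexx orbT].
have [d1 d10 H1] := Hf _ E0; have [d2 d20 H2] := Hg _ E0.
have [d3 d30 H3] : exists2 d, 0 < d & forall w, cmod (w - z) < d -> cmod (g w - g z) < d1.
  by have /ccontP/(_ _ d10) := der_cont hg.
exists (Num.min d2 d3); first by rewrite lt_min d20.
move=> w; rewrite lt_min => /andP[/H2 h2 /H3 /H1 h1] /=.
set x := cmod (w - z) in h2 *.
have x0 : 0 <= x := cmod_ge0 _.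
have h3 : cmod (g w - g z) <= (cmod l + 1) * x.
  have -> : g w - g z = (g w - g z - l * (w - z)) + l * (w - z) by rewrite subrK.
  rewrite (le_trans (cmodD _ _)) // cmodM -/x mulrDl mul1r addrC lerD2l.
  by rewrite (le_trans h2) // ler_piMl.
have -> : f (g w) - f (g z) - m * l * (w - z) =
  (f (g w) - f (g z) - m * (g w - g z)) + m * (g w - g z - l * (w - z)) by ring.
rewrite (le_trans (cmodD _ _)) // cmodM.
apply: le_trans (_ : E * ((cmod l + 1) * x) + cmod m * (E * x) <= _).
  by rewrite lerD // ?(le_trans h1) // ler_wpM2l // ?(ltW E0) // cmod_ge0.
have -> : E * ((cmod l + 1) * x) + cmod m * (E * x) = E * A * x by rewrite /A; ring.
exact: ler_wpM2r.
Qed.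

Lemma der_inv (g : C -> C) z l : g z != 0 -> cder z g l ->
  cder z (fun w => (g w)^-1) (- l / (g z) ^+ 2).
Proof.
move=> h0 [h <-]; apply: DeriveDef; first exact: derivableV.
by rewrite deriveV // /GRing.scale /= !mulNr mulrC.
Qed.

Lemma der_mul (f g : C -> C) z l m : cder z f l -> cder z g m ->
  cder z (fun w => f w * g w) (l * g z + f z * m).
Proof.
move=> hf hg; have H := is_deriveM hf hg; apply: is_derive_eq H _.
by rewrite /GRing.scale /= addrC [g z * l]mulrC.
Qed.
Lemma der_add (f g : C -> C) z l m : cder z f l -> cder z g m ->
  cder z (fun w => f w + g w) (l + m).
Proof. by move=> hf hg; exact: is_deriveD. Qed.
Lemma der_opp (f : C -> C) z l : cder z f l ->
  cder z (fun w => - f w) (- l).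
Proof. by move=> hf; exact: is_deriveN. Qed.
Lemma der_sub (f g : C -> C) z l m : cder z f l -> cder z g m ->
  cder z (fun w => f w - g w) (l - m).
Proof. by move=> hf hg; exact: is_deriveB. Qed.
Lemma der_cst a z : cder z (fun=> a) 0.
Proof. exact: is_derive_cst. Qed.
Lemma der_id z : cder z (fun w => w) 1.
Proof. exact: is_derive_id. Qed.
Lemma der_eq (f : C -> C) z l m : cder z f l -> l = m -> cder z f m.
Proof. by move=> h <-. Qed.
Lemma der_exp (f : C -> C) z l n : cder z f l ->
  cder z (fun w => f w ^+ n) (n%:R * f z ^+ n.-1 * l).
Proof.
move=> h; elim: n => [|n IH]; first by apply: der_eq (der_cst _ _) _; rewrite !mul0r.
have -> : (fun w => f w ^+ n.+1) = (fun w => f w * f w ^+ n) by apply/funext => w; rewrite exprS.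
apply: der_eq (der_mul h IH) _.
case: n {IH} => [|n] /=; first by rewrite expr0; ring.
rewrite exprS -[n.+2%:R]natr1; ring.
Qed.
Lemma der_poly (P : {poly C}) z : cder z (fun w => P.[w]) (P^`()).[z].
Proof.
elim/poly_ind: P => [|P c IH].
  rewrite deriv0 horner0; under eq_fun do rewrite horner0; exact: der_cst.
under eq_fun do rewrite hornerMXaddC.
apply: der_eq (der_add (der_mul IH (der_id z)) (der_cst c z)) _.
rewrite derivMXaddC hornerD hornerM hornerX; ring.
Qed.
End Cmod.

(** A function is recognised as constant when its bodies at [z] and [z + 1] agree syntactically
    after beta reduction; [derstep] tries this before the structural rules. *)
Ltac is_const F z := let a := eval cbv beta in (F z) in
  let b := eval cbv beta in (F (z + 1)) in constr_eq a b.
Ltac derstep := match goal with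
  | H : is_derive ?z _ ?f _ |- is_derive ?z _ ?f _ => exact: H
  | |- is_derive ?z _ ?f _ => is_const f z; exact: der_cst
  | _ => lazymatch goal with
  | |- is_derive _ _ (fun w => w) _ => exact: der_id
  | |- is_derive _ _ (fun w => GRing.add (@?f w) (@?g w)) _ => eapply (@der_add _ f g)
  | |- is_derive _ _ (fun w => GRing.opp (@?f w)) _ => eapply (@der_opp _ f)
  | |- is_derive _ _ (fun w => GRing.mul (@?f w) (@?g w)) _ => eapply (@der_mul _ f g)
  | |- is_derive _ _ (fun w => GRing.inv (@?f w)) _ => eapply (@der_inv _ f)
  | |- is_derive _ _ (fun w => GRing.exp (@?f w) ?n) _ => eapply (@der_exp _ f _ _ n)
  | |- is_derive _ _ (fun w => horner ?P w) _ => exact: der_poly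
  | |- _ => first [eassumption | match goal with H : is_derive _ _ _ _ |- _ => exact H end]
  end end.
Ltac ders := eapply der_eq; [ repeat derstep |].
Ltac diffs := apply/diff_derP; eexists; repeat derstep.

(** * Integration on segments *)

Section Integral.
Variable R : realType.
Local Notation C := (Cplx R).
Implicit Types (f g : R -> C) (x : nat -> C) (a b c : C) (s t : R).

Definition slim x (l : C) := forall e : R, 0 < e ->
  exists N, forall n, (N <= n)%N -> cmod (x n - l) <= e.

Lemma real_complete (u : nat -> R) : (forall e : R, 0 < e ->
  exists N, forall n, (N <= n)%N -> `|u n - u N| <= e) -> exists l : R, u @ \oo --> l.
Proof.
move=> H.
suff : cvgn u by move=> h; exists (limn u).
apply: cauchy_cvg; apply: cauchy_exP => e e0.
have e20 : 0 < e / 2 by lra.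
have [N HN] := H _ e20; exists (u N); exists N => //= n Nn.
have := HN n Nn; rewrite /ball /= distrC; lra.
Qed.

Lemma slim_complete x : (forall e : R, 0 < e ->
  exists N, forall n, (N <= n)%N -> cmod (x n - x N) <= e) -> exists l, slim x l.
Proof.
move=> H.
have [|lr Hr] := @real_complete (fun n => cre (x n)).
  move=> e /H[N HN]; exists N => n /HN; apply: le_trans.
  by have := cmod_cre (x n - x N); rewrite !cE.
have [|li Hi] := @real_complete (fun n => cim (x n)).
  move=> e /H[N HN]; exists N => n /HN; apply: le_trans.
  by have := cmod_cim (x n - x N); rewrite !cE.
exists (rc lr + cI R * rc li) => e e0.
have e20 : 0 < e / 2 by lra.
move/cvgrPdist_lt: Hr => /(_ _ e20) [N1 _ H1].
move/cvgrPdist_lt: Hi => /(_ _ e20) [N2 _ H2].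
exists (maxn N1 N2) => n; rewrite geq_max => /andP[n1 n2].
rewrite (le_trans (cmod_le_reim _)) // !cE.
have := H1 n n1; have := H2 n n2; rewrite /= !(distrC lr, distrC li) => h1 h2.
rewrite !mul0r !mul1r !subr0 !add0r !addr0; lra.
Qed.

Lemma slim_unique x l l' : slim x l -> slim x l' -> l = l'.
Proof.
move=> H H'; apply: eps_eq => e e0.
have e20 : 0 < e / 2 by lra.
have [N HN] := H _ e20; have [N' HN'] := H' _ e20.
have := HN (maxn N N') (leq_maxl _ _); have := HN' (maxn N N') (leq_maxr _ _).
set y := x _ => h1 h2.
have -> : l - l' = (y - l') - (y - l) by ring.
rewrite (le_trans (cmodB _ _)) //; lra.
Qed.

Lemma slim_lin x y l m a b : slim x l -> slim y m ->
  slim (fun n => a * x n + b * y n) (a * l + b * m).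
Proof.
move=> H H' e e0.
pose k := cmod a + cmod b + 1.
have k0 : 0 < k by have := cmod_ge0 a; have := cmod_ge0 b; rewrite /k; lra.
have ek0 : 0 < e / k by rewrite divr_gt0.
have [N HN] := H _ ek0; have [N' HN'] := H' _ ek0.
exists (maxn N N') => n; rewrite geq_max => /andP[/HN n1 /HN' n2].
have -> : a * x n + b * y n - (a * l + b * m) = a * (x n - l) + b * (y n - m) by ring.
rewrite (le_trans (cmodD _ _)) // !cmodM.
apply: le_trans (_ : cmod a * (e / k) + cmod b * (e / k) <= _).
  by rewrite lerD // ler_wpM2l // cmod_ge0.
rewrite -mulrDl mulrCA ler_piMr ?(ltW e0) // ler_pdivrMr // mul1r /k; lra.
Qed.

Lemma slim_bound x l M : slim x l -> (forall n, cmod (x n) <= M) -> cmod l <= M.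
Proof.
move=> H h; apply/ler_addgt0Pr => e e0; have [N HN] := H e e0.
have := HN N (leqnn _); have := cmod_revtri l (x N); rewrite cmodBC.
have := h N; lra.
Qed.

Lemma slim_dist x l M a : slim x l -> (forall n, cmod (x n - a) <= M) -> cmod (l - a) <= M.
Proof.
move=> H; apply: slim_bound => e /H [N HN]; exists N => n /HN.
by have -> : x n - a - (l - a) = x n - l by ring.
Qed.

Definition in01 t := (0 <= t) && (t <= 1).
Definition lo f t := f (t / 2).
Definition hi f t := f ((1 + t) / 2).

(* Left Riemann sums over the dyadic subdivision of [0, 1] into 2 ^ n pieces,
   in the recursive form that makes halving of the interval definitional. *)
Fixpoint rsum n f : C :=
  if n is m.+1 then (rsum m (lo f) + rsum m (hi f)) / 2 else f 0.

Lemma in01_lo t : in01 t -> in01 (t / 2).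
Proof. by rewrite /in01 => /andP[h1 h2]; apply/andP; split; lra. Qed.
Lemma in01_hi t : in01 t -> in01 ((1 + t) / 2).
Proof. by rewrite /in01 => /andP[h1 h2]; apply/andP; split; lra. Qed.
Lemma in01_rev t : in01 t -> in01 (1 - t).
Proof. by rewrite /in01 => /andP[h1 h2]; apply/andP; split; lra. Qed.
Lemma in010 : in01 0. Proof. by rewrite /in01 lexx ler01. Qed.
Lemma in011 : in01 1. Proof. by rewrite /in01 lexx ler01. Qed.
Hint Resolve in010 in011 : core.

Lemma rsum_ext n f g : (forall t, in01 t -> f t = g t) -> rsum n f = rsum n g.
Proof.
elim: n f g => [|n IH] f g H /=; first exact: H.
by congr ((_ + _) / _); apply: IH => t ht; apply: H; [apply: in01_lo | apply: in01_hi].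
Qed.

Lemma rsum_lin n f g a b : rsum n (fun t => a * f t + b * g t) = a * rsum n f + b * rsum n g.
Proof. by elim: n f g => //= n IH f g; rewrite /lo /hi !IH; ring. Qed.

Lemma half_bound a b (M : R) : cmod a <= M -> cmod b <= M -> cmod ((a + b) / 2) <= M.
Proof.
move=> ha hb; rewrite cmodM cmodV -(rcn R 2) cmod_rc normr_nat.
have := cmodD a b; lra.
Qed.

Lemma rsum_bound n f (M : R) : (forall t, in01 t -> cmod (f t) <= M) -> cmod (rsum n f) <= M.
Proof.
elim: n f => [|n IH] f H /=; first exact: H.
by apply: half_bound; apply: IH => t ht; apply: H; [apply: in01_lo | apply: in01_hi].
Qed.

Lemma rsum_im n f (M : R) : (forall t, in01 t -> M <= cim (f t)) -> M <= cim (rsum n f).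
Proof.
elim: n f => [|n IH] f H /=; first exact: H.
have h1 : M <= cim (rsum n (lo f)) by apply: IH => t ht; apply: H; apply: in01_lo.
have h2 : M <= cim (rsum n (hi f)) by apply: IH => t ht; apply: H; apply: in01_hi.
rewrite -(rcn R 2) -rcV !cE; lra.
Qed.

Definition osc f (d e : R) :=
  forall s t, in01 s -> in01 t -> `|s - t| <= d -> cmod (f s - f t) <= e.

Lemma osc_lo f d e : osc f (d / 2) e -> osc (lo f) d e.
Proof.
move=> H s t hs ht st; apply: H; rewrite ?in01_lo //.
by rewrite -mulrBl normrM (ger0_norm (_ : 0 <= 2^-1)) ?invr_ge0 // ler_wpM2r // invr_ge0.
Qed.
Lemma osc_hi f d e : osc f (d / 2) e -> osc (hi f) d e.
Proof.
move=> H s t hs ht st; apply: H; rewrite ?in01_hi //.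
have -> : (1 + s) / 2 - (1 + t) / 2 = (s - t) / 2 by ring.
by rewrite normrM (ger0_norm (_ : 0 <= 2^-1)) ?invr_ge0 // ler_wpM2r // invr_ge0.
Qed.

(** Passing to a half interval doubles the scale at which the oscillation is at most [e], so the
    induction ends on one interval where every value is within [e] of [f 0]. *)
Lemma rsum_cauchy n k f e : osc f (2^-1 ^+ n) e -> cmod (rsum (n + k) f - rsum n f) <= e.
Proof.
elim: n f => [|n IH] f; last first.
  rewrite exprS mulrC => H; rewrite addSn /=.
  have -> : (rsum (n + k) (lo f) + rsum (n + k) (hi f)) / 2 - (rsum n (lo f) + rsum n (hi f)) / 2
    = ((rsum (n + k) (lo f) - rsum n (lo f)) + (rsum (n + k) (hi f) - rsum n (hi f))) / 2 by ring.
  by apply: half_bound; apply: IH; [apply: osc_lo | apply: osc_hi].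
rewrite expr0 add0n /= => H.
have -> : rsum k f - f 0 = rsum k (fun t => 1 * f t + (-1) * f 0).
  rewrite rsum_lin mul1r mulN1r; congr (_ - _).
  have : forall m a, rsum m (fun=> a) = a.
    by elim=> //= m IH a; rewrite /lo /hi !IH; field.
  by move=> ->.
apply: rsum_bound => t ht; rewrite mul1r mulN1r; apply: H => //.
by rewrite subr0; move: ht => /andP[h1 h2]; rewrite ger0_norm.
Qed.

(** Up to the choice of sample points in each piece, reversal only permutes the terms; at the last
    stage the left sample [f 0] is compared with the right sample [f 1]. *)
Lemma rsum_rev n f e : osc f (2^-1 ^+ n) e ->
  cmod (rsum n (fun t => f (1 - t)) - rsum n f) <= e.
Proof.
elim: n f => [|n IH] f.
  by rewrite expr0 /= subr0 => H; apply: H => //; rewrite subr0 normr1.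
rewrite exprS mulrC => H /=.
rewrite (_ : lo (fun t => f (1 - t)) = (fun t => hi f (1 - t))); last first.
  by apply/funext => t; rewrite /lo /hi; congr f; field.
rewrite (_ : hi (fun t => f (1 - t)) = (fun t => lo f (1 - t))); last first.
  by apply/funext => t; rewrite /lo /hi; congr f; field.
set a := rsum n _; set b := rsum n _; set c := rsum n _; set d := rsum n _.
have -> : (a + b) / 2 - (c + d) / 2 = ((a - d) + (b - c)) / 2 by ring.
by apply: half_bound; apply: IH; [apply: osc_hi | apply: osc_lo].
Qed.

Definition cont01 f := forall s, in01 s -> forall e : R, 0 < e -> exists2 d : R, 0 < d &
  forall t, in01 t -> `|t - s| < d -> cmod (f t - f s) < e.

Lemma cont01_unif f : cont01 f -> forall e : R, 0 < e -> exists2 d : R, 0 < d & osc f d e.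
Proof.
move=> H e e0.
have /compact_near_coveringP cov := @segment_compact R 0 1.
(* Heine's theorem through the covering form of compactness: [P d s] must hold for all centres near
   [s] and all small [d] at once, hence the halves of [d] and [e]. *)
pose P (d s : R) := in01 s -> forall t, in01 t -> `|t - s| <= d -> cmod (f t - f s) <= e.
have [] : \forall d \near 0^'+, `[0%R, 1%R] `<=` P d.
  apply: (cov R 0^'+ P) => s; rewrite /= in_itv /= => hs.
  have e20 : 0 < e / 2 by lra.
  have [d d0 Hd] := H s hs _ e20.
  have d20 : 0 < d / 2 by lra.
  near=> s' d' => /= hs' t ht ts'.
  have h1 : `|s' - s| < d / 2 by rewrite distrC; near: s'; apply/nbhs_ballP; exists (d / 2).
  have h2 : d' < d / 2 by near: d'; exact: nbhs_right_lt.
  have k1 := Hd s' hs'.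
  have k2 := Hd t ht; have tri : `|t - s| <= `|t - s'| + `|s' - s| by exact: ler_distD.
  have -> : f t - f s' = (f t - f s) - (f s' - f s) by ring.
  rewrite (le_trans (cmodB _ _)) //.
  have {}k1 : cmod (f s' - f s) < e / 2 by apply: k1; lra.
  have {}k2 : cmod (f t - f s) < e / 2 by apply: k2; lra.
  lra.
move=> d /= d0 Hd; exists (d / 2); first by lra.
move=> s t hs ht st; apply: (Hd (d / 2)) => //=.
- by rewrite sub0r normrN ger0_norm; lra.
- by lra.
Unshelve. all: by end_near.
Qed.

Lemma cont01_osc f (e : R) : cont01 f -> 0 < e ->
  exists N, forall n, (N <= n)%N -> osc f (2^-1 ^+ n) e.
Proof.
move=> Hf e0; have [d d0 Hd] := cont01_unif Hf e0.
have h : `|2^-1 : R| < 1 by rewrite ger0_norm ?invr_ge0 //; lra.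
have /cvgrPdist_lt/(_ _ d0)[N _ HN] := cvg_expr h.
exists N => n /HN /=; rewrite sub0r normrN => hn s t hs ht st; apply: Hd => //.
by rewrite (le_trans st) // (le_trans (ler_norm _)) // ltW.
Qed.

Definition dint f : C := xget 0 [set l | slim (rsum ^~ f) l].

Lemma dintP f : cont01 f -> slim (rsum ^~ f) (dint f).
Proof.
move=> Hf; rewrite /dint; apply: (@xgetPex _ 0 [set l | slim (rsum ^~ f) l]).
apply: slim_complete => e e0; have [N HN] := cont01_osc Hf e0.
exists N => n Nn; rewrite -(subnKC Nn); apply: rsum_cauchy; exact: HN.
Qed.

Lemma dint_lim f l : cont01 f -> slim (rsum ^~ f) l -> dint f = l.
Proof. by move=> /dintP; exact: slim_unique. Qed.

Lemma dint_ext f g : (forall t, in01 t -> f t = g t) -> dint f = dint g.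
Proof.
move=> E; rewrite /dint; congr xget; apply/seteqP.
by split=> l /= H e /H[N HN]; exists N => n /HN; rewrite (rsum_ext _ E).
Qed.

Lemma cont01_lin f g a b : cont01 f -> cont01 g -> cont01 (fun t => a * f t + b * g t).
Proof.
move=> Hf Hg s hs e e0.
pose k := cmod a + cmod b + 1.
have k0 : 0 < k by have := cmod_ge0 a; have := cmod_ge0 b; rewrite /k; lra.
have ek0 : 0 < e / k by rewrite divr_gt0.
have [d d0 Hd] := Hf s hs _ ek0; have [d' d'0 Hd'] := Hg s hs _ ek0.
exists (Num.min d d'); first by rewrite lt_min d0.
move=> t ht; rewrite lt_min => /andP[/(Hd t ht) h1 /(Hd' t ht) h2].
have -> : a * f t + b * g t - (a * f s + b * g s) = a * (f t - f s) + b * (g t - g s) by ring.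
rewrite (le_lt_trans (cmodD _ _)) // !cmodM.
apply: le_lt_trans (_ : cmod a * (e / k) + cmod b * (e / k) < _).
  by rewrite lerD // ler_wpM2l ?cmod_ge0 // ltW.
rewrite -mulrDl mulrCA gtr_pMr // ltr_pdivrMr // mul1r /k; lra.
Qed.

Lemma dint_lin f g a b : cont01 f -> cont01 g ->
  dint (fun t => a * f t + b * g t) = a * dint f + b * dint g.
Proof.
move=> Hf Hg; apply: dint_lim; first exact: cont01_lin.
move=> e e0; have [N HN] := slim_lin a b (dintP Hf) (dintP Hg) e0.
by exists N => n /HN; rewrite rsum_lin.
Qed.

Lemma dint_bound f (M : R) : cont01 f -> (forall t, in01 t -> cmod (f t) <= M) ->
  cmod (dint f) <= M.
Proof. by move=> Hf h; apply: slim_bound (dintP Hf) _ => n; exact: rsum_bound. Qed.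

(** Serves the lower bound on the winding integral, whose integrand has imaginary part bounded below
    on each side of the contour. *)
Lemma dint_im f (M : R) : cont01 f -> (forall t, in01 t -> M <= cim (f t)) -> M <= cim (dint f).
Proof.
move=> Hf h; apply/ler_addgt0Pr => e e0; have [N HN] := dintP Hf e0.
have := HN N (leqnn _); have := rsum_im N h.
have := cmod_cim (rsum N f - dint f); rewrite cimD cimN.
have := ler_norm (cim (rsum N f) - cim (dint f)); lra.
Qed.

Lemma cont01_lo f : cont01 f -> cont01 (lo f).
Proof.
move=> H s hs e e0; have [d d0 Hd] := H _ (in01_lo hs) e e0; exists d => // t ht ts.
apply: Hd; first exact: in01_lo.
rewrite -mulrBl normrM (ger0_norm (_ : 0 <= 2^-1)) ?invr_ge0 //.
by have := normr_ge0 (t - s); lra.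
Qed.
Lemma cont01_hi f : cont01 f -> cont01 (hi f).
Proof.
move=> H s hs e e0; have [d d0 Hd] := H _ (in01_hi hs) e e0; exists d => // t ht ts.
apply: Hd; first exact: in01_hi.
have -> : (1 + t) / 2 - (1 + s) / 2 = (t - s) / 2 by ring.
rewrite normrM (ger0_norm (_ : 0 <= 2^-1)) ?invr_ge0 //.
by have := normr_ge0 (t - s); lra.
Qed.

Lemma dint_half f : cont01 f -> dint f = (dint (lo f) + dint (hi f)) / 2.
Proof.
move=> Hf; apply: dint_lim => // e e0.
have [N HN] := slim_lin (2^-1) (2^-1) (dintP (cont01_lo Hf)) (dintP (cont01_hi Hf)) e0.
exists N.+1 => -[//|n] /HN /=.
by rewrite -!mulrDr ![2^-1 * _]mulrC.
Qed.

Lemma dint_rev f : cont01 f -> dint (fun t => f (1 - t)) = dint f.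
Proof.
move=> Hf.
have Hg : cont01 (fun t => f (1 - t)).
  move=> s hs e e0; have [d d0 Hd] := Hf _ (in01_rev hs) e e0; exists d => // t ht ts.
  apply: Hd; first exact: in01_rev.
  rewrite (_ : 1 - t - (1 - s) = - (t - s)) ?normrN //; ring.
apply: dint_lim => // e e0.
have e20 : 0 < e / 2 by lra.
have [N HN] := cont01_osc Hf e20; have [N' HN'] := dintP Hf e20.
exists (maxn N N') => n; rewrite geq_max => /andP[/HN/rsum_rev h1 /HN' h2].
have -> : rsum n (fun t => f (1 - t)) - dint f =
  (rsum n (fun t => f (1 - t)) - rsum n f) + (rsum n f - dint f) by ring.
rewrite (le_trans (cmodD _ _)) //; lra.
Qed.
End Integral.

(** * Goursat and Cauchy *)

Section Goursat.
Variable R : realType.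
Local Notation C := (Cplx R).
Implicit Types (f g : C -> C) (A : C -> Prop) (a b c z w p : C) (t : R).

Definition pt a b t : C := a + rc t * (b - a).
Definition seg f a b : C := (b - a) * dint (fun t => f (pt a b t)).
Definition scont f a b := cont01 (fun t => f (pt a b t)).
Definition tri f a b c : C := seg f a b + seg f b c + seg f c a.

Lemma half_rc : (2^-1 : C) = rc (2^-1 : R).
Proof. by rewrite rcV rcn. Qed.
Lemma cmod_half z : cmod (z / 2) = cmod z / 2.
Proof. by rewrite cmodM half_rc cmod_rc ger0_norm // invr_ge0. Qed.

Lemma pt_lo a b t : pt a b (t / 2) = pt a ((a + b) / 2) t.
Proof. rewrite /pt rcM -half_rc; by field. Qed.
Lemma pt_hi a b t : pt a b ((1 + t) / 2) = pt ((a + b) / 2) b t.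
Proof. rewrite /pt rcM -half_rc rcD rc1; by field. Qed.
Lemma pt_rev a b t : pt a b (1 - t) = pt b a t.
Proof. rewrite /pt rcB rc1; ring. Qed.

Lemma seg_half f a b : scont f a b -> seg f a b = seg f a ((a + b) / 2) + seg f ((a + b) / 2) b.
Proof.
move=> H; rewrite /seg (dint_half H).
rewrite (@dint_ext _ (lo _) (fun t => f (pt a ((a + b) / 2) t))); last by move=> t _; rewrite /lo pt_lo.
rewrite (@dint_ext _ (hi _) (fun t => f (pt ((a + b) / 2) b t))); last by move=> t _; rewrite /hi pt_hi.
by field.
Qed.
Lemma seg_rev f a b : scont f a b -> seg f b a = - seg f a b.
Proof.
move=> H; rewrite /seg -(dint_rev H).
under [X in _ = - (_ * dint X)]eq_fun do rewrite pt_rev.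
ring.
Qed.
Lemma seg_lin f g k l a b : scont f a b -> scont g a b ->
  seg (fun z => k * f z + l * g z) a b = k * seg f a b + l * seg g a b.
Proof. by move=> Hf Hg; rewrite /seg (dint_lin k l Hf Hg); ring. Qed.
Lemma seg_bound f a b (M : R) : scont f a b ->
  (forall t, in01 t -> cmod (f (pt a b t)) <= M) -> cmod (seg f a b) <= M * cmod (b - a).
Proof. by move=> Hf h; rewrite /seg cmodM mulrC ler_wpM2r ?cmod_ge0 // dint_bound. Qed.
Lemma seg_ext f g a b : (forall t, in01 t -> f (pt a b t) = g (pt a b t)) -> seg f a b = seg g a b.
Proof. by move=> h; rewrite /seg; congr (_ * _); apply: dint_ext. Qed.

Lemma cont01_cst c : cont01 (fun=> c : C).
Proof. by move=> s hs e e0; exists 1 => // t _ _; rewrite subrr cmod0. Qed.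
Lemma cont01_rc : cont01 (@rc R).
Proof. by move=> s hs e e0; exists e => // t _; rewrite -rcB cmod_rc. Qed.
Lemma dint_cst c : dint (fun=> c : C) = c.
Proof.
apply: dint_lim; first exact: cont01_cst.
move=> e e0; exists 0%N => n _; have -> : rsum n (fun=> c) = c.
  by elim: n => //= n IH; rewrite /lo /hi IH; by field.
by rewrite subrr cmod0 ltW.
Qed.
(** The substitution [t -> 1 - t] gives [I = 1 - I], so no Riemann sum has to be evaluated. *)
Lemma dint_rc : dint (@rc R) = 2^-1.
Proof.
have h : dint (@rc R) = 1 - dint (@rc R).
  have := dint_lin 1 (-1) (cont01_cst 1) cont01_rc; rewrite dint_cst mul1r mulN1r => <-.
  rewrite -{1}(dint_rev cont01_rc); apply: dint_ext => t _.
  by rewrite rcB rc1; ring.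
apply: (@mulfI _ 2); first by rewrite pnatr_eq0.
by rewrite divff ?pnatr_eq0 // mulr_natl mulr2n {1}h subrK.
Qed.
(** The midpoint rule is exact on affine functions; in [goursat] their contributions around a
    triangle therefore cancel by algebra alone. *)
Lemma seg_aff a b k l : seg (fun z => k + l * z) a b = (b - a) * (k + l * ((a + b) / 2)).
Proof.
rewrite /seg; congr (_ * _).
have -> : (fun t => k + l * pt a b t) = (fun t => (k + l * a) * 1 + (l * (b - a)) * rc t).
  by apply/funext => t; rewrite /pt; ring.
rewrite (dint_lin _ _ (cont01_cst 1) cont01_rc) dint_cst dint_rc; by field.
Qed.

(** Convexity, sequential closedness and relative continuity, in just the form that the nested
    triangles consume. *)
Definition conv A := forall a b t, A a -> A b -> in01 t -> A (pt a b t).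
Definition clo A := forall x l, slim x l -> (forall n : nat, A (x n)) -> A l.
Definition conton f A := forall z, A z -> forall e : R, 0 < e ->
  exists2 d : R, 0 < d & forall w, A w -> cmod (w - z) < d -> cmod (f w - f z) < e.

Lemma pt_dist a b t s : cmod (pt a b t - pt a b s) = `|t - s| * cmod (b - a).
Proof.
have -> : pt a b t - pt a b s = rc (t - s) * (b - a) by rewrite /pt rcB; ring.
by rewrite cmodM cmod_rc.
Qed.

Lemma conton_seg f A a b : conv A -> conton f A -> A a -> A b -> scont f a b.
Proof.
move=> cA cf Aa Ab s hs e e0.
have [d d0 Hd] := cf _ (cA a b s Aa Ab hs) e e0.
have h0 := cmod_ge0 (b - a).
have D0 : 0 < d / (cmod (b - a) + 1) by rewrite divr_gt0 //; lra.
exists (d / (cmod (b - a) + 1)) => // t ht; rewrite ltr_pdivlMr; last by lra.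
move=> ts; apply: Hd; first exact: cA.
rewrite pt_dist; have := normr_ge0 (t - s); nra.
Qed.

Lemma diff_conton f A : (forall z, A z -> differentiable f z) -> conton f A.
Proof.
move=> H z /H /differentiable_continuous /ccontP h e /h [d d0 Hd].
by exists d => // w _; exact: Hd.
Qed.

Lemma conv_mid A a b : conv A -> A a -> A b -> A ((a + b) / 2).
Proof.
move=> cA Aa Ab; have -> : (a + b) / 2 = pt a b (2^-1) by rewrite /pt -half_rc; by field.
by apply: cA => //; rewrite /in01; apply/andP; split; lra.
Qed.

Lemma lt_sum4_quarter (x x1 x2 x3 x4 : R) : x1 < x / 4 -> x2 < x / 4 -> x3 < x / 4 -> x4 < x / 4 ->
  x <= x1 + (x2 + (x3 + (x4 + 0))) -> False.
Proof. lra. Qed.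

Section Triangle.
Variables (f : C -> C) (A : C -> Prop).
Hypotheses (cA : conv A) (clA : clo A) (df : forall z, A z -> differentiable f z).

Let cf := diff_conton df.
Let sc a b : A a -> A b -> scont f a b := conton_seg cA cf.
Let T := (C * C * C)%type.
Let triT (x : T) := tri f x.1.1 x.1.2 x.2.
Let AT (x : T) := [/\ A x.1.1, A x.1.2 & A x.2].
Let per (x : T) : R := cmod (x.1.1 - x.1.2) + cmod (x.1.2 - x.2) + cmod (x.2 - x.1.1).
(** Three corner triangles and the medial one, all oriented like the parent, so that each inner edge
    is run through once in each direction. *)
Let child (i : 'I_4) (x : T) : T :=
  let: (a, b, c) := x in
  let m1 := (a + b) / 2 in let m2 := (b + c) / 2 in let m3 := (c + a) / 2 in
  nth (a, m1, m3) [:: (a, m1, m3); (m1, b, m2); (m3, m2, c); (m1, m2, m3)] i.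

Let child_AT i x : AT x -> AT (child i x).
Proof.
case: x => [[a b] c] [/= Aa Ab Ac].
have h1 := conv_mid cA Aa Ab; have h2 := conv_mid cA Ab Ac; have h3 := conv_mid cA Ac Aa.
by case: i => [[|[|[|[|//]]]]] i4.
Qed.

Let child_per i x : per (child i x) = per x / 2.
Proof.
case: x => [[a b] c]; rewrite /per [RHS]mulrDl [X in _ = X + _]mulrDl -!cmod_half.
case: i => [[|[|[|[|//]]]]] i4; rewrite /child /=.
- rewrite (_ : a - (a + b) / 2 = (a - b) / 2); last by field.
  rewrite (_ : (a + b) / 2 - (c + a) / 2 = (b - c) / 2); last by field.
  by rewrite (_ : (c + a) / 2 - a = (c - a) / 2); last by field.
- rewrite (_ : (a + b) / 2 - b = (a - b) / 2); last by field.
  rewrite (_ : b - (b + c) / 2 = (b - c) / 2); last by field.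
  by rewrite (_ : (b + c) / 2 - (a + b) / 2 = (c - a) / 2); last by field.
- rewrite (_ : (c + a) / 2 - (b + c) / 2 = (a - b) / 2); last by field.
  rewrite (_ : (b + c) / 2 - c = (b - c) / 2); last by field.
  by rewrite (_ : c - (c + a) / 2 = (c - a) / 2); last by field.
- rewrite (_ : (a + b) / 2 - (b + c) / 2 = - ((c - a) / 2)); last by field.
  rewrite (_ : (b + c) / 2 - (c + a) / 2 = - ((a - b) / 2)); last by field.
  rewrite (_ : (c + a) / 2 - (a + b) / 2 = - ((b - c) / 2)); last by field.
  by rewrite !cmodN; ring.
Qed.

(** Makes the first vertices of the nested triangles a Cauchy sequence, which provides the limit
    point. *)
Let child_fst i x : cmod ((child i x).1.1 - x.1.1) <= per x / 2.
Proof.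
case: x => [[a b] c]; rewrite /per /=.
have h1 := cmod_ge0 (a - b); have h2 := cmod_ge0 (b - c); have h3 := cmod_ge0 (c - a).
have k1 : cmod ((a + b) / 2 - a) = cmod (a - b) / 2.
  by rewrite (_ : (a + b) / 2 - a = - ((a - b) / 2)) ?cmodN ?cmod_half //; by field.
have k2 : cmod ((c + a) / 2 - a) = cmod (c - a) / 2.
  by rewrite (_ : (c + a) / 2 - a = (c - a) / 2) ?cmod_half //; by field.
by case: i => [[|[|[|[|//]]]]] i4; rewrite /child /= ?subrr ?cmod0 ?k1 ?k2; lra.
Qed.

Let tri_split x : AT x -> triT x = \sum_i triT (child i x).
Proof.
case: x => [[a b] c] [/= Aa Ab Ac].
have h1 := conv_mid cA Aa Ab; have h2 := conv_mid cA Ab Ac; have h3 := conv_mid cA Ac Aa.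
rewrite !big_ord_recl big_ord0 /triT /child /tri /=.
rewrite (seg_half (sc Aa Ab)) (seg_half (sc Ab Ac)) (seg_half (sc Ac Aa)).
rewrite (seg_rev (sc h1 h3)) (seg_rev (sc h2 h1)) (seg_rev (sc h3 h2)).
ring.
Qed.

Let child_big x : AT x -> exists i, cmod (triT x) <= 4 * cmod (triT (child i x)).
Proof.
move=> Ax; apply: contrapT => /forallNP h.
have {}h i : cmod (triT (child i x)) < cmod (triT x) / 4.
  by rewrite ltr_pdivlMr // mulrC ltNge; apply/negP; exact: h.
have := cmod_sum (index_enum 'I_4) xpredT (fun i => triT (child i x)).
rewrite -tri_split // !big_ord_recl big_ord0.
by apply: lt_sum4_quarter; exact: h.
Qed.

(** Bisection keeps a child with at least a quarter of the integral while perimeters halve. Near the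
    limit point [l] the function is affine up to [e * cmod (z - l)], so the [N]-th integral is at
    most [2 * e] times a squared perimeter of order [4 ^- N]. This cancels the factor [4 ^+ N], and
    [e] is arbitrary. *)
Lemma goursat a b c : A a -> A b -> A c -> tri f a b c = 0.
Proof.
move=> Aa Ab Ac.
have [nx Hnx] : exists nx : T -> 'I_4, forall x, AT x ->
    cmod (triT x) <= 4 * cmod (triT (child (nx x) x)).
  have : forall x, exists i, AT x -> cmod (triT x) <= 4 * cmod (triT (child i x)).
    move=> x; have [Ax|nAx] := pselect (AT x); last by exists ord0.
    by have [i Hi] := child_big Ax; exists i.
  by move=> /choice[nx Hnx]; exists nx.
pose S n := iter n (fun x => child (nx x) x) (a, b, c).
have AS n : AT (S n) by elim: n => [//|n IH] /=; apply: child_AT.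
have perS n : per (S n) = per (a, b, c) / 2 ^+ n.
  elim: n => [|n IH]; first by rewrite expr0 divr1.
  by rewrite /= child_per -/(S n) IH exprS invfM mulrA mulrAC.
have triS n : cmod (triT (a, b, c)) <= 4 ^+ n * cmod (triT (S n)).
  elim: n => [|n IH]; first by rewrite expr0 mul1r.
  apply: le_trans IH _; rewrite exprSr -mulrA ler_wpM2l ?exprn_ge0 //.
  exact: Hnx.
have per0 x : 0 <= per x by rewrite /per !addr_ge0 // cmod_ge0.
(* The drift is a geometric sum [per (S n) * (1/2 + ... + 1/2^k)]. *)
have drift n k : cmod ((S (n + k)%N).1.1 - (S n).1.1) <= per (S n) * (1 - 2^-1 ^+ k).
  elim: k => [|k IH]; first by rewrite addn0 subrr cmod0 expr0 subrr mulr0.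
  rewrite addnS; have -> : (S (n + k).+1).1.1 - (S n).1.1 =
    ((S (n + k).+1).1.1 - (S (n + k)%N).1.1) + ((S (n + k)%N).1.1 - (S n).1.1) by ring.
  rewrite (le_trans (cmodD _ _)) //.
  have h : cmod ((S (n + k).+1).1.1 - (S (n + k)%N).1.1) <= per (S (n + k)%N) / 2 by exact: child_fst.
  have e2 : per (S (n + k)%N) = per (S n) * 2^-1 ^+ k.
    by rewrite !perS exprD invfM mulrA exprVn.
  rewrite exprS; rewrite e2 in h.
  have -> : per (S n) * (1 - 2^-1 * 2^-1 ^+ k) =
    per (S n) * 2^-1 ^+ k / 2 + per (S n) * (1 - 2^-1 ^+ k) by field.
  exact: lerD.
have small (e : R) : 0 < e -> exists N, forall n, (N <= n)%N -> per (S n) <= e.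
  move=> e0; have h : `|2^-1 : R| < 1 by rewrite ger0_norm ?invr_ge0 //; lra.
  have p1 : 0 < per (a, b, c) + 1 by have := per0 (a, b, c); lra.
  have d0 : 0 < e / (per (a, b, c) + 1) by rewrite divr_gt0.
  have /cvgrPdist_lt/(_ _ d0)[N _ HN] := cvg_expr h.
  exists N => n /HN /=; rewrite sub0r normrN perS -exprVn => hn.
  have {}hn := le_lt_trans (ler_norm _) hn; rewrite ltr_pdivlMr // in hn.
  have : 0 <= 2^-1 ^+ n :> R by rewrite exprn_ge0 // invr_ge0.
  lra.
have [l Hl] : exists l, slim (fun n => (S n).1.1) l.
  apply: slim_complete => e e0; have [N HN] := small e e0; exists N => n Nn.
  rewrite -(subnKC Nn) (le_trans (drift _ _)) // (le_trans _ (HN N (leqnn _))) // ler_piMr ?per0 //.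
have Al : A l by apply: clA Hl _ => n; have [] := AS n.
have dl n : cmod (l - (S n).1.1) <= per (S n).
  apply/ler_addgt0Pr => e e0; have [N HN] := Hl e e0.
  have := HN (n + N)%N (leq_addl _ _); have := drift n N.
  set x := (S (n + N)%N).1.1 => h1 h2.
  have -> : l - (S n).1.1 = (x - (S n).1.1) - (x - l) by ring.
  rewrite (le_trans (cmodB _ _)) // lerD // (le_trans h1) // ler_piMr ?per0 //.
have [l' /cderP Hl'] : exists l', cder l f l' by apply/diff_derP; exact: df.
have bnd (e : R) : 0 < e -> cmod (triT (a, b, c)) <= e * (2 * per (a, b, c) ^+ 2).
  move=> e0; have [d d0 Hd] := Hl' e e0.
  (* The sides of the [N]-th triangle stay within [2 * per (S N)] of [l]; a third of [d] keeps this
     below [d]. *)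
  have d20 : 0 < d / 3 by lra.
  have [N /(_ N (leqnn _)) HN] := small _ d20.
  have vert x y : (x = (S N).1.1 \/ x = (S N).1.2 \/ x = (S N).2) ->
      (y = (S N).1.1 \/ y = (S N).1.2 \/ y = (S N).2) ->
      forall t, in01 t -> cmod (pt x y t - l) <= 2 * per (S N).
    have v x' : (x' = (S N).1.1 \/ x' = (S N).1.2 \/ x' = (S N).2) ->
        cmod (x' - l) <= 2 * per (S N).
      have := dl N; rewrite /per cmodBC.
      have h1 := cmod_ge0 ((S N).1.1 - (S N).1.2); have h2 := cmod_ge0 ((S N).1.2 - (S N).2).
      have h3 := cmod_ge0 ((S N).2 - (S N).1.1).
      move=> h [->|[->|->]].
      - by lra.
      - have -> : (S N).1.2 - l = ((S N).1.1 - l) - ((S N).1.1 - (S N).1.2) by ring.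
        by rewrite (le_trans (cmodB _ _)) //; lra.
      - have -> : (S N).2 - l = ((S N).1.1 - l) + ((S N).2 - (S N).1.1) by ring.
        by rewrite (le_trans (cmodD _ _)) //; lra.
    move=> /v hx /v hy t /andP[t0 t1].
    have -> : pt x y t - l = rc (1 - t) * (x - l) + rc t * (y - l) by rewrite /pt rcB rc1; ring.
    rewrite (le_trans (cmodD _ _)) // !cmodM !cmod_rc !ger0_norm //; last by lra.
    by nra.
  pose g z := f z - (f l + l' * (z - l)).
  (* The integral of the affine approximation is removed from each side; these three terms sum to
     zero around the triangle, which is the identity closed by [field] in [key]. *)
  have gb x y : (x = (S N).1.1 \/ x = (S N).1.2 \/ x = (S N).2) ->
      (y = (S N).1.1 \/ y = (S N).1.2 \/ y = (S N).2) -> A x -> A y ->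
      cmod (seg f x y - (y - x) * ((f l - l' * l) + l' * ((x + y) / 2))) <=
        e * (2 * per (S N)) * cmod (x - y).
    move=> hx hy Ax Ay.
    rewrite -seg_aff.
    have cl : scont (fun z => (f l - l' * l) + l' * z) x y.
      apply: (@conton_seg _ A) => //; apply: diff_conton => z _.
      by apply/diff_derP; eexists; exact: der_add (der_cst _ _) (der_mul (der_cst _ _) (der_id _)).
    have -> : seg f x y - seg (fun z => (f l - l' * l) + l' * z) x y =
        seg (fun z => 1 * f z + (-1) * ((f l - l' * l) + l' * z)) x y.
      by rewrite seg_lin ?mul1r ?mulN1r //; exact: sc.
    rewrite (cmodBC x y); apply: seg_bound.
      have cl2 := cont01_lin 1 (-1) (sc Ax Ay) cl; exact: cl2.
    move=> t ht; have v := vert x y hx hy t ht.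
    have : cmod (pt x y t - l) < d by rewrite (le_lt_trans v) //; lra.
    move=> /Hd h; rewrite mul1r mulN1r.
    have -> : f (pt x y t) - (f l - l' * l + l' * pt x y t) =
      f (pt x y t) - f l - l' * (pt x y t - l) by ring.
    by rewrite (le_trans h) // ler_wpM2l // ltW.
  have [A1 A2 A3] := AS N.
  have g1 := gb _ _ (or_introl erefl) (or_intror (or_introl erefl)) A1 A2.
  have g2 := gb _ _ (or_intror (or_introl erefl)) (or_intror (or_intror erefl)) A2 A3.
  have g3 := gb _ _ (or_intror (or_intror erefl)) (or_introl erefl) A3 A1.
  have key : cmod (triT (S N)) <= e * (2 * per (S N)) * per (S N).
    set M := e * (2 * per (S N)) in g1 g2 g3 *; rewrite /per !mulrDr.
    rewrite /triT /tri.
    have -> : seg f (S N).1.1 (S N).1.2 + seg f (S N).1.2 (S N).2 + seg f (S N).2 (S N).1.1 =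
     (seg f (S N).1.1 (S N).1.2 - ((S N).1.2 - (S N).1.1) *
       (f l - l' * l + l' * (((S N).1.1 + (S N).1.2) / 2))) +
     (seg f (S N).1.2 (S N).2 - ((S N).2 - (S N).1.2) *
       (f l - l' * l + l' * (((S N).1.2 + (S N).2) / 2))) +
     (seg f (S N).2 (S N).1.1 - ((S N).1.1 - (S N).2) *
       (f l - l' * l + l' * (((S N).2 + (S N).1.1) / 2))) by field.
    rewrite (le_trans (cmodD _ _)) // lerD // (le_trans (cmodD _ _)) // lerD //.
  apply: le_trans (triS N) _.
  apply: le_trans (ler_wpM2l _ key) _; first by rewrite exprn_ge0.
  rewrite perS.
  have -> : (4 : R) ^+ N = 2 ^+ N * 2 ^+ N by rewrite -exprMn; congr (_ ^+ _); ring.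
  have : (2 : R) ^+ N != 0 by rewrite expf_neq0.
  move=> h; rewrite le_eqVlt; apply/orP; left; apply/eqP; field; exact: h.
apply/eqP; rewrite -cmod_eq0 eq_le cmod_ge0 andbT.
pose M := 2 * per (a, b, c) ^+ 2.
have M0 : 0 <= M by rewrite mulr_ge0 // exprn_ge0.
apply/ler_addgt0Pr => e e0; rewrite add0r.
have eM : 0 < e / (M + 1) by rewrite divr_gt0 //; lra.
apply: le_trans (bnd _ eM) _; rewrite -/M mulrAC ler_pdivrMr; last by lra.
by rewrite ler_pM2l //; lra.
Qed.
End Triangle.
End Goursat.

Section Cauchy.
Variable R : realType.
Local Notation C := (Cplx R).
Implicit Types (f g q : C -> C) (a b c z w p : C) (t : R).

Definition dv f z : C := 'D_1 f z.
Lemma dvP f z : differentiable f z -> cder z f (dv f z).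
Proof. by move=> /diff_derP [l h]; rewrite /dv (@derive_val _ _ _ _ _ _ _ h). Qed.
Lemma dv_eq f z l : cder z f l -> dv f z = l.
Proof. by move=> h; rewrite /dv (@derive_val _ _ _ _ _ _ _ h). Qed.
Lemma der_diff f z l : cder z f l -> differentiable f z.
Proof. by move=> h; apply/diff_derP; exists l. Qed.

(** Half-planes are written [M <= cre (w * (x - z))], with [w] the conjugate of a normal vector;
    this is their closedness. *)
Lemma slim_cre (x : nat -> C) l w z (M : R) : slim x l ->
  (forall n, M <= cre (w * (x n - z))) -> M <= cre (w * (l - z)).
Proof.
move=> H h; apply/ler_addgt0Pr => e e0.
have k0 : 0 < cmod w + 1 by have := cmod_ge0 w; lra.
have ek : 0 < e / (cmod w + 1) by rewrite divr_gt0.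
have [N HN] := H _ ek; have := HN N (leqnn _); rewrite ler_pdivlMr // => h2.
have := h N; have := cmod_cre (w * (x N - l)); rewrite cmodM.
have -> : w * (x N - z) = w * (x N - l) + w * (l - z) by ring.
rewrite creD; have := ler_norm (cre (w * (x N - l))).
have := cmod_ge0 (x N - l); have := cmod_ge0 w; nra.
Qed.

Lemma cre_pt w z a b t : cre (w * (pt a b t - z)) =
  (1 - t) * cre (w * (a - z)) + t * cre (w * (b - z)).
Proof.
have -> : w * (pt a b t - z) = rc (1 - t) * (w * (a - z)) + rc t * (w * (b - z)).
  by rewrite /pt rcB rc1; ring.
by rewrite creD !(creM (rc _)) !cim_rc !cre_rc !mul0r !subr0.
Qed.

(** * Goursat for triangles with an exceptional vertex *)

Section Vertex.
Variables (q : C -> C) (B : C -> Prop) (z w : C).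
Hypotheses (cB : conv B) (clB : clo B) (cq : conton q B) (Bz : B z).
Hypothesis dq : forall x, B x -> x != z -> differentiable q x.

Let sc a b : B a -> B b -> scont q a b := conton_seg cB cq.

(** The trapezoid between the triangle and its half-size copy at [z] lies in the half-plane at
    height at least [d / 2], away from [z]; a diagonal cuts it into two triangles to which [goursat]
    applies. *)
Lemma tri_vertex_half a b (d : R) : B a -> B b -> 0 < d ->
  cre (w * (a - z)) = d -> cre (w * (b - z)) = d ->
  tri q z a b = tri q z ((z + a) / 2) ((z + b) / 2).
Proof.
move=> Ba Bb d0 Ha Hb.
pose A x := B x /\ d / 2 <= cre (w * (x - z)).
have cA : conv A.
  move=> x y t [Bx hx] [By hy] /[dup] ht /andP[t0 t1]; split; first exact: cB.
  by rewrite cre_pt; nra.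
have clA : clo A.
  move=> x l Hl h; split; first by apply: clB Hl _ => n; have [] := h n.
  by apply: slim_cre Hl _ => n; have [] := h n.
have dA x : A x -> differentiable q x.
  move=> [Bx hx]; apply: dq => //; apply/eqP => e; move: hx.
  by rewrite e subrr mulr0 -rc0 cre_rc; lra.
set m1 := (z + a) / 2; set m2 := (z + b) / 2.
have mid x : B x -> cre (w * (x - z)) = d -> A ((z + x) / 2).
  move=> Bx hx; split; first exact: conv_mid.
  rewrite (_ : w * _ = rc (2^-1) * (w * (x - z))); last by rewrite -half_rc; field.
  by rewrite creM cim_rc cre_rc mul0r subr0 hx; lra.
have A1 : A m1 by apply: mid.
have A2 : A m2 by apply: mid.
have Aa : A a by split=> //; lra.
have Ab : A b by split=> //; lra.
have [[B1 _] [B2 _]] := (A1, A2).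
have g1 := goursat cA clA dA A1 Aa Ab; have g2 := goursat cA clA dA A1 Ab A2.
rewrite /tri (seg_half (sc Bz Ba)) (seg_half (sc Bb Bz)) -/m1 (addrC b z) -/m2.
move: g1 g2; rewrite /tri (seg_rev (sc B1 Bb)) (seg_rev (sc B1 B2)) => g1 g2.
transitivity (seg q z m1 + seg q m1 m2 + seg q m2 z +
  (seg q m1 a + seg q a b - seg q m1 b) + (seg q m1 b + seg q b m2 - seg q m1 m2)); first by ring.
by rewrite g1 g2 !addr0.
Qed.

(** Halving repeatedly shrinks the triangle to [z], where continuity keeps [q] bounded, so its
    integral is smaller than any [e]. *)
Lemma tri_vertex a b (d : R) : B a -> B b -> 0 < d ->
  cre (w * (a - z)) = d -> cre (w * (b - z)) = d -> tri q z a b = 0.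
Proof.
move=> Ba Bb d0 Ha Hb.
pose A n x : C := z + (x - z) / 2 ^+ n.
have A0 x : A 0%N x = x by rewrite /A expr0; field.
have two n : (2 : C) ^+ n != 0 by rewrite expf_neq0 // pnatr_eq0.
have AS n x : (z + A n x) / 2 = A n.+1 x.
  by rewrite /A exprS; field; exact: two.
have AB n x : B x -> B (A n x).
  by move=> Bx; elim: n => [|n IH]; rewrite ?A0 // -AS; apply: conv_mid.
have Ad n x : cre (w * (x - z)) = d -> cre (w * (A n x - z)) = d / 2 ^+ n.
  move=> h; rewrite (_ : w * _ = rc (2 ^- n) * (w * (x - z))).
    by rewrite creM cim_rc cre_rc mul0r subr0 h mulrC.
  by rewrite rcV rcX rcn /A; field; exact: two.
have E n : tri q z a b = tri q z (A n a) (A n b).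
  elim: n => [|n IH]; first by rewrite !A0.
  rewrite IH (@tri_vertex_half _ _ (d / 2 ^+ n)) ?AS ?Ad ?divr_gt0 ?exprn_gt0 //; exact: AB.
apply/eqP; rewrite -cmod_eq0 eq_le cmod_ge0 andbT; apply/ler_addgt0Pr => e e0; rewrite add0r.
have [dl dl0 Hd] := cq Bz ltr01.
pose P := cmod (a - z) + cmod (b - a) + cmod (z - b).
have P0 : 0 <= P by rewrite !addr_ge0 // cmod_ge0.
pose M := (cmod (q z) + 1) * P.
have qz0 := cmod_ge0 (q z).
have M0 : 0 <= M by rewrite mulr_ge0 //; lra.
(* The first bound puts the shrunken triangle where [q] is within [1] of [q z]; the second brings
   its perimeter times [cmod (q z) + 1] below [e]. *)
pose K := Num.min (dl / (P + 1)) (e / (M + 1)).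
have K0 : 0 < K by rewrite lt_min !divr_gt0 //; lra.
have h : `|2^-1 : R| < 1 by rewrite ger0_norm ?invr_ge0 //; lra.
have /cvgrPdist_lt/(_ _ K0)[N _ /(_ N (leqnn _))] := cvg_expr h.
rewrite /= sub0r normrN => HN.
set k := 2^-1 ^+ N in HN.
have k0 : 0 <= k by rewrite exprn_ge0 // invr_ge0.
have kE : k = (2 ^+ N)^-1 by rewrite /k exprVn.
rewrite ger0_norm // lt_min ltr_pdivlMr ?ltr_pdivlMr in HN; try lra.
move/andP: HN => [kd ke].
have dA x y : cmod (A N x - A N y) = k * cmod (x - y).
  rewrite (_ : A N x - A N y = rc k * (x - y)); first by rewrite cmodM cmod_rc ger0_norm.
  by rewrite kE rcV rcX rcn /A; field; exact: two.
have dz x : cmod (A N x - z) = k * cmod (x - z).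
  by rewrite -dA; congr cmod; rewrite /A; field; exact: two.
have le3 : [/\ cmod (a - z) <= P, cmod (b - z) <= P & cmod (b - a) <= P].
  have := cmod_ge0 (a - z); have := cmod_ge0 (b - a); have := cmod_ge0 (z - b).
  rewrite (cmodBC b z) /P; move: (cmod _) (cmod _) (cmod _) => x1 x2 x3 ? ? ?; split; lra.
have [la lb lab] := le3.
have bd x y : (x = z \/ x = A N a \/ x = A N b) -> (y = z \/ y = A N a \/ y = A N b) ->
    cmod (seg q x y) <= (cmod (q z) + 1) * cmod (y - x).
  have v x' : (x' = z \/ x' = A N a \/ x' = A N b) -> B x' /\ cmod (x' - z) <= k * P.
    by move=> [->|[->|->]]; split;
      first [exact: Bz | exact: AB | by rewrite ?subrr ?cmod0 ?dz ?mulr_ge0 ?ler_wpM2l].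
  move=> /v [Bx hx] /v [By hy]; apply: seg_bound; first exact: sc.
  move=> t /[dup] ht /andP[t0 t1].
  have : cmod (pt x y t - z) < dl.
    have -> : pt x y t - z = rc (1 - t) * (x - z) + rc t * (y - z) by rewrite /pt rcB rc1; ring.
    rewrite (le_lt_trans (cmodD _ _)) // !cmodM !cmod_rc !ger0_norm; try lra.
    by nra.
  move=> /(Hd _ (cB Bx By ht)) hq.
  have -> : q (pt x y t) = (q (pt x y t) - q z) + q z by ring.
  by rewrite (le_trans (cmodD _ _)) //; lra.
rewrite (E N) /tri (le_trans (cmodD _ _)) //.
have b1 := bd z (A N a) (or_introl erefl) (or_intror (or_introl erefl)).
have b2 := bd (A N a) (A N b) (or_intror (or_introl erefl)) (or_intror (or_intror erefl)).
have b3 := bd (A N b) z (or_intror (or_intror erefl)) (or_introl erefl).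
apply: le_trans (lerD (le_trans (cmodD _ _) (lerD b1 b2)) b3) _.
rewrite dA dz (cmodBC z) dz -!mulrDr (cmodBC b z).
by rewrite -/P mulrCA -/M; lra.
Qed.
End Vertex.

(** * The square contour and Cauchy integrals over it *)

Section Diamond.
Variables (p : C) (r : R).
Hypothesis r0 : 0 < r.
Local Ltac rlra := have := r0; lra.
Local Ltac rnra := have := r0; nra.
Local Notation I := (cI R).

Definition vx (k : nat) : C := p + rc r * I ^+ k.
(** Conjugate of a normal to the [k]-th side: [wx k * (vx k - p)] and [wx k * (vx k.+1 - p)] both
    have real part [r]. *)
Let wx (k : nat) : C := (1 - I) * (- I) ^+ k.
Definition disc z := cmod (z - p) <= r.
(** The whole cap of the disc cut off by the [k]-th side, not just the side; thus [edge] is the disc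
    minus the open square. A cap is convex and given by a single linear inequality, so a side lies
    in it as soon as its ends do. *)
Let side k z := disc z /\ r <= cre (wx k * (z - p)).
Definition edge z := exists k : 'I_4, side k z.

Let II : I * I = -1.
Proof. by apply: cplx_eq; rewrite !cE -?rc1 ?cE; ring. Qed.
Let INI k : (- I) ^+ k * I ^+ k = 1.
Proof. by rewrite -exprMn mulNr II opprK expr1n. Qed.
Let wv k : wx k * (vx k - p) = rc r * (1 - I).
Proof.
rewrite /wx /vx (addrC p) addrK.
transitivity (rc r * ((- I) ^+ k * I ^+ k) * (1 - I)); first by ring.
by rewrite INI mulr1.
Qed.
Let wvS k : wx k * (vx k.+1 - p) = rc r * (1 + I).
Proof.
rewrite /wx /vx (addrC p) addrK exprS.
transitivity (rc r * ((- I) ^+ k * I ^+ k) * ((1 - I) * I)); first by ring.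
by rewrite INI mulrBl II; ring.
Qed.
Let cmodIX k : cmod (I ^+ k) = 1.
Proof. by rewrite cmodX cmodI expr1n. Qed.
Let cmod1I : cmod (1 - I) <= 2.
Proof. by rewrite (le_trans (cmodB _ _)) // cmod1 cmodI; rlra. Qed.
Let cmodw k : cmod (wx k) <= 2.
Proof. rewrite cmodM cmodX cmodN cmodI expr1n mulr1; exact: cmod1I. Qed.
Let vdisc k : disc (vx k).
Proof. by rewrite /disc /vx (addrC p) addrK cmodM cmodIX mulr1 cmod_rc gtr0_norm. Qed.
Let vside k : side k (vx k).
Proof.
split; first exact: vdisc.
by rewrite wv -rc1 !cE; rlra.
Qed.
Let vsideS k : side k (vx k.+1).
Proof. by split; [exact: vdisc | rewrite wvS -rc1 !cE; rlra]. Qed.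

Lemma disc_conv : conv disc.
Proof.
move=> x y t hx hy /andP[t0 t1]; rewrite /disc.
have -> : pt x y t - p = rc (1 - t) * (x - p) + rc t * (y - p) by rewrite /pt rcB rc1; ring.
rewrite (le_trans (cmodD _ _)) // !cmodM !cmod_rc !ger0_norm; try rlra.
by move: hx hy; rewrite /disc; rnra.
Qed.
Lemma disc_clo : clo disc.
Proof. by move=> x l H h; exact: slim_dist H h. Qed.
Let side_conv k : conv (side k).
Proof.
move=> x y t [hx kx] [hy ky] /[dup] ht /andP[t0 t1]; split; first exact: disc_conv.
by rewrite cre_pt; rnra.
Qed.
Let side_pt (k : 'I_4) t : in01 t -> side k (pt (vx k) (vx k.+1) t).
Proof. by move=> ht; exact: side_conv (vside k) (vsideS k) ht. Qed.
Let edge_pt (k : 'I_4) t : in01 t -> edge (pt (vx k) (vx k.+1) t).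
Proof. by move=> ht; exists k; exact: side_pt. Qed.
Lemma edge_disc z : edge z -> disc z.
Proof. by move=> [k []]. Qed.
Lemma edge_p z : edge z -> r / 2 <= cmod (z - p).
Proof.
move=> [k [_ h]]; have := cmod_cre (wx k * (z - p)); rewrite cmodM.
have := ler_norm (cre (wx k * (z - p))); have := cmodw k; have := cmod_ge0 (z - p); rnra.
Qed.
Let side_z k z x : cmod (z - p) < r / 4 -> side k x -> r / 2 <= cre (wx k * (x - z)).
Proof.
move=> hz [_ h].
have -> : wx k * (x - z) = wx k * (x - p) - wx k * (z - p) by ring.
rewrite creD creN; have := cmod_cre (wx k * (z - p)); rewrite cmodM.
have := ler_norm (cre (wx k * (z - p))); have := cmodw k; have := cmod_ge0 (z - p); rnra.
Qed.
(** The origin of the radius [r / 4] used throughout: with [cmod (wx k) <= 2], moving from [p] to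
    [z] costs at most [r / 2] of the height [r] of the side, and the remaining [r / 2] gives
    distance at least [r / 4]. *)
Lemma edge_z z x : cmod (z - p) < r / 4 -> edge x -> r / 4 <= cmod (x - z).
Proof.
move=> hz [k /(side_z hz) h]; have := cmod_cre (wx k * (x - z)); rewrite cmodM.
have := ler_norm (cre (wx k * (x - z))); have := cmodw k; have := cmod_ge0 (x - z); rnra.
Qed.
Lemma edge_neq z x : cmod (z - p) < r / 4 -> edge x -> x - z != 0.
Proof. by move=> hz hx; rewrite -cmod_gt0; apply: lt_le_trans (edge_z hz hx); rewrite divr_gt0. Qed.
Lemma edge_le z x : cmod (z - p) < r / 4 -> edge x -> cmod (x - z) <= 2 * r.
Proof.
move=> hz /edge_disc hx; have -> : x - z = (x - p) - (z - p) by ring.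
by rewrite (le_trans (cmodB _ _)) //; move: hx; rewrite /disc; rlra.
Qed.

Definition oint f : C := \sum_(k < 4) seg f (vx k) (vx k.+1).
Definition dedge f := forall x, edge x -> differentiable f x.

Let dedge_scont f (k : 'I_4) : dedge f -> scont f (vx k) (vx k.+1).
Proof.
move=> df; apply: (@conton_seg _ _ (side k)) => //.
by apply: diff_conton => x hx; apply: df; exists k.
Qed.

Lemma oint_lin f g a b : dedge f -> dedge g ->
  oint (fun x => a * f x + b * g x) = a * oint f + b * oint g.
Proof.
move=> df dg; rewrite /oint !mulr_sumr -big_split /=; apply: eq_bigr => k _.
by rewrite seg_lin //; exact: dedge_scont.
Qed.
Lemma oint_ext f g : (forall x, edge x -> f x = g x) -> oint f = oint g.
Proof. by move=> h; apply: eq_bigr => k _; apply: seg_ext => t ht; apply: h; exact: edge_pt. Qed.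
Let cmod_side k : cmod (vx k.+1 - vx k) <= 2 * r.
Proof.
have -> : vx k.+1 - vx k = rc r * I ^+ k * (I - 1) by rewrite /vx exprS; ring.
rewrite !cmodM cmodIX mulr1 cmod_rc gtr0_norm // mulrC ler_pM2r //.
rewrite cmodBC; exact: cmod1I.
Qed.
Lemma oint_bound f (M : R) : dedge f -> (forall x, edge x -> cmod (f x) <= M) ->
  cmod (oint f) <= 8 * r * M.
Proof.
move=> df h; have M0 : 0 <= M.
  by apply: le_trans (cmod_ge0 _) (h _ (@edge_pt ord0 0 _)); rewrite /in01 lexx ler01.
rewrite (le_trans (cmod_sum _ _ _)) //.
apply: le_trans (_ : \sum_(k < 4) (2 * r * M) <= _); last first.
  by rewrite sumr_const card_ord -mulr_natl; rlra.
apply: ler_sum => k _; apply: le_trans (seg_bound (dedge_scont k df) _) _; last first.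
- by rewrite mulrC; apply: ler_wpM2r => //; exact: cmod_side.
- by move=> t ht; apply: h; exact: edge_pt.
Qed.

(** Differentiation under the integral sign, from a quadratic remainder that is uniform over the
    contour. *)
Lemma oint_der (G : C -> C -> C) (G1 : C -> C) z (M : R) : cmod (z - p) < r / 4 -> 0 <= M ->
  (forall w, cmod (w - p) < r / 4 -> dedge (G w)) -> dedge G1 ->
  (forall w x, cmod (w - p) < r / 4 -> edge x ->
    cmod (G w x - G z x - G1 x * (w - z)) <= M * cmod (w - z) ^+ 2) ->
  cder z (fun w => oint (G w)) (oint G1).
Proof.
move=> hz M0 dG dG1 hM; apply/cderP => e e0.
have K0 : 0 < 8 * r * M + 1 by have := mulr_ge0 (ltW r0) M0; rlra.
exists (Num.min (r / 4 - cmod (z - p)) (e / (8 * r * M + 1))).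
  by rewrite lt_min divr_gt0 // andbT; rlra.
move=> w; rewrite lt_min => /andP[h1 h2].
have hw : cmod (w - p) < r / 4.
  have -> : w - p = (w - z) + (z - p) by ring.
  by rewrite (le_lt_trans (cmodD _ _)) //; rlra.
have dGw := dG w hw; have dGz := dG z hz.
have dsub : dedge (fun x => 1 * G w x + (-1) * G z x).
  move=> x hx; have /diff_derP [l hl] := dGw x hx; have /diff_derP [m hm] := dGz x hx.
  by diffs.
have dsub2 : dedge (fun x => 1 * (1 * G w x + (-1) * G z x) + (- (w - z)) * G1 x).
  move=> x hx; have /diff_derP [l hl] := dsub x hx; have /diff_derP [m hm] := dG1 x hx.
  by diffs.
have -> : oint (G w) - oint (G z) - oint G1 * (w - z) =
    oint (fun x => 1 * (1 * G w x + (-1) * G z x) + (- (w - z)) * G1 x).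
  by rewrite !oint_lin //; ring.
apply: le_trans (oint_bound (M := M * cmod (w - z) ^+ 2) dsub2 _) _.
  move=> x hx; have := hM w x hw hx; congr (cmod _ <= _); ring.
rewrite expr2 !mulrA ler_wpM2r ?cmod_ge0 //.
move: h2; rewrite ltr_pdivlMr // => h2.
have := cmod_ge0 (w - z); rnra.
Qed.

(** Cauchy integrals without normalisation: [K1 cst1], whose value is never computed, plays the role
    of 2 pi i. *)
Definition K1 f z := oint (fun x => f x / (x - z)).
Definition K2 f z := oint (fun x => f x / (x - z) ^+ 2).
Definition K3 f z := oint (fun x => f x / (x - z) ^+ 3).

Lemma dedge_kernel f z n : dedge f -> cmod (z - p) < r / 4 ->
  dedge (fun x => f x / (x - z) ^+ n).
Proof.
move=> df hz x hx; have /diff_derP [l hl] := df x hx.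
have n0 : (x - z) ^+ n != 0 by rewrite expf_neq0 //; exact: edge_neq.
by diffs.
Qed.
Lemma dedge_kernel1 f z : dedge f -> cmod (z - p) < r / 4 -> dedge (fun x => f x / (x - z)).
Proof. exact: (@dedge_kernel f z 1). Qed.
Lemma kernel_bound f z (S : R) n : dedge f -> cmod (z - p) < r / 4 ->
  (forall x, edge x -> cmod (f x) <= S) ->
  cmod (oint (fun x => f x / (x - z) ^+ n)) <= 8 * r * (S * (4 / r) ^+ n).
Proof.
move=> df hz hS; apply: oint_bound; first exact: dedge_kernel.
move=> x hx; rewrite cmodM cmodV cmodX.
have h1 := edge_z hz hx.
have h2 : 0 < cmod (x - z) by rlra.
rewrite ler_pM ?cmod_ge0 ?invr_ge0 ?exprn_ge0 ?cmod_ge0 ?hS // -exprVn.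
rewrite lerXn2r ?nnegrE ?invr_ge0 ?cmod_ge0 ?divr_ge0 ?(ltW r0) //.
by rewrite -[4 / r]invrK invf_div lef_pV2 ?posrE // divr_gt0.
Qed.

Let Vn y n : r / 4 <= cmod y -> cmod (y^-1 ^+ n) <= (4 / r) ^+ n.
Proof.
move=> hy; rewrite cmodX cmodV.
have r40 : 0 < r / 4 by rewrite divr_gt0.
have y0 : 0 < cmod y by apply: lt_le_trans hy.
rewrite lerXn2r ?nnegrE ?invr_ge0 ?cmod_ge0 ?divr_ge0 ?(ltW r0) //.
by rewrite -[4 / r]invrK invf_div lef_pV2 ?posrE.
Qed.

Let S_ge0 f (S : R) : (forall x, edge x -> cmod (f x) <= S) -> 0 <= S.
Proof.
move=> hS; apply: le_trans (cmod_ge0 _) (hS _ (@edge_pt ord0 0 _)).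
by rewrite /in01 lexx ler01.
Qed.

Lemma K1_der f z (S : R) : dedge f -> cmod (z - p) < r / 4 ->
  (forall x, edge x -> cmod (f x) <= S) -> cder z (K1 f) (K2 f z).
Proof.
move=> df hz hS; have S0 := S_ge0 hS.
have r40 : 0 <= 4 / r by rewrite divr_ge0 // ltW.
apply: (@oint_der (fun w x => f x / (x - w)) (fun x => f x / (x - z) ^+ 2) z (S * (4 / r) ^+ 3) hz).
- by rewrite mulr_ge0 // exprn_ge0.
- by move=> w hw; exact: dedge_kernel1.
- exact: dedge_kernel.
move=> w x hw hx; have nw := edge_neq hw hx; have nz := edge_neq hz hx.
have -> : f x / (x - w) - f x / (x - z) - f x / (x - z) ^+ 2 * (w - z) =
  f x * ((x - z)^-1 ^+ 2 * (x - w)^-1 ^+ 1) * (w - z) ^+ 2.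
  by field; rewrite nw nz.
have h1 := edge_z hw hx; have h2 := edge_z hz hx.
rewrite cmodM [cmod (_ ^+ 2)]cmodX; apply: ler_wpM2r; first by rewrite exprn_ge0 ?cmod_ge0.
rewrite cmodM; apply: ler_pM; rewrite ?cmod_ge0 ?hS //.
by rewrite cmodM (exprD _ 2 1); apply: ler_pM; rewrite ?cmod_ge0 ?Vn.
Qed.

Lemma K2_der f z (S : R) : dedge f -> cmod (z - p) < r / 4 ->
  (forall x, edge x -> cmod (f x) <= S) -> cder z (K2 f) (2 * K3 f z).
Proof.
move=> df hz hS; have S0 := S_ge0 hS.
have r40 : 0 <= 4 / r by rewrite divr_ge0 // ltW.
have d3 := dedge_kernel 3 df hz.
have -> : 2 * K3 f z = oint (fun x => 2 * (f x / (x - z) ^+ 3) + 0 * (f x / (x - z) ^+ 3)).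
  by rewrite (oint_lin _ _ d3 d3) mul0r addr0.
apply: (@oint_der (fun w x => f x / (x - w) ^+ 2)
  (fun x => 2 * (f x / (x - z) ^+ 3) + 0 * (f x / (x - z) ^+ 3)) z (S * (10 * r * (4 / r) ^+ 5)) hz).
- by apply: mulr_ge0 => //; apply: mulr_ge0; rewrite ?exprn_ge0 // mulr_ge0 // ltW.
- by move=> w hw; exact: dedge_kernel.
- by move=> x hx; have /diff_derP [l hl] := d3 x hx; diffs.
move=> w x hw hx; have nw := edge_neq hw hx; have nz := edge_neq hz hx.
have -> : f x / (x - w) ^+ 2 - f x / (x - z) ^+ 2
    - (2 * (f x / (x - z) ^+ 3) + 0 * (f x / (x - z) ^+ 3)) * (w - z) =
  f x * ((x - z + 2 * (x - w)) * ((x - z)^-1 ^+ 3 * (x - w)^-1 ^+ 2)) * (w - z) ^+ 2.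
  by field; rewrite nw nz.
have h1 := edge_z hw hx; have h2 := edge_z hz hx.
rewrite cmodM [cmod (_ ^+ 2)]cmodX; apply: ler_wpM2r; first by rewrite exprn_ge0 ?cmod_ge0.
rewrite cmodM; apply: ler_pM; rewrite ?cmod_ge0 ?hS //.
rewrite cmodM; apply: ler_pM; rewrite ?cmod_ge0 //.
  rewrite (le_trans (cmodD _ _)) // cmodM -(rcn R 2) cmod_rc normr_nat.
  have := edge_le hz hx; have := edge_le hw hx; rlra.
by rewrite cmodM (exprD _ 3 2); apply: ler_pM; rewrite ?cmod_ge0 ?Vn.
Qed.

Definition cst1 : C -> C := fun=> 1.
Let dcst1 : dedge cst1.
Proof. by move=> x _; apply: der_diff; exact: der_cst. Qed.

Let cim_conj z w : z != 0 -> cim (w / z) = (cim w * cre z - cre w * cim z) / cmod z ^+ 2.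
Proof.
move=> z0; have n0 : cmod z ^+ 2 != 0 by rewrite expf_neq0 // cmod_eq0.
have h : w = w / z * z by rewrite mulfVK.
move: (w / z) h => y ->; rewrite cimM creM cmod_sqr; rewrite cmod_sqr in n0.
by apply: (mulIf n0); rewrite divfK //; ring.
Qed.

(** Each of the four sides contributes imaginary part at least [1 / 4]: the numerator is at least
    [r * (r / 2)], and [cmod (x - z)] is at most [r + r / 4]. *)
Lemma K1_cst1_ge z : cmod (z - p) < r / 4 -> 1 <= cmod (K1 cst1 z).
Proof.
move=> hz; apply: le_trans (cmod_cim _); apply: le_trans (ler_norm _).
have cims : forall (s : seq 'I_4) (F : 'I_4 -> C), cim (\sum_(k <- s) F k) = \sum_(k <- s) cim (F k).
  by move=> s F; elim/big_ind2: _ => // x1 x2 y1 y2 <- <-; rewrite cimD.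
rewrite /K1 /oint cims.
apply: le_trans (_ : \sum_(k < 4) (4^-1 : R) <= _).
  by rewrite sumr_const card_ord -mulr_natl; lra.
apply: ler_sum => k _.
have sc : scont (fun x => cst1 x / (x - z)) (vx k) (vx k.+1).
  by apply: dedge_scont; exact: dedge_kernel1.
have -> : seg (fun x => cst1 x / (x - z)) (vx k) (vx k.+1) =
    dint (fun t => (vx k.+1 - vx k) * (cst1 (pt (vx k) (vx k.+1) t) / (pt (vx k) (vx k.+1) t - z)) +
       0 * (cst1 (pt (vx k) (vx k.+1) t) / (pt (vx k) (vx k.+1) t - z))).
  by rewrite (dint_lin _ _ sc sc) mul0r addr0.
apply: dint_im; first exact: cont01_lin.
move=> t ht; rewrite mul0r addr0 /cst1 mul1r.
set x := pt _ _ _.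
have hs : side k x := side_pt k ht.
have he : edge x by exists k.
have x0 := edge_neq hz he.
rewrite cim_conj //.
have -> : cim (vx k.+1 - vx k) * cre (x - z) - cre (vx k.+1 - vx k) * cim (x - z) =
    r * cre (wx k * (x - z)).
  have e1 : vx k.+1 - vx k = rc r * ((I - 1) * I ^+ k) by rewrite /vx exprS; ring.
  have [ev od] : cre (I ^+ k) = cre ((- I) ^+ k) /\ cim (I ^+ k) = - cim ((- I) ^+ k).
    elim: (nat_of_ord k) => [|m [h1 h2]]; first by rewrite !expr0 -rc1 !cE oppr0.
    rewrite !exprS; move: (I ^+ m) ((- I) ^+ m) h1 h2 => x1 x2 h1 h2.
    by rewrite !(creM, cimM) creN cimN creI cimI h1 h2; split; ring.
  rewrite e1 /wx -mulrA; move: (I ^+ k) ((- I) ^+ k) (x - z) ev od => x1 x2 x3 h1 h2.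
  by rewrite -rc1 !cE h1 h2; ring.
have h1 := side_z hz hs.
have h2 := edge_le hz he; have h3 : 0 < cmod (x - z) by rewrite cmod_gt0.
rewrite ler_pdivlMr ?exprn_gt0 //.
apply: le_trans (_ : r * (r / 2) <= _); last by rewrite ler_pM2l.
have h4 : cmod (x - z) <= r + r / 4.
  have -> : x - z = (x - p) - (z - p) by ring.
  by rewrite (le_trans (cmodB _ _)) //; have := edge_disc he; rewrite /disc; rlra.
by rewrite expr2; rnra.
Qed.

Section Formula.
Variables (f : C -> C) (S : R).
Hypothesis df : forall x, disc x -> differentiable f x.

Lemma df_edge : dedge f.
Proof. by move=> x /edge_disc; exact: df. Qed.

Lemma quot_diff z x : differentiable f x -> x != z -> differentiable (fun x => (f x - f z) / (x - z)) x.
Proof.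
move=> /diff_derP [l hl]; rewrite -subr_eq0 => xz.
by diffs.
Qed.

(* Goursat on the four triangles with apex [z] over the sides of the diamond,
   applied to the difference quotient of [f] at [z]. *)
Lemma cauchy_formula z : cmod (z - p) < r / 4 -> f z * K1 cst1 z = K1 f z.
Proof.
move=> hz; pose q x := if x == z then dv f z else (f x - f z) / (x - z).
have dz : disc z by rewrite /disc; rlra.
have dq x : disc x -> x != z -> differentiable q x.
  move=> dx xz; have /diff_derP [l hl] := quot_diff (df dx) xz.
  apply: (@der_diff _ _ l); apply: der_near hl.
  apply/nearCP; exists (cmod (x - z)); first by rewrite cmod_gt0 subr_eq0.
  move=> w; rewrite /q; case: eqVneq => // ->.
  by rewrite cmodBC ltxx.
have cq : conton q disc.
  move=> x dx; have [->|xz] := eqVneq x z; last first.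
    move=> e e0; have /differentiable_continuous/ccontP/(_ e e0)[d d0 Hd] := dq x dx xz.
    by exists d => // w _; exact: Hd.
  move=> e e0; have /cderP h := dvP (df dz).
  have e20 : 0 < e / 2 by lra.
  have [d d0 Hd] := h _ e20; exists d => // w _ /Hd.
  rewrite /q eqxx; case: eqVneq => [->|wz]; first by move=> _; rewrite subrr cmod0.
  have wz0 : w - z != 0 by rewrite subr_eq0.
  have -> : f w - f z - dv f z * (w - z) = ((f w - f z) / (w - z) - dv f z) * (w - z).
    by field.
  by rewrite cmodM ler_pM2r ?cmod_gt0 // => /le_lt_trans; apply; lra.
have T (k : 'I_4) : tri q z (vx k) (vx k.+1) = 0.
  (* The height of the [k]-th side over [z]; it is positive since [z] is within [r / 4] of the
     centre and [cmod (wx k) <= 2]. *)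
  apply: (@tri_vertex q disc z (wx k) disc_conv disc_clo cq dz dq _ _ (r - cre (wx k * (z - p)))) => //.
  - have := cmod_cre (wx k * (z - p)); rewrite cmodM.
    have := ler_norm (cre (wx k * (z - p))); have := cmodw k; have := cmod_ge0 (z - p); rnra.
  - rewrite (_ : vx k - z = (vx k - p) - (z - p)); last by ring.
    by rewrite mulrBr creD creN wv -rc1 !cE; ring.
  - rewrite (_ : vx k.+1 - z = (vx k.+1 - p) - (z - p)); last by ring.
    by rewrite mulrBr creD creN wvS -rc1 !cE; ring.
have scv k : scont q z (vx k) by exact: conton_seg disc_conv cq dz (vdisc k).
have v4 : vx 4 = vx 0%N.
  by rewrite /vx expr0; congr (_ + _ * _); rewrite !exprS expr0 mulr1 mulrA II; ring.
(* In the sum of the four vanishing triangle integrals the spokes from [z] telescope, because the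
   square closes up. *)
have Q : oint q = 0.
  pose s k := seg q z (vx k).
  transitivity (oint q - \sum_(0 <= k < 4) (s k.+1 - s k)).
    by rewrite telescope_sumr // /s v4 subrr subr0.
  rewrite big_mkord -sumrB big1 // => k _; rewrite -(T k) /tri (seg_rev (scv k.+1)) /s.
  by move: (seg _ _ _) (seg _ _ _) (seg _ _ _) => s1 s2 s3; ring.
have E : oint q = K1 f z - f z * K1 cst1 z.
  have d1 := dedge_kernel1 df_edge hz; have d2 := dedge_kernel1 dcst1 hz.
  transitivity (1 * K1 f z + (- f z) * K1 cst1 z); last by ring.
  rewrite /K1 -(oint_lin _ _ d1 d2); apply: oint_ext => x hx.
  have := edge_neq hz hx; rewrite /q subr_eq0 => xz; rewrite (negPf xz) /cst1.
  by field; rewrite subr_eq0.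
by apply/eqP; rewrite eq_sym -subr_eq0 -E Q.
Qed.

Hypothesis hS : forall x, edge x -> cmod (f x) <= S.

(** A maximum principle with loss: contour length at most [8 * r], kernel at most [4 / r], [K1 cst1]
    at least [1]. That the factor [32] is the same for all functions is what makes it usable on
    iterated quotients. *)
Lemma sup_est z : cmod (z - p) < r / 4 -> cmod (f z) <= 32 * S.
Proof.
move=> hz; have h1 := K1_cst1_ge hz.
have := kernel_bound 1 df_edge hz hS.
rewrite -/(K1 f z) -cauchy_formula // cmodM expr1.
have -> : 8 * r * (S * (4 / r)) = 32 * S by field; rewrite gt_eqF.
have := cmod_ge0 (f z); nra.
Qed.

Lemma cst1_bound x : edge x -> cmod (cst1 x) <= 1.
Proof. by rewrite cmod1. Qed.

(** Differentiate [f * K1 cst1 = K1 f]. Since [K1 cst1] is not known to be constant, its derivative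
    [K2 cst1] remains as a correction. *)
Lemma dvE z : cmod (z - p) < r / 4 -> dv f z = (K2 f z - f z * K2 cst1 z) / K1 cst1 z.
Proof.
move=> hz; have h1 := K1_cst1_ge hz.
have n0 : K1 cst1 z != 0 by rewrite -cmod_gt0; lra.
have d1 := K1_der dcst1 hz cst1_bound; have d2 := K1_der df_edge hz hS.
have dfz : cder z f (dv f z) by apply: dvP; apply: df; rewrite /disc; rlra.
have d3 := der_mul dfz d1.
have d4 : cder z (fun w => f w * K1 cst1 w) (K2 f z).
  apply: der_near d2; apply/nearCP; exists (r / 4 - cmod (z - p)); first by lra.
  move=> w hw; rewrite cauchy_formula //.
  have -> : w - p = (w - z) + (z - p) by ring.
  by rewrite (le_lt_trans (cmodD _ _)) //; lra.
have <- := der_unique d3 d4.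
by rewrite addrK mulfK.
Qed.

Lemma dv_diff z : cmod (z - p) < r / 4 -> differentiable (dv f) z.
Proof.
move=> hz; have h1 := K1_cst1_ge hz.
have n0 : K1 cst1 z != 0 by rewrite -cmod_gt0; lra.
have d1 := K1_der dcst1 hz cst1_bound.
have dfz : cder z f (dv f z) by apply: dvP; apply: df; rewrite /disc; rlra.
have e1 := K2_der df_edge hz hS; have e2 := K2_der dcst1 hz cst1_bound.
have := der_mul (der_sub e1 (der_mul dfz e2)) (der_inv n0 d1) => d3.
apply: der_diff; apply: der_near d3.
apply/nearCP; exists (r / 4 - cmod (z - p)); first by lra.
move=> w hw; rewrite dvE //.
have -> : w - p = (w - z) + (z - p) by ring.
by rewrite (le_lt_trans (cmodD _ _)) //; lra.
Qed.

(** Each of the two terms of [dvE] is at most [8 * r * (4 / r) ^+ 2 = 128 / r] times [S]. *)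
Lemma dv_est z : cmod (f z) <= S -> cmod (z - p) < r / 4 -> cmod (dv f z) <= 256 * S / r.
Proof.
move=> fS hz; have h1 := K1_cst1_ge hz.
have k1 := kernel_bound 2 df_edge hz hS; have k2 := kernel_bound 2 dcst1 hz cst1_bound.
rewrite -/(K2 f z) in k1; rewrite -/(K2 cst1 z) in k2.
have rn : r != 0 by rewrite gt_eqF.
rewrite (_ : 8 * r * (S * (4 / r) ^+ 2) = 128 * S / r) in k1; last by field.
rewrite (_ : 8 * r * (1 * (4 / r) ^+ 2) = 128 / r) in k2; last by field.
rewrite dvE // cmodM cmodV ler_pdivrMr; last by lra.
have b : cmod (K2 f z - f z * K2 cst1 z) <= 256 * S / r.
  rewrite (le_trans (cmodB _ _)) // cmodM.
  have -> : 256 * S / r = 128 * S / r + S * (128 / r) by field.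
  by rewrite lerD // ler_pM // cmod_ge0.
have b0 := le_trans (cmod_ge0 _) b; apply: (le_trans b).
by move: (256 * S / r) b0 => X X0; rewrite -{1}[X]mulr1 ler_wpM2l.
Qed.

(* The difference quotient of [f] at [p] is again a Cauchy integral, hence
   differentiable at [p]. *)
Lemma quot_diff_center :
  differentiable (fun x => if x == p then dv f p else (f x - f p) / (x - p)) p.
Proof.
set q := fun x => _.
have pz : cmod (p - p) < r / 4 by rewrite subrr cmod0 divr_gt0.
have h1 := K1_cst1_ge pz.
have n0 : K1 cst1 p != 0 by rewrite -cmod_gt0; lra.
pose h x := (f x - f p) / (x - p).
have dh : dedge h.
  move=> x hx; apply: quot_diff; first exact: df_edge.
  by have := edge_neq pz hx; rewrite subr_eq0.
have S0 : 0 <= S.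
  by apply: le_trans (cmod_ge0 _) (hS (@edge_pt ord0 0 _)); rewrite /in01 lexx ler01.
have bh x : edge x -> cmod (h x) <= (S + cmod (f p)) * (4 / r).
  move=> hx; rewrite /h cmodM cmodV ler_pM ?invr_ge0 ?cmod_ge0 //.
    by rewrite (le_trans (cmodB _ _)) // lerD2r hS.
  have h2 := edge_z pz hx; have r40 : 0 < r / 4 by rewrite divr_gt0.
  by rewrite -[4 / r]invrK invf_div lef_pV2 ?posrE //; exact: lt_le_trans h2.
have d1 := K1_der dcst1 pz cst1_bound; have d2 := K1_der dh pz bh.
have := der_mul d2 (der_inv n0 d1) => d3.
apply: der_diff; apply: der_near d3.
apply/nearCP; exists (r / 4); first by rewrite divr_gt0.
move=> w hw.
have cw := cauchy_formula hw; have cp := cauchy_formula pz.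
have nw : K1 cst1 w != 0 by rewrite -cmod_gt0; apply: lt_le_trans (K1_cst1_ge hw).
apply: (mulIf nw); rewrite mulfVK //.
have k1 : dedge (fun x => f x / (x - w)) := dedge_kernel1 df_edge hw.
have k2 : dedge (fun x => f x / (x - p)) := dedge_kernel1 df_edge pz.
have k3 : dedge (fun x => cst1 x / (x - w)) := dedge_kernel1 dcst1 hw.
have k4 : dedge (fun x => cst1 x / (x - p)) := dedge_kernel1 dcst1 pz.
rewrite /q; case: eqVneq => [->|wp].
  rewrite (dvE pz) mulfVK //.
  have k5 := dedge_kernel 2 df_edge pz; have k6 := dedge_kernel 2 dcst1 pz.
  transitivity (1 * K2 f p + (- f p) * K2 cst1 p); last by ring.
  rewrite /K2 -(oint_lin _ _ k5 k6); apply: oint_ext => x hx.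
  by have := edge_neq pz hx => x0; rewrite /h /cst1; field.
have wp0 : w - p != 0 by rewrite subr_eq0.
(* Partial fractions: [(w - p) / ((x - p) * (x - w))] is the difference of the two simple kernels,
   and the kernel at [p] integrates [f x - f p] to zero by the formula at [p]. *)
have E : (w - p) * K1 h w = K1 f w - f p * K1 cst1 w.
  have k7 := dedge_kernel1 dh hw.
  have dd F G a b : dedge F -> dedge G -> dedge (fun x => a * F x + b * G x).
    move=> dF dG x hx; have /diff_derP [l hl] := dF x hx; have /diff_derP [m hm] := dG x hx.
    by diffs.
  have L1 := oint_lin (w - p) 0 k7 k7.
  have L2 := oint_lin 1 (- f p) k1 k3; have L3 := oint_lin 1 (- f p) k2 k4.
  have L4 := oint_lin 1 (-1) (dd _ _ 1 (- f p) k1 k3) (dd _ _ 1 (- f p) k2 k4).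
  rewrite L2 L3 in L4.
  have X := etrans (esym L1) (etrans _ L4).
  rewrite -/(K1 h w) -/(K1 f w) -/(K1 cst1 w) -/(K1 f p) -/(K1 cst1 p) -cp in X.
  transitivity ((w - p) * K1 h w + 0 * K1 h w); first by rewrite mul0r addr0.
  rewrite X; first by ring.
  apply: oint_ext => x hx; have x0 := edge_neq pz hx; have x1 := edge_neq hw hx.
  by rewrite /h /cst1; field; rewrite x0 x1.
apply: (mulfI wp0); rewrite E -cw; field; exact: wp0.
Qed.
End Formula.
End Diamond.
End Cauchy.

(** * Zeros, the Liouville theorem and blow-up *)

Section Local.
Variable R : realType.
Local Notation C := (Cplx R).
Implicit Types (f g q v : C -> C) (a b c z w p : C).

Definition hol f p := exists2 d : R, 0 < d & forall z, cmod (z - p) < d -> differentiable f z.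

Lemma hol_def f p : hol f p <-> holomorphic_at f p.
Proof. by rewrite /holomorphic_at nearCP. Qed.

Lemma hol_diff f p : hol f p -> differentiable f p.
Proof. by move=> [d d0]; apply; rewrite subrr cmod0. Qed.

Lemma cmod_tri z w p : cmod (z - p) <= cmod (z - w) + cmod (w - p).
Proof. by have := cmodD (z - w) (w - p); rewrite addrA subrK. Qed.

Lemma hol_disc f p : hol f p -> exists r S : R,
  [/\ 0 < r, forall z, disc p r z -> differentiable f z
    & forall z, disc p r z -> cmod (f z) <= S].
Proof.
move=> [d d0 H].
have /differentiable_continuous/ccontP/(_ 1 ltr01)[e e0 He] : differentiable f p.
  by apply: H; rewrite subrr cmod0.
exists (Num.min d e / 2), (cmod (f p) + 1).
have m0 : 0 < Num.min d e by rewrite lt_min d0.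
have [md me] : Num.min d e <= d /\ Num.min d e <= e by rewrite !ge_min !lexx orbT.
split; first by lra.
  by move=> z; rewrite /disc => hz; apply: H; lra.
move=> z; rewrite /disc => hz.
have h : cmod (f z - f p) < 1 by apply: He; lra.
have := cmod_revtri (f z) (f p); lra.
Qed.

Lemma hol_dv f p : hol f p -> hol (dv f) p.
Proof.
move=> /hol_disc [r [S [r0 df bf]]]; exists (r / 4); first by lra.
by move=> z; apply: (dv_diff r0 df (S := S)) => x /edge_disc; exact: bf.
Qed.

Lemma hol_near f g p : hol f p -> (\forall z \near p, f z = g z) -> hol g p.
Proof.
move=> [d d0 H] /nearCP [e e0 E].
exists (Num.min d e); first by rewrite lt_min d0.
move=> z; rewrite lt_min => /andP[z1 z2].
apply: der_diff; apply: der_near (dvP (H z z1)).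
apply/nearCP; exists (e - cmod (z - p)); first by lra.
by move=> w hw; apply: E; have := cmod_tri w z p; lra.
Qed.

Lemma hol_all f p : (forall z, differentiable f z) -> hol f p.
Proof. by move=> H; exists 1. Qed.

Section HolOps.
Variables (p : C).
Lemma hol_cst a : hol (fun=> a) p.
Proof. by apply: hol_all => z; diffs. Qed.
Lemma hol_add f g : hol f p -> hol g p -> hol (fun z => f z + g z) p.
Proof.
move=> [d d0 H] [e e0 K]; exists (Num.min d e); first by rewrite lt_min d0.
move=> z; rewrite lt_min => /andP[/H/dvP h1 /K/dvP h2]; diffs.
Qed.
Lemma hol_mul f g : hol f p -> hol g p -> hol (fun z => f z * g z) p.
Proof.
move=> [d d0 H] [e e0 K]; exists (Num.min d e); first by rewrite lt_min d0.
move=> z; rewrite lt_min => /andP[/H/dvP h1 /K/dvP h2]; diffs.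
Qed.
Lemma hol_exp f n : hol f p -> hol (fun z => f z ^+ n) p.
Proof. by move=> [d d0 H]; exists d => // z /H/dvP h1; diffs. Qed.
Lemma hol_lin a : hol (fun z => z - a) p.
Proof. by apply: hol_all => z; diffs. Qed.
Lemma hol_cont_neq0 f : hol f p -> f p != 0 ->
  exists2 d : R, 0 < d & forall z, cmod (z - p) < d -> f z != 0.
Proof.
move=> /hol_diff /differentiable_continuous/ccontP h; rewrite -cmod_gt0 => f0.
have [d d0 H] := h _ f0; exists d => // z /H hz; rewrite -cmod_gt0.
have := cmod_revtri (f p) (f z); rewrite cmodBC; lra.
Qed.
Lemma hol_inv f : hol f p -> f p != 0 -> hol (fun z => (f z)^-1) p.
Proof.
move=> hf f0; have [d d0 H] := hol_cont_neq0 hf f0; case: hf => e e0 K.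
exists (Num.min d e); first by rewrite lt_min d0.
move=> z; rewrite lt_min => /andP[/H h0 /K/dvP h2]; diffs.
Qed.
Lemma hol_comp f g : hol g p -> hol f (g p) -> hol (fun z => f (g z)) p.
Proof.
move=> hg [e e0 K].
have /ccontP/(_ e e0)[d' d'0 H'] := differentiable_continuous (hol_diff hg).
case: hg => d d0 H; exists (Num.min d d'); first by rewrite lt_min d0.
move=> z; rewrite lt_min => /andP[/H/dvP h1 /H'/K/dvP h2].
by apply: der_diff; exact: (der_comp h1 h2).
Qed.
End HolOps.

(** Division by [z - p] that stays within holomorphic functions; its iteration replaces power
    series. *)
Definition quo f p : C -> C := fun x => if x == p then dv f p else (f x - f p) / (x - p).

Lemma quoE f p z : f z = f p + (z - p) * quo f p z.
Proof.
rewrite /quo; case: eqVneq => [->|zp]; first by rewrite subrr mul0r addr0.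
by rewrite mulrCA divff ?subr_eq0 // mulr1 addrC subrK.
Qed.

Lemma quo_diff f p x : hol f p -> differentiable f x -> differentiable (quo f p) x.
Proof.
move=> hf dx; have [->|xp] := eqVneq x p.
  have [r [S [r0 df bf]]] := hol_disc hf.
  by apply: (quot_diff_center r0 df (S := S)) => y /edge_disc; exact: bf.
apply: (@der_diff _ _ _ _); apply: der_near (dvP (quot_diff dx xp)).
apply/nearCP; exists (cmod (x - p)); first by rewrite cmod_gt0 subr_eq0.
move=> w; rewrite /quo; case: eqVneq => // ->.
by rewrite cmodBC ltxx.
Qed.

(** Divide by [z - p] as long as the quotient vanishes at [p]. If this never stops,
    [f = (z - p) ^+ m * q m] for all [m]. On the contour [cmod (z - p) >= r / 2], so [q m] is at
    most [S * (2 / r) ^+ m] there, and by [sup_est] at most [32] times that for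
    [cmod (z - p) < r / 4]; hence [f] is at most [32 * S * 2 ^- m]. *)
Lemma zero_order f p : hol f p -> (\forall z \near p, f z = 0) \/
  exists m, exists q, [/\ hol q p, q p != 0 & forall z, f z = (z - p) ^+ m * q z].
Proof.
move=> hf; have [r [S [r0 df bf]]] := hol_disc hf.
pose q m := iter m (fun g => quo g p) f.
have dq m x : disc p r x -> differentiable (q m) x.
  elim: m x => [|m IH] x dx; first exact: df.
  apply: quo_diff; last exact: IH.
  by exists r => // z hz; apply: IH; rewrite /disc ltW.
have hq m : hol (q m) p by exists r => // z hz; apply: dq; rewrite /disc ltW.
have [[m0 Hm0]|/forallNP H] := pselect (exists m, q m p != 0).
  right; have ex : exists m, q m p != 0 by exists m0.
  case: (ex_minnP ex) => m qm minm; exists m, (q m); split=> // z.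
  have : forall k, (k <= m)%N -> f z = (z - p) ^+ k * q k z.
    elim=> [|k IH] km; first by rewrite expr0 mul1r.
    rewrite IH 1?ltnW // exprSr -mulrA; congr (_ * _).
    rewrite (quoE (q k) p z); suff -> : q k p = 0 by rewrite add0r.
    by apply/eqP/negPn/negP => /minm; rewrite leqNgt km.
  exact.
left; have q0 m : q m p = 0 by apply/eqP/negPn/negP; exact: H.
have fq m z : f z = (z - p) ^+ m * q m z.
  elim: m => [|m ->]; first by rewrite expr0 mul1r.
  by rewrite exprSr -mulrA (quoE (q m) p z) q0 add0r.
apply/nearCP; exists (r / 4); first by lra.
move=> z hz; apply/eqP; rewrite -cmod_eq0 eq_le cmod_ge0 andbT.
apply/ler_addgt0Pr => e e0; rewrite add0r.
have S0 : 0 <= S.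
  by apply: le_trans (cmod_ge0 (f p)) _; apply: bf; rewrite /disc subrr cmod0 ltW.
have key m : cmod (f z) <= 32 * S * 2^-1 ^+ m.
  have bq x : edge p r x -> cmod (q m x) <= S * (2 / r) ^+ m.
    move=> hx; have hp := edge_p r0 hx.
    have x0 : 0 < cmod (x - p) by lra.
    have := bf x (edge_disc hx); rewrite (fq m) cmodM cmodX => h.
    rewrite -[2 / r]invrK exprVn invf_div ler_pdivlMr ?exprn_gt0 ?divr_gt0 //.
    apply: le_trans h; rewrite mulrC ler_wpM2r ?cmod_ge0 //.
    by rewrite lerXn2r ?nnegrE ?cmod_ge0 ?divr_ge0 ?(ltW r0).
  have := sup_est r0 (dq m) bq hz => h.
  rewrite (fq m) cmodM cmodX.
  apply: le_trans (_ : (r / 4) ^+ m * (32 * (S * (2 / r) ^+ m)) <= _).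
    apply: ler_pM; rewrite ?exprn_ge0 ?cmod_ge0 // lerXn2r ?nnegrE ?cmod_ge0 ?(ltW hz) //.
    by rewrite divr_ge0 // ltW.
  have -> : (r / 4) ^+ m * (32 * (S * (2 / r) ^+ m)) = 32 * S * ((r / 4) ^+ m * (2 / r) ^+ m) by ring.
  rewrite -exprMn; have -> : r / 4 * (2 / r) = 2^-1 by field; rewrite gt_eqF.
  by [].
have h : `|2^-1 : R| < 1 by rewrite ger0_norm ?invr_ge0 //; lra.
have K0 : 0 < e / (32 * S + 1) by rewrite divr_gt0 //; lra.
have /cvgrPdist_lt/(_ _ K0)[N _ /(_ N (leqnn _))] := cvg_expr h.
rewrite /= sub0r normrN ger0_norm ?exprn_ge0 ?invr_ge0 // ltr_pdivlMr; last by lra.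
have k0 : 0 <= 2^-1 ^+ N :> R by rewrite exprn_ge0 ?invr_ge0.
by have := key N; nra.
Qed.

Lemma zero_dich f p : hol f p -> (\forall z \near p, f z = 0) \/
  (exists2 d : R, 0 < d & forall z, z != p -> cmod (z - p) < d -> f z != 0).
Proof.
move=> /zero_order [|[m [q [hq q0 E]]]]; first by left.
right; have [d d0 H] := hol_cont_neq0 hq q0; exists d => // z zp /H h.
by rewrite E mulf_neq0 // expf_neq0 // subr_eq0.
Qed.

(** If [f - f p = (z - p) ^+ m * q] with [q p != 0], then [m > 0] and the derivative is
    [(z - p) ^+ m.-1] times a function with value [m%:R * q p] at [p], so it cannot vanish near
    [p]. *)
Lemma dv0_cst f p : hol f p -> (\forall z \near p, dv f z = 0) -> \forall z \near p, f z = f p.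
Proof.
move=> hf /nearCP [d d0 D].
have hg : hol (fun z => f z + (- f p)) p by apply: hol_add => //; exact: hol_cst.
have [|[m [q [hq q0 E]]]] := zero_order hg.
  by apply: filterS => z /eqP; rewrite subr_eq0 => /eqP.
exfalso; have := E p; rewrite subrr => /esym/eqP.
rewrite mulf_eq0 (negPf q0) orbF expf_eq0 subrr eqxx andbT => m0.
have hh : hol (fun z => m%:R * q z + (z - p) * dv q z) p.
  apply: hol_add; apply: hol_mul => //; [exact: hol_cst | exact: hol_lin | exact: hol_dv].
have [|d1 d10 D1] := hol_cont_neq0 hh.
  by rewrite subrr mul0r addr0 mulf_neq0 // pnatr_eq0 -lt0n.
case: (hq) => d2 d20 D2; case: (hf) => d3 d30 D3.
pose e := Num.min (Num.min d d1) (Num.min d2 d3) / 2.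
have e1 : 0 < Num.min (Num.min d d1) (Num.min d2 d3) by rewrite !lt_min d0 d10 d20 d30.
have e0 : 0 < e by rewrite /e; lra.
pose z := p + rc e.
have zp : cmod (z - p) = e by rewrite /z (addrC p) addrK cmod_rc gtr0_norm.
have zp0 : z - p != 0 by rewrite -cmod_gt0 zp.
have : e < Num.min (Num.min d d1) (Num.min d2 d3) by rewrite /e; lra.
rewrite !lt_min -zp => /andP[/andP[z1 z2] /andP[z3 z4]].
have h1 := dvP (D3 z z4); have h2 := dvP (D2 z z3).
have h3 : cder z (fun w => f w + (- f p)) (dv f z + 0) by repeat derstep.
have h4 : cder z (fun w => (w - p) ^+ m * q w)
  (m%:R * (z - p) ^+ m.-1 * (1 + - 0) * q z + (z - p) ^+ m * dv q z) by repeat derstep.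
have h5 : (fun w => (w - p) ^+ m * q w) = (fun w => f w + (- f p)) by apply/funext => w; rewrite E.
rewrite h5 in h4; have := der_unique h3 h4; rewrite D // addr0 => /esym/eqP.
rewrite -(prednK m0) /= exprS (prednK m0).
have -> : m%:R * (z - p) ^+ m.-1 * (1 + - 0) * q z + (z - p) * (z - p) ^+ m.-1 * dv q z =
  (z - p) ^+ m.-1 * (m%:R * q z + (z - p) * dv q z) by ring.
by rewrite mulf_eq0 expf_eq0 (negPf zp0) andbF /= (negPf (D1 z z2)).
Qed.

Lemma liouville f (M : R) : (forall z, differentiable f z) -> (forall z, cmod (f z) <= M) ->
  forall z, f z = f 0.
Proof.
move=> df bf z; rewrite (quoE f 0 z) subr0.
suff -> : quo f 0 z = 0 by rewrite mulr0 addr0.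
have dq x : differentiable (quo f 0) x by apply: quo_diff => //; exact: hol_all.
apply/eqP; rewrite -cmod_eq0 eq_le cmod_ge0 andbT; apply/ler_addgt0Pr => e e0; rewrite add0r.
have M0 : 0 <= M by apply: le_trans (cmod_ge0 _) (bf 0).
(* The difference quotient is at most [4 * M / r] on the contour and [32] times that inside. The
   first summand makes this at most [e]; the second puts [z] in the inner quarter. *)
pose r := 128 * (M + 1) / e + 4 * cmod z + 1.
have q0 : 0 < 128 * (M + 1) / e by rewrite divr_gt0 //; lra.
have z0 := cmod_ge0 z.
have r0 : 0 < r by rewrite /r; lra.
have bq x : edge 0 r x -> cmod (quo f 0 x) <= 4 * M / r.
  move=> hx; have := edge_p r0 hx; rewrite /quo subr0 => hx2.
  have x0 : x != 0 by rewrite -cmod_gt0; lra.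
  rewrite (negPf x0) cmodM cmodV ler_pdivrMr ?cmod_gt0 //.
  apply: le_trans (_ : 2 * M <= _).
    by rewrite (le_trans (cmodB _ _)) //; have := bf x; have := bf 0; lra.
  have -> : 4 * M / r * cmod x = 2 * M * (2 * cmod x / r) by field; rewrite gt_eqF.
  rewrite -{1}[2 * M]mulr1 ler_wpM2l //; first by lra.
  by rewrite ler_pdivlMr // mul1r; lra.
have h : cmod (z - 0) < r / 4 by rewrite subr0 /r; lra.
apply: le_trans (sup_est r0 (fun x _ => dq x) bq h) _.
rewrite mulrA ler_pdivrMr //.
apply: le_trans (_ : e * (128 * (M + 1) / e) <= _).
  by rewrite [X in _ <= X]mulrC divfK ?gt_eqF //; lra.
by rewrite ler_wpM2l ?(ltW e0) // /r; lra.
Qed.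

(** Linear growth bounds the difference quotient at [0], to which [liouville] then applies. *)
Lemma liouville_lin f (A B : R) : (forall z, differentiable f z) -> 0 <= A ->
  (forall z, B <= cmod z -> cmod (f z) <= A * cmod z) ->
  exists a b, forall z, f z = a + z * b.
Proof.
move=> df A0 bf.
have dq x : differentiable (quo f 0) x by apply: quo_diff => //; exact: hol_all.
suff [M bq] : exists M, forall z, cmod (quo f 0 z) <= M.
  exists (f 0), (quo f 0 0) => z; rewrite {1}(quoE f 0 z) subr0.
  by rewrite (liouville dq bq).
exists (32 * (A + cmod (f 0))) => z.
have z0 := cmod_ge0 z.
pose r := 4 * cmod z + 2 * `|B| + 2.
have B0 := normr_ge0 B; have B1 := ler_norm B.
have r0 : 0 < r by rewrite /r; lra.
apply: (@sup_est _ 0 r r0 _ _ (fun x _ => dq x)); last by rewrite subr0 /r; lra.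
move=> x hx; have := edge_p r0 hx; rewrite /quo subr0 /r => hx2.
have x0 : x != 0 by rewrite -cmod_gt0; lra.
rewrite (negPf x0) cmodM cmodV ler_pdivrMr ?cmod_gt0 // mulrDl.
rewrite (le_trans (cmodB _ _)) // lerD //; first by apply: bf; lra.
by have := cmod_ge0 (f 0); nra.
Qed.

Lemma geom_cauchy (t : nat -> C) (r0 th : R) : 0 <= r0 -> 0 <= th -> th < 1 ->
  (forall k, cmod (t k.+1 - t k) <= r0 * th ^+ k) -> exists l, slim t l.
Proof.
move=> r00 th0 th1 H.
have D n k : cmod (t (n + k)%N - t n) * (1 - th) <= r0 * th ^+ n * (1 - th ^+ k).
  elim: k => [|k IH]; first by rewrite addn0 subrr cmod0 mul0r expr0 subrr mulr0.
  have := cmod_tri (t (n + k.+1)%N) (t (n + k)%N) (t n).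
  have := H (n + k)%N; rewrite -addnS exprD => h1 h2.
  have h3 : 0 <= th ^+ k by rewrite exprn_ge0.
  have h4 : 0 <= r0 * th ^+ n by rewrite mulr_ge0 // exprn_ge0.
  rewrite exprS; move: h1 h2 IH; rewrite mulrA.
  by move: (cmod _) (cmod _) (cmod _) (th ^+ k) (r0 * _) h3 h4 => x1 x2 x3 x4 x5 *; nra.
apply: slim_complete => e e0.
have h : `|th| < 1 by rewrite ger0_norm.
have K0 : 0 < e * (1 - th) / (r0 + 1) by rewrite divr_gt0 ?mulr_gt0 //; lra.
have /cvgrPdist_lt/(_ _ K0)[N _ /(_ N (leqnn _))] := cvg_expr h.
rewrite /= sub0r normrN ger0_norm ?exprn_ge0 // ltr_pdivlMr; last by lra.
move=> hN; exists N => n Nn; rewrite -(subnKC Nn).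
have h1 := D N (n - N)%N; have h3 : 0 <= th ^+ (n - N) by rewrite exprn_ge0.
have h4 : 0 <= th ^+ N by rewrite exprn_ge0.
rewrite -(@ler_pM2r _ (1 - th)); last by lra.
apply: le_trans h1 _; apply: le_trans (_ : r0 * th ^+ N <= _).
  by rewrite ler_piMr ?mulr_ge0 //; lra.
by nra.
Qed.

(* By the Cauchy estimate, [v] doubles within a distance of order
   [|v| ^ (- 1 / l)]; iterating, [v] would be unbounded near a finite point. *)
Lemma blowup v l (c M : R) : (forall z, differentiable v z) -> (0 < l)%N -> 0 < c -> 0 <= M ->
  (forall z, M < cmod (v z) -> c * cmod (v z) ^+ l.+1 <= cmod (dv v z) ^+ l) ->
  forall z, cmod (v z) <= M.
Proof.
move=> dvv l0 c0 M0 H t0; rewrite leNgt; apply/negP => vt0.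
have [D D1 Dest] : exists2 D : R, 1 <= D & forall z (r : R), 0 < r ->
    (forall x, disc z r x -> cmod (v x) <= 2 * cmod (v z)) -> cmod (dv v z) <= D * cmod (v z) / r.
  (* The factor [256] of [dv_est], applied with the bound [2 * cmod (v z)] on the disc. *)
  exists 512; first by lra.
  move=> z r r0 h.
  have zz : cmod (z - z) < r / 4 by rewrite subrr cmod0 divr_gt0.
  have vv : cmod (v z) <= 2 * cmod (v z) by have := cmod_ge0 (v z); lra.
  have := dv_est r0 (fun x _ => dvv x) (fun x hx => h x (edge_disc hx)) vv zz.
  by rewrite mulrA -natrM.
have D0 : 0 < D by lra.
(* If [v] did not double within distance [r], the Cauchy estimate and the hypothesis on [dv v] would
   give [c * cmod (v z) * r ^+ l <= D ^+ l]. *)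
have step z (r : R) : 0 < r -> M < cmod (v z) -> D ^+ l < c * cmod (v z) * r ^+ l ->
    exists2 z', cmod (z' - z) <= r & 2 * cmod (v z) < cmod (v z').
  move=> r0 hM hr; apply: contrapT => /forall2NP h.
  have {}h x : disc z r x -> cmod (v x) <= 2 * cmod (v z).
    by move=> hx; have [//|/negP] := h x; rewrite -leNgt.
  have v0 : 0 < cmod (v z) by lra.
  have est := Dest z r r0 h.
  have := H z hM.
  have : cmod (dv v z) ^+ l <= (D * cmod (v z) / r) ^+ l.
    by rewrite lerXn2r ?nnegrE ?cmod_ge0 // divr_ge0 ?mulr_ge0 ?cmod_ge0 ?ltW.
  rewrite expr_div_n exprMn ler_pdivlMr ?exprn_gt0 // exprS => h1 h2.
  have vl : 0 < cmod (v z) ^+ l by rewrite exprn_gt0.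
  have rl : 0 < r ^+ l by rewrite exprn_gt0.
  have h3 : c * (cmod (v z) * cmod (v z) ^+ l) * r ^+ l <= D ^+ l * cmod (v z) ^+ l.
    by apply: le_trans h1; rewrite ler_pM2r.
  have : c * cmod (v z) * r ^+ l * cmod (v z) ^+ l <= D ^+ l * cmod (v z) ^+ l.
    by apply: le_trans h3; rewrite le_eqVlt; apply/orP; left; apply/eqP; ring.
  by rewrite ler_pM2r // leNgt hr.
set m := cmod (v t0) in vt0.
have m0 : 0 < m by lra.
have l1 : (0 : R) < l%:R by rewrite ltr0n.
have l2 : (1 : R) <= l%:R by rewrite ler1n.
(* Each step doubles [cmod v], so the radius may shrink by [th] as long as [2 * th ^+ l >= 1]; for
   this [th] that is Bernoulli's inequality. As [th < 1], the total distance travelled is finite. *)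
pose th : R := 1 - (2 * l%:R)^-1.
have i2 : (2 * l%:R)^-1 <= 2^-1 :> R by rewrite lef_pV2 ?posrE; lra.
have i0 : (0 : R) < (2 * l%:R)^-1 by rewrite invr_gt0; lra.
have [th0 th1] : 0 < th /\ th < 1 by rewrite /th; split; lra.
have thl : 2^-1 <= th ^+ l.
  have bern : forall k, 1 - k%:R * (2 * l%:R)^-1 <= th ^+ k.
    elim=> [|k IH]; first by rewrite mul0r subr0 expr0.
    have k0 : (0 : R) <= k%:R by rewrite ler0n.
    have h5 := ler_wpM2l (ltW th0) IH; rewrite exprS -natr1; apply: le_trans h5.
    rewrite /th; move: (2 * _)^-1 i0 i2 => x *; nra.
  apply: le_trans (bern l); rewrite le_eqVlt; apply/orP; left; apply/eqP.
  by field; rewrite gt_eqF.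
(* Meets the first step condition: [c * m * (1 + (c * m)^-1) ^+ l >= c * m + 1 > 1]. *)
pose r0 : R := D * (1 + (c * m)^-1).
have cm : 0 < c * m by rewrite mulr_gt0.
have icm : 0 < (c * m)^-1 by rewrite invr_gt0.
have r00 : 0 < r0 by apply: mulr_gt0 => //; lra.
have hr0 : D ^+ l < c * m * r0 ^+ l.
  rewrite /r0 exprMn mulrCA -[X in X < _]mulr1 ltr_pM2l ?exprn_gt0 //.
  apply: lt_le_trans (_ : c * m * (1 + (c * m)^-1) <= _).
    by rewrite mulrDr mulr1 divff ?gt_eqF //; lra.
  by rewrite ler_pM2l // ler_eXnr //; lra.
clearbody r0 th.
have [nx Hnx] : exists nx : C -> R -> C, forall z (r : R), 0 < r -> M < cmod (v z) ->
    D ^+ l < c * cmod (v z) * r ^+ l ->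
    cmod (nx z r - z) <= r /\ 2 * cmod (v z) < cmod (v (nx z r)).
  have ex : forall zr : C * R, exists z', 0 < zr.2 -> M < cmod (v zr.1) ->
      D ^+ l < c * cmod (v zr.1) * zr.2 ^+ l ->
      cmod (z' - zr.1) <= zr.2 /\ 2 * cmod (v zr.1) < cmod (v z').
    move=> [z r] /=; have [[h1 [h2 h3]]|h] :=
      pselect (0 < r /\ M < cmod (v z) /\ D ^+ l < c * cmod (v z) * r ^+ l).
      by have [z' k1 k2] := step z r h1 h2 h3; exists z'.
    by exists z => h1 h2 h3; case: h.
  have [F HF] := choice ex; exists (fun z r => F (z, r)) => z r; exact: (HF (z, r)).
pose fix t k := if k is j.+1 then nx (t j) (r0 * th ^+ j) else t0.
have inv k : 2 ^+ k * m <= cmod (v (t k)) /\ D ^+ l < c * cmod (v (t k)) * (r0 * th ^+ k) ^+ l.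
  have aux j x : 2 ^+ j * m <= x -> D ^+ l < c * x * (r0 * th ^+ j) ^+ l.
    move=> hx; apply: lt_le_trans hr0 _; rewrite exprMn exprAC.
    apply: le_trans (_ : c * (2 ^+ j * m) * (r0 ^+ l * (th ^+ l) ^+ j) <= _); last first.
      by rewrite ler_wpM2r ?ler_wpM2l ?mulr_ge0 ?exprn_ge0 // ltW.
    have -> : c * (2 ^+ j * m) * (r0 ^+ l * (th ^+ l) ^+ j) =
       c * m * r0 ^+ l * (2 * th ^+ l) ^+ j by rewrite exprMn; ring.
    rewrite ler_peMr ?mulr_ge0 ?exprn_ge0 ?(ltW r00) ?(ltW c0) ?(ltW m0) //.
    by rewrite exprn_ege1 //; lra.
  elim: k => [|k [IH1 IH2]]; first by rewrite expr0 mul1r; split=> //; apply: aux; rewrite expr0 mul1r.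
  have tk : M < cmod (v (t k)).
    apply: lt_le_trans IH1; apply: lt_le_trans vt0 _.
    by rewrite ler_peMl ?exprn_ege1 ?ler1n // ltW.
  have [_ h2] := Hnx (t k) (r0 * th ^+ k) (mulr_gt0 r00 (exprn_gt0 k th0)) tk IH2.
  have h3 : 2 ^+ k.+1 * m <= cmod (v (t k.+1)).
    by rewrite exprS -mulrA (le_trans _ (ltW h2)) // ler_pM2l.
  by split=> //; apply: aux.
have big k : M < cmod (v (t k)).
  have [h _] := inv k; apply: lt_le_trans h; apply: lt_le_trans vt0 _.
  by rewrite ler_peMl ?exprn_ege1 ?ler1n // ltW.
have [s Hs] : exists s, slim t s.
  apply: (@geom_cauchy t r0 th); rewrite ?(ltW r00) ?(ltW th0) // => k.
  have [_ h2] := inv k.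
  by have [] := Hnx (t k) (r0 * th ^+ k) (mulr_gt0 r00 (exprn_gt0 k th0)) (big k) h2.
have /ccontP/(_ _ ltr01)[d d0 Hd] := differentiable_continuous (dvv s).
have d20 : 0 < d / 2 by lra.
have [N HN] := Hs _ d20.
have bdd n : (N <= n)%N -> cmod (v (t n)) <= cmod (v s) + 1.
  move=> /HN h; have : cmod (v (t n) - v s) < 1 by apply: Hd; lra.
  have := cmod_revtri (v (t n)) (v s); lra.
have lim2 : exists n, (N <= n)%N /\ cmod (v s) + 1 < 2 ^+ n * m.
  have ng k : k%:R <= 2 ^+ k :> R by rewrite -natrX ler_nat ltnW // ltn_expl.
  pose x := (cmod (v s) + 1) / m.
  have [k hk] : exists k : nat, x < k%:R.
    exists (Num.truncn x).+1; exact: truncnS_gt.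
  exists (N + k)%N; split; first exact: leq_addr.
  rewrite -ltr_pdivrMr // -/x; apply: lt_le_trans hk (le_trans _ (ng _)).
  by rewrite ler_nat leq_addl.
have [n [Nn hn]] := lim2; have := bdd n Nn; have [h _] := inv n; lra.
Qed.

(** Equality of meromorphic functions is only meaningful off isolated points, since representatives
    have arbitrary values at poles; punctured neighbourhoods express this. *)
Definition pnear p (P : C -> Prop) :=
  exists2 d : R, 0 < d & forall z, z != p -> cmod (z - p) < d -> P z.

Lemma pnear_and p (P Q : C -> Prop) : pnear p P -> pnear p Q -> pnear p (fun z => P z /\ Q z).
Proof.
move=> [d d0 D] [e e0 E]; exists (Num.min d e); first by rewrite lt_min d0.
by move=> z zp; rewrite lt_min => /andP[h1 h2]; split; [apply: D | apply: E].
Qed.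
Lemma pnear_sub p (P Q : C -> Prop) : (forall z, z != p -> P z -> Q z) -> pnear p P -> pnear p Q.
Proof. by move=> h [d d0 D]; exists d => // z zp zd; apply: h => //; exact: D. Qed.
Lemma near_pnear p (P : C -> Prop) : (\forall z \near p, P z) -> pnear p P.
Proof. by move=> /nearCP [d d0 D]; exists d => // z _; exact: D. Qed.
Lemma pnear_ex p (P : C -> Prop) (d : R) : pnear p P -> 0 < d ->
  exists z, [/\ z != p, cmod (z - p) < d & P z].
Proof.
move=> [e e0 E] d0; pose x := Num.min d e / 2.
have m0 : 0 < Num.min d e by rewrite lt_min d0.
have [md me] : Num.min d e <= d /\ Num.min d e <= e by rewrite !ge_min !lexx orbT.
have zp : cmod (p + rc x - p) = x by rewrite (addrC p) addrK cmod_rc ger0_norm // /x; lra.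
exists (p + rc x); have h : p + rc x != p.
  by rewrite -subr_eq0 -cmod_gt0 zp /x; lra.
by split=> //; [|apply: E => //]; rewrite zp /x; lra.
Qed.
Lemma pnear_move p (P : C -> Prop) : pnear p P -> pnear p (fun z => \forall w \near z, P w).
Proof.
move=> [d d0 D]; exists d => // z zp zd; apply/nearCP.
exists (Num.min (cmod (z - p)) (d - cmod (z - p))).
  by rewrite lt_min cmod_gt0 subr_eq0 zp; lra.
move=> w; rewrite lt_min => /andP[h1 h2]; apply: D; last by have := cmod_tri w z p; lra.
by apply/eqP => e; move: h1; rewrite e cmodBC ltxx.
Qed.

(** Let [x] be the supremum of the parameters up to which [Z] holds around the points of the segment
    from [p0] to [p1]. If [Z] failed around [g x], it would fail around earlier points close to
    [g x]; if it holds there, it holds beyond [x] unless [x = 1]. *)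
Lemma pnear_connected (Z : C -> Prop) p0 :
  (forall p, pnear p Z \/ pnear p (fun z => ~ Z z)) -> pnear p0 Z -> forall p, pnear p Z.
Proof.
move=> D H0 p1; apply: contrapT => H1.
have excl p : pnear p Z -> pnear p (fun z => ~ Z z) -> False.
  by move=> h1 h2; have [z [_ _ []]] := pnear_ex (pnear_and h1 h2) ltr01.
have spread p (P : C -> Prop) : pnear p P -> exists2 d : R, 0 < d &
    forall z, z != p -> cmod (z - p) < d -> pnear z P.
  by move=> /pnear_move [d d0 E]; exists d => // z zp zd; apply: near_pnear; exact: E.
pose g s := pt p0 p1 s.
have len0 : 0 < cmod (p1 - p0).
  by rewrite cmod_gt0 subr_eq0; apply/eqP => e; apply: H1; rewrite e.
pose S : set R := [set s | 0 <= s <= 1 /\ forall s', 0 <= s' <= s -> pnear (g s') Z].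
have g0 : g 0 = p0 by rewrite /g /pt rc0 mul0r addr0.
have g1 : g 1 = p1 by rewrite /g /pt rc1 mul1r addrC subrK.
have S0 : S 0.
  split; first by rewrite lexx ler01.
  move=> s' h; have -> : s' = 0 by apply/eqP; rewrite eq_le andbC.
  by rewrite g0.
have hsS : has_sup S.
  by split; [exists 0 | exists 1 => s [/andP[]]].
pose x := sup S.
have x0 : 0 <= x by apply: sup_upper_bound.
have x1 : x <= 1 by apply: sup_le_ub; [exists 0 | move=> s [/andP[]]].
have gd s : cmod (g s - g x) = `|s - x| * cmod (p1 - p0) by exact: pt_dist.
have gneq s : s != x -> g s != g x.
  by move=> sx; rewrite -subr_eq0 -cmod_gt0 gd mulr_gt0 // normr_gt0 subr_eq0.
have [hZ|hN] := D (g x); last first.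
  have [d d0 E] := spread _ _ hN.
  have e0 : 0 < d / cmod (p1 - p0) by rewrite divr_gt0.
  have [s Ss sx] := sup_adherent e0 hsS.
  have sx2 : s <= x by apply: sup_upper_bound.
  have Zs : pnear (g s) Z by apply: (proj2 Ss); move: (proj1 Ss) => /andP[-> _] /=.
  have [e|ne] := eqVneq s x; first by apply: (excl (g x)); rewrite // -e.
  apply: (excl (g s)) => //; apply: E; first exact: gneq.
  rewrite gd -ltr_pdivlMr // ler0_norm; last by lra.
  by move: sx; rewrite -/x; lra.
have [d d0 E] := spread _ _ hZ.
have e0 : 0 < d / cmod (p1 - p0) by rewrite divr_gt0.
have [s Ss sx] := sup_adherent e0 hsS; rewrite -/x in sx.
have near s' : `|s' - x| < d / cmod (p1 - p0) -> pnear (g s') Z.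
  have [->//|ne] := eqVneq s' x; move=> h; apply: E; first exact: gneq.
  by rewrite gd -ltr_pdivlMr.
pose y := Num.min 1 (x + d / cmod (p1 - p0) / 2).
have Sy : S y.
  split; first by rewrite le_min ler01 ge_min lexx /= andbT; lra.
  move=> s' /andP[s'0]; rewrite le_min => /andP[s'1 s'2].
  have [h|h] := leP s' s; first by apply: (proj2 Ss); rewrite s'0.
  by apply: near; rewrite ltr_norml; apply/andP; split; lra.
have yx : y <= x by apply: sup_upper_bound.
have y1 : y = 1.
  have h : ~ (x + d / cmod (p1 - p0) / 2 <= x) by apply/negP; rewrite -ltNge ltrDl divr_gt0.
  apply: contrapT => y1; apply: h; move: yx y1; rewrite /y.
  have [h1|h1] := leP 1 (x + d / cmod (p1 - p0) / 2); first by move=> _ /(_ erefl).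
  by [].
by apply: H1; rewrite -g1 -y1; apply: (proj2 Sy); case: Sy => /andP[-> _] /=.
Qed.
End Local.

(** * Meromorphic functions of one variable *)

Section Mero.
Variable R : realType.
Local Notation C := (Cplx R).
Implicit Types (f g y U V W G : C -> C) (a b c z w p : C) (k l m : nat).

Definition mero U p := exists m, exists2 y, hol y p & pnear p (fun z => U z = y z / (z - p) ^+ m).

Lemma pnear_triv p (P : C -> Prop) : (forall z, P z) -> pnear p P.
Proof. by move=> h; exists 1. Qed.

Lemma hol_pnear_eq f g p : hol f p -> hol g p -> pnear p (fun z => f z = g z) -> f p = g p.
Proof.
move=> /hol_diff/differentiable_continuous/ccontP cf /hol_diff/differentiable_continuous/ccontP cg H.
apply: eps_eq => e e0; have e20 : 0 < e / 2 by lra.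
have [d d0 D] := cf _ e20; have [d' d'0 D'] := cg _ e20.
have m0 : 0 < Num.min d d' by rewrite lt_min d0.
have [z [_ zd fg]] := pnear_ex H m0.
move: zd; rewrite lt_min => /andP[/D h1 /D' h2].
have -> : f p - g p = (g z - g p) - (f z - f p) by rewrite fg; ring.
by rewrite (le_trans (cmodB _ _)) //; lra.
Qed.

Lemma hol_pnear_near f g p : hol f p -> hol g p -> pnear p (fun z => f z = g z) ->
  \forall z \near p, f z = g z.
Proof.
move=> hf hg H; have E := hol_pnear_eq hf hg H; case: H => d d0 D.
by apply/nearCP; exists d => // z; have [->//|zp] := eqVneq z p; exact: D.
Qed.

Lemma dv_near f g p : (\forall z \near p, f z = g z) -> hol f p -> dv f p = dv g p.
Proof. by move=> E /hol_diff/dvP h; rewrite (dv_eq (der_near E h)). Qed.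

Lemma pnear_dv f g p : pnear p (fun z => f z = g z) -> pnear p (fun z => differentiable f z) ->
  pnear p (fun z => dv f z = dv g z).
Proof.
move=> /pnear_move E D; apply: pnear_sub (pnear_and E D) => z _ [e /dvP h].
by rewrite (dv_eq (der_near e h)).
Qed.

Lemma hol_pnear_diff f p : hol f p -> pnear p (fun z => differentiable f z).
Proof. by move=> [d d0 D]; exists d => // z _; exact: D. Qed.

Lemma mero_hol f p : hol f p -> mero f p.
Proof. by move=> hf; exists 0%N, f => //; apply: pnear_triv => z; rewrite expr0 divr1. Qed.
Lemma mero_ext U V p : pnear p (fun z => U z = V z) -> mero U p -> mero V p.
Proof.
move=> E [m [y hy H]]; exists m, y => //.
by apply: pnear_sub (pnear_and E H) => z _ [<-].
Qed.
Lemma mero_cst a p : mero (fun=> a) p.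
Proof. by apply: mero_hol; exact: hol_cst. Qed.
Lemma mero_add U V p : mero U p -> mero V p -> mero (fun z => U z + V z) p.
Proof.
move=> [m [y hy H]] [m' [y' hy' H']].
exists (m + m')%N, (fun z => y z * (z - p) ^+ m' + y' z * (z - p) ^+ m).
  by apply: hol_add; apply: hol_mul => //; apply: hol_exp; exact: hol_lin.
apply: pnear_sub (pnear_and H H') => z zp [-> ->].
have z0 : z - p != 0 by rewrite subr_eq0.
have h1 : (z - p) ^+ m != 0 by rewrite expf_neq0.
have h2 : (z - p) ^+ m' != 0 by rewrite expf_neq0.
by rewrite exprD; field; rewrite h1 h2.
Qed.
Lemma mero_mul U V p : mero U p -> mero V p -> mero (fun z => U z * V z) p.
Proof.
move=> [m [y hy H]] [m' [y' hy' H']].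
exists (m + m')%N, (fun z => y z * y' z); first exact: hol_mul.
apply: pnear_sub (pnear_and H H') => z zp [-> ->].
by rewrite exprD invfM; ring.
Qed.
Lemma mero_exp U p n : mero U p -> mero (fun z => U z ^+ n) p.
Proof.
move=> hU; elim: n => [|n IH]; first exact: mero_cst.
by under eq_fun do rewrite exprS; exact: mero_mul.
Qed.
Lemma mero_poly (P : {poly C}) U p : mero U p -> mero (fun z => P.[U z]) p.
Proof.
move=> hU; elim/poly_ind: P => [|P c IH].
  by under eq_fun do rewrite horner0; exact: mero_cst.
under eq_fun do rewrite hornerMXaddC.
by apply: mero_add; [apply: mero_mul | exact: mero_cst].
Qed.

Lemma mero_order U p : mero U p -> [\/ pnear p (fun z => U z = 0),
  exists m, exists y, [/\ hol y p, y p != 0 & pnear p (fun z => U z = (z - p) ^+ m * y z)] |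
  exists k, exists y, [/\ hol y p, y p != 0 & pnear p (fun z => U z = y z / (z - p) ^+ k.+1)]].
Proof.
move=> [m [y hy H]]; have [h|[j [q [hq q0 E]]]] := zero_order hy.
  by constructor 1; apply: pnear_sub (pnear_and (near_pnear h) H) => z _ [-> ->]; rewrite mul0r.
have [mj|jm] := leqP m j.
  constructor 2; exists (j - m)%N, q; split=> //; apply: pnear_sub H => z zp ->.
  have z0 : (z - p) ^+ m != 0 by rewrite expf_neq0 // subr_eq0.
  by rewrite E -{1}(subnK mj) exprD; field.
constructor 3; exists (m - j).-1, q; split=> //; apply: pnear_sub H => z zp ->.
have z0 n : (z - p) ^+ n != 0 by rewrite expf_neq0 // subr_eq0.
rewrite prednK ?subn_gt0 // E.
have -> : (z - p) ^+ m = (z - p) ^+ (m - j) * (z - p) ^+ j by rewrite -exprD subnK // ltnW.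
by field; rewrite !z0.
Qed.

Lemma mero_dich U p : mero U p -> pnear p (fun z => U z = 0) \/ pnear p (fun z => U z != 0).
Proof.
move=> /mero_order [h|[m [y [hy y0 H]]]|[m [y [hy y0 H]]]]; [by left| |]; right;
  have [d d0 D] := hol_cont_neq0 hy y0;
  have N : pnear p (fun z => y z != 0) by exists d => // z _; exact: D.
all: apply: pnear_sub (pnear_and H N) => z zp [-> yz].
all: by rewrite mulf_neq0 // ?invr_eq0 expf_neq0 // subr_eq0.
Qed.

Lemma mero_inv U p : mero U p -> mero (fun z => (U z)^-1) p.
Proof.
move=> /mero_order [h|[m [y [hy y0 H]]]|[m [y [hy y0 H]]]].
- by apply: mero_ext (mero_cst 0 p); apply: pnear_sub h => z _ ->; rewrite invr0.
- exists m, (fun z => (y z)^-1); first exact: hol_inv.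
  by apply: pnear_sub H => z zp ->; rewrite invfM mulrC.
- exists 0%N, (fun z => (y z)^-1 * (z - p) ^+ m.+1).
    by apply: hol_mul; [exact: hol_inv | apply: hol_exp; exact: hol_lin].
  by apply: pnear_sub H => z zp ->; rewrite invfM invrK expr0 divr1.
Qed.

Lemma der_pole y p z m : z != p -> differentiable y z ->
  cder z (fun z => y z / (z - p) ^+ m)
   (((z - p) * dv y z - m%:R * y z) / (z - p) ^+ m.+1).
Proof.
move=> zp /dvP h.
have z0 : z - p != 0 by rewrite subr_eq0.
have z1 : (z - p) ^+ m != 0 by rewrite expf_neq0.
ders.
case: m z1 => [|m] z1; first by rewrite !expr0 expr1; field.
rewrite /= !exprS in z1 *; have z2 : (z - p) ^+ m != 0 by rewrite expf_neq0.
by field; rewrite z0 z2.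
Qed.

Lemma der_zero y p z m : differentiable y z ->
  cder z (fun z => (z - p) ^+ m.+1 * y z)
   ((z - p) ^+ m * (m.+1%:R * y z + (z - p) * dv y z)).
Proof. by move=> /dvP h; ders; rewrite /= exprS; ring. Qed.

Lemma mero_diff U p : mero U p -> pnear p (fun z => differentiable U z).
Proof.
move=> [m [y hy H]]; apply: pnear_sub (pnear_and (pnear_move H) (hol_pnear_diff hy)) => z zp [E dy].
apply: der_diff; apply: der_near (der_pole m zp dy).
by apply: filterS E => w ->.
Qed.

Lemma hol_mulcst y p a : hol y p -> hol (fun z => a * y z) p.
Proof. by move=> hy; apply: hol_mul => //; exact: hol_cst. Qed.
Lemma hol_sub f g p : hol f p -> hol g p -> hol (fun z => f z - g z) p.
Proof.
move=> hf hg; have := hol_add hf (hol_mulcst (-1) hg).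
by congr hol; apply/funext => z; ring.
Qed.

Lemma mero_dv U p : mero U p -> mero (dv U) p.
Proof.
move=> [m [y hy H]]; exists m.+1, (fun z => (z - p) * dv y z - m%:R * y z).
  by apply: hol_sub; [apply: hol_mul; [exact: hol_lin | exact: hol_dv] | exact: hol_mulcst].
apply: pnear_sub (pnear_and (pnear_move H) (hol_pnear_diff hy)) => z zp [E dy].
apply: dv_eq; apply: der_near (der_pole m zp dy).
by apply: filterS E => w ->.
Qed.

Lemma hol_mero_all f : (forall z, differentiable f z) -> forall p, mero f p.
Proof. by move=> h p; apply: mero_hol; exact: hol_all. Qed.

Lemma mero_identity U V p0 : (forall p, mero U p) -> (forall p, mero V p) ->
  pnear p0 (fun z => U z = V z) -> forall p, pnear p (fun z => U z = V z).
Proof.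
move=> hU hV; apply: (@pnear_connected _ (fun z => U z = V z)) => p.
have := mero_dich (mero_add (hU p) (mero_mul (mero_cst (-1) p) (hV p))).
case=> h; [left | right]; apply: pnear_sub h => z _; rewrite mulN1r.
  by move/eqP; rewrite subr_eq0 => /eqP.
by move=> h e; move: h; rewrite e subrr eqxx.
Qed.

Lemma mero_comp f G p : hol G p -> mero f (G p) -> ~ (\forall z \near p, G z = G p) ->
  mero (fun z => f (G z)) p.
Proof.
move=> hG [m [y hy [d d0 D]]] nc.
have hg : hol (fun z => G z - G p) p by apply: hol_sub => //; exact: hol_cst.
have [h|[k [g [hg2 g0 E]]]] := zero_order hg.
  by case: nc; apply: filterS h => z /eqP; rewrite subr_eq0 => /eqP.
exists (k * m)%N, (fun z => y (G z) * (g z ^+ m)^-1).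
  apply: hol_mul; first exact: hol_comp.
  by apply: hol_inv; [exact: hol_exp | rewrite expf_neq0].
have [e e0 He] := hol_cont_neq0 hg2 g0.
have /ccontP/(_ _ d0)[e' e'0 He'] := differentiable_continuous (hol_diff hG).
exists (Num.min e e'); first by rewrite lt_min e0.
move=> z zp; rewrite lt_min => /andP[/He gz /He' Gz].
have zp0 : (z - p) ^+ k != 0 by rewrite expf_neq0 // subr_eq0.
have Gzp : G z != G p by rewrite -subr_eq0 E mulf_neq0.
rewrite D // E exprMn -exprM.
have n1 : g z ^+ m != 0 by rewrite expf_neq0.
have n2 : (z - p) ^+ (k * m) != 0 by rewrite exprM expf_neq0.
by field; rewrite n1 n2.
Qed.

Lemma mero_def f : meromorphic f -> forall p, mero f p.
Proof.
move=> H p; have [h [k [/hol_def hh /hol_def hk nk E]]] := H p.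
have [//|[m [q [hq q0 Ek]]]] := zero_order hk.
exists m, (fun z => h z * (q z)^-1); first by apply: hol_mul => //; exact: hol_inv.
have [d d0 D] := hol_cont_neq0 hq q0.
have N : pnear p (fun z => q z != 0) by exists d => // z _; exact: D.
apply: pnear_sub (pnear_and (near_pnear E) N) => z zp [Ez qz].
rewrite Ez; first by rewrite Ek invfM mulrA mulrAC.
by rewrite Ek mulf_neq0 // expf_neq0 // subr_eq0.
Qed.

Lemma expo_eq f g p k l : hol f p -> hol g p -> f p != 0 -> g p != 0 ->
  pnear p (fun z => (z - p) ^+ k * f z = (z - p) ^+ l * g z) -> k = l.
Proof.
wlog kl : f g k l / (k <= l)%N => [hw|] hf hg f0 g0 H.
  have [kl|/ltnW lk] := leqP k l; first exact: (hw f g).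
  by apply/esym/(hw g f) => //; apply: pnear_sub H => z _ ->.
apply/eqP; rewrite eqn_leq kl leqNgt; apply/negP => lt; move/eqP: f0; apply.
have hl : hol (fun z => (z - p) ^+ (l - k) * g z) p.
  by apply: hol_mul => //; apply: hol_exp; exact: hol_lin.
have E : pnear p (fun z => f z = (z - p) ^+ (l - k) * g z).
  apply: pnear_sub H => z zp; have zk : (z - p) ^+ k != 0 by rewrite expf_neq0 // subr_eq0.
  have -> : (z - p) ^+ l = (z - p) ^+ k * (z - p) ^+ (l - k) by rewrite -exprD subnKC.
  by rewrite -mulrA => /(mulfI zk).
rewrite (hol_pnear_eq hf hl E) subrr expr0n subn_eq0 leqNgt lt.
exact: mul0r.
Qed.

(** Take [V p := Y p p] for local representatives [Y p]. Near [p] this agrees with [Y p], since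
    [Y p] and [Y z] are holomorphic at [z] and coincide around it. *)
Lemma pnear_extend W : (forall p, exists2 y, hol y p & pnear p (fun z => W z = y z)) ->
  exists V, (forall z, differentiable V z) /\ forall p, pnear p (fun z => W z = V z).
Proof.
move=> H.
have [Y HY] : exists Y : C -> C -> C, forall p, hol (Y p) p /\ pnear p (fun z => W z = Y p z).
  have ex p : exists y, hol y p /\ pnear p (fun z => W z = y z).
    by have [y h1 h2] := H p; exists y.
  by have [Y HY] := choice ex; exists Y.
pose V p := Y p p; exists V.
have E p : \forall z \near p, Y p z = V z.
  have [hp Hp] := HY p; have [d d0 D] := pnear_move Hp; case: hp => e e0 De.
  apply/nearCP; exists (Num.min d e); first by rewrite lt_min d0.
  move=> z; rewrite lt_min => /andP[zd ze]; have [->//|zp] := eqVneq z p.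
  have [hz Hz] := HY z.
  apply: (@hol_pnear_eq (Y p) (Y z) z) => //.
    exists (e - cmod (z - p)); first by lra.
    by move=> w hw; apply: De; have := cmod_tri w z p; lra.
  by apply: pnear_sub (pnear_and (near_pnear (D z zp zd)) Hz) => w _ [<-].
split=> p.
  by have [hp _] := HY p; apply: hol_diff; apply: hol_near hp _; exact: E.
by have [_ Hp] := HY p; apply: pnear_sub (pnear_and Hp (near_pnear (E p))) => z _ [-> ->].
Qed.
End Mero.

(** * The equation in one variable *)

Section OneVariable.
Variable R : realType.
Local Notation C := (Cplx R).
Implicit Types (f g y U V W G : C -> C) (a b c z w p : C) (k l m : nat) (P Q : {poly C}).

(** The homogenisation of [P]. At a pole [U = y / (z - p) ^+ j.+1] it is the holomorphic numerator
    of [P.[U]], nonzero at [p] by [homog0]. *)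
Definition homog P a b : C :=
  \sum_(i < size P) P`_i * a ^+ i * b ^+ ((size P).-1 - i).

Lemma homogE P a b : b != 0 -> P.[a / b] * b ^+ (size P).-1 = homog P a b.
Proof.
move=> b0; rewrite horner_coef mulr_suml; apply: eq_bigr => i _.
have iP : (i <= (size P).-1)%N by rewrite -ltnS (leq_trans (ltn_ord i)) // leqSpred.
have -> : b ^+ (size P).-1 = b ^+ ((size P).-1 - i) * b ^+ i by rewrite -exprD subnK.
have bi : b ^+ i != 0 by rewrite expf_neq0.
by rewrite expr_div_n; field.
Qed.

Lemma homog0 P a : P != 0 -> homog P a 0 = lead_coef P * a ^+ (size P).-1.
Proof.
move=> P0; rewrite /homog lead_coefE.
have : size P = (size P).-1.+1 by rewrite prednK // lt0n size_poly_eq0.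
move: (size P).-1 => n ->; rewrite big_ord_recr /= big1 ?add0r ?subnn ?expr0 ?mulr1 //.
by move=> i _; rewrite expr0n subn_eq0 leqNgt ltn_ord mulr0.
Qed.

Lemma hol_homog P f g p : hol f p -> hol g p -> hol (fun z => homog P (f z) (g z)) p.
Proof.
move=> hf hg; rewrite /homog; move: (index_enum _) => s.
elim: s => [|i s IH]; first by under eq_fun do rewrite big_nil; exact: hol_cst.
under eq_fun do rewrite big_cons; apply: hol_add => //.
by apply: hol_mul; [apply: hol_mulcst|]; exact: hol_exp.
Qed.

Lemma hol_id p : hol (fun z => z) p.
Proof. by apply: hol_all => z; diffs. Qed.

Lemma hol_poly P f p : hol f p -> hol (fun z => P.[f z]) p.
Proof.
move=> hf; elim/poly_ind: P => [|P c IH].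
  by under eq_fun do rewrite horner0; exact: hol_cst.
under eq_fun do rewrite hornerMXaddC.
by apply: hol_add; [apply: hol_mul | exact: hol_cst].
Qed.

Lemma hol_lower f p : hol f p -> f p != 0 -> exists2 d : R, 0 < d &
  forall z, cmod (z - p) < d -> cmod (f p) / 2 <= cmod (f z).
Proof.
move=> /hol_diff/differentiable_continuous/ccontP h; rewrite -cmod_gt0 => f0.
have e0 : 0 < cmod (f p) / 2 by lra.
have [d d0 D] := h _ e0; exists d => // z /D hz.
by have := cmod_revtri (f p) (f z); rewrite cmodBC; lra.
Qed.

(** [P.[x] = homog P 1 x^-1 * x ^+ (size P).-1], and the first factor tends to the leading
    coefficient. [1 <= M] lets lower powers of [cmod x] be compared later. *)
Lemma poly_lower P : P != 0 -> exists c M : R, [/\ 0 < c, 1 <= M &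
  forall x, M < cmod x -> c * cmod x ^+ (size P).-1 <= cmod P.[x]].
Proof.
move=> P0; have h0 := homog0 1 P0; rewrite expr1n mulr1 in h0.
have l0 : homog P 1 0 != 0 by rewrite h0 lead_coef_eq0.
have [d d0 D] := hol_lower (hol_homog P (hol_cst 0 1) (hol_id 0)) l0.
exists (cmod (homog P 1 0) / 2), (1 + d^-1); have i0 : 0 < d^-1 by rewrite invr_gt0.
split; [by rewrite divr_gt0 // cmod_gt0 | by lra |].
move=> x hx; have x0 : x != 0 by rewrite -cmod_gt0; lra.
have xd : cmod (x^-1 - 0) < d.
  by rewrite subr0 cmodV -[d]invrK ltf_pV2 ?posrE ?cmod_gt0 //; lra.
have := D _ xd => h.
have : P.[x] = homog P 1 x^-1 * x ^+ (size P).-1.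
  rewrite -homogE ?invr_eq0 // div1r invrK -mulrA exprVn mulVf ?mulr1 //.
  by rewrite expf_neq0.
by move=> ->; rewrite cmodM cmodX ler_wpM2r // exprn_ge0 // cmod_ge0.
Qed.

(** Constants are included ([A = 0]), so degenerate left factors are covered too. *)
Definition affine f := exists A, exists B, forall p, pnear p (fun z => f z = A * z + B).

Section AffineComposite.
Variables (f G : C -> C) (a b : C).
Hypotheses (mf : forall p, mero f p) (hf : hol f (G 0)) (dG : forall z, differentiable G z).
Hypotheses (a0 : a != 0) (E : \forall z \near (0 : C), f (G z) = a * z + b).

Let hG p : hol G p := hol_all p dG.

Lemma affine_nonconst p : ~ (\forall z \near p, G z = G p).
Proof.
move=> H.
have H0 : pnear 0 (fun z => G z = G p).
  apply: (@mero_identity _ G (fun=> G p) p).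
  - exact: hol_mero_all.
  - by move=> q; exact: mero_cst.
  - exact: near_pnear.
have K := pnear_and H0 (pnear_and (near_pnear E) (pnear_triv 0 (fun z => erefl z))).
case: K => d d0 D.
pose z := rc (d / 2) : C; pose w := rc (d / 4) : C.
have zd : cmod (z - 0) < d by rewrite subr0 cmod_rc ger0_norm; lra.
have wd : cmod (w - 0) < d by rewrite subr0 cmod_rc ger0_norm; lra.
have z0 : z != 0 by rewrite -cmod_gt0 cmod_rc normr_gt0 gt_eqF //; lra.
have w0 : w != 0 by rewrite -cmod_gt0 cmod_rc normr_gt0 gt_eqF //; lra.
have [e1 [e2 _]] := D z z0 zd; have [e3 [e4 _]] := D w w0 wd.
have : a * z + b = a * w + b by rewrite -e2 -e4 e1 e3.
move=> /addIr/(mulfI a0)/rc_inj; lra.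
Qed.

(** [G t] can be within [e] of [p = G 0] only for [cmod t < 1], as otherwise [a * t + b] would be
    too far from [b]; and [G t = p] only at [t = 0], a simple zero. So [K t = t / (G t - p)] is
    entire without zeros and at most [cmod t / e] for [cmod t >= 1]. By Liouville it is affine, and
    having no zero it is constant; thus [G] is affine, and so is [f]. *)
Lemma affine_left : affine f.
Proof.
pose p := G 0.
have ident q : pnear q (fun z => f (G z) = a * z + b).
  apply: (@mero_identity _ (fun z => f (G z)) (fun z => a * z + b) 0).
  - by move=> t; apply: mero_comp => //; exact: affine_nonconst.
  - by apply: hol_mero_all => t; diffs.
  - exact: near_pnear.
have exact q : hol f (G q) -> f (G q) = a * q + b.
  move=> h; apply: (@hol_pnear_eq _ (fun z => f (G z)) (fun z => a * z + b) q) => //.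
    exact: hol_comp.
  by apply: hol_all => t; diffs.
have fp : f p = b by rewrite exact // mulr0 add0r.
have a1 : 0 < cmod a by rewrite cmod_gt0.
have [e [e0 He]] : exists e : R, 0 < e /\ forall w, cmod (w - p) < e -> hol f w /\ cmod (f w - b) < cmod a.
  have [d d0 D] := hf.
  have /differentiable_continuous/ccontP/(_ _ a1)[d' d'0 D'] := hol_diff hf.
  exists (Num.min d d'); split; first by rewrite lt_min d0.
  move=> w; rewrite lt_min => /andP[wd wd']; split; last by rewrite -fp; exact: D'.
  exists (d - cmod (w - p)); first by lra.
  by move=> z zw; apply: D; have := cmod_tri z w p; rewrite -/p; lra.
have far t : cmod (G t - p) < e -> cmod t < 1.
  move=> /He [h1 h2]; move: h2; rewrite exact // addrK cmodM.
  by rewrite -ltr_pdivlMl // mulVf // gt_eqF.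
have Gp t : G t = p -> t = 0.
  move=> h; have : f (G t) = a * t + b by apply: exact; rewrite h.
  by rewrite h fp -{1}[b]add0r => /addIr/esym/eqP; rewrite mulf_eq0 (negPf a0) /= => /eqP.
have dG0 : dv G 0 != 0.
  have h1 := der_comp (dvP (dG 0)) (dvP (hol_diff hf)).
  have h2 : cder (0 : C) (f \o G) a.
    have h3 : cder (0 : C) (fun z => a * z + b) a.
      by ders; rewrite ?mul0r ?add0r ?addr0 ?mulr1.
    by apply: der_near h3; apply: filterS E => z /= ->.
  apply/eqP => h0; move: (der_unique h1 h2); rewrite h0 mulr0 => /esym/eqP.
  by rewrite (negPf a0).
pose q := quo G 0.
have dq t : differentiable q t by apply: quo_diff.
have Eq t : G t = p + t * q t by rewrite (quoE G 0 t) subr0.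
have q0 t : q t != 0.
  apply/eqP => h; have t0 : t = 0 by apply: Gp; rewrite Eq h mulr0 addr0.
  by move: h; rewrite t0 /q /quo eqxx => /eqP; rewrite (negPf dG0).
pose K t := (q t)^-1.
have dK t : differentiable K t.
  by have h := dvP (dq t); have n0 := q0 t; rewrite /K; diffs.
have e1 : 0 <= e^-1 by rewrite invr_ge0 ltW.
have [|A [B HK]] := @liouville_lin _ K e^-1 1 dK e1.
  move=> t t1; have t0 : t != 0 by rewrite -cmod_gt0; lra.
  have et : e <= cmod (G t - p) by rewrite leNgt; apply/negP => /far; lra.
  have -> : K t = t / (G t - p).
    by rewrite Eq (addrC p) addrK /K; have := q0 t; move=> h; field; rewrite t0 h.
  rewrite cmodM cmodV mulrC ler_wpM2r ?cmod_ge0 // lef_pV2 ?posrE //.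
  exact: lt_le_trans et.
have B0 : B = 0.
  apply/eqP/negPn/negP => B0; have := HK (- A / B).
  rewrite divfK // addrN => /eqP; rewrite /K invr_eq0; exact/negP/q0.
have A0 : A != 0 by have := HK 0; rewrite B0 mulr0 addr0 => <-; rewrite /K invr_eq0.
have GE t : G t = p + t / A.
  by rewrite Eq; congr (_ + _ * _); rewrite -[q t]invrK -/(K t) HK B0 mulr0 addr0.
exists (a * A), (b - a * A * p).
apply: (@mero_identity _ _ _ p) => //.
  by apply: hol_mero_all => t; diffs.
have [d d0 D] : exists2 d : R, 0 < d & forall z, cmod (z - 0) < d -> f (G z) = a * z + b.
  by apply/nearCP.
apply: near_pnear; apply/nearCP; exists (d / cmod A); first by rewrite divr_gt0 // cmod_gt0.
move=> w; rewrite ltr_pdivlMr ?cmod_gt0 // -cmodM => hw.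
have := D ((w - p) * A); rewrite subr0 => /(_ hw); rewrite GE mulfK // addrC subrK => ->.
by ring.
Qed.
End AffineComposite.
End OneVariable.

(** * Entire solutions, poles and omitted values for U' ^ l = k P(U) *)

Section OneVariableMain.
Variable R : realType.
Local Notation C := (Cplx R).
Variables (f G : Cplx R -> Cplx R) (P : {poly Cplx R}) (l : nat) (k : Cplx R).
Let U z := f (G z).
Hypotheses (mf : forall p, mero f p) (hf : hol f (G 0)) (dG : forall z, differentiable G z).
Hypotheses (k0 : k != 0) (l0 : (0 < l)%N) (P0 : P != 0).
Hypothesis ode0 : \forall z \near (0 : C), dv U z ^+ l = k * P.[U z].
Hypothesis dU0 : dv U 0 != 0.

Let hU : hol U 0.
Proof. by apply: hol_comp => //; exact: hol_all. Qed.

Lemma dv_cst (a z : C) : dv (fun=> a) z = 0.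
Proof. exact: dv_eq (der_cst a z). Qed.

Let nonconst_near (a : C) : ~ (\forall z \near (0 : C), U z = a).
Proof. by move=> h; move/eqP: dU0; apply; rewrite (dv_near h hU) dv_cst. Qed.

Let G_nonconst p : ~ (\forall z \near p, G z = G p).
Proof.
move=> H; apply: (@nonconst_near (f (G p))).
have E : pnear 0 (fun z => G z = G p).
  apply: (@mero_identity _ G (fun=> G p) p); [exact: hol_mero_all | | exact: near_pnear].
  by move=> q; exact: mero_cst.
have := hol_pnear_near (hol_all 0 dG) (hol_cst 0 (G p)) E.
by apply: filterS => z; rewrite /U => ->.
Qed.

Let mU p : mero U p.
Proof. by apply: mero_comp; [exact: hol_all | exact: mf | exact: G_nonconst]. Qed.

Let ode p : pnear p (fun z => dv U z ^+ l = k * P.[U z]).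
Proof.
apply: (@mero_identity _ _ _ 0); last exact: near_pnear ode0.
  by move=> q; apply: mero_exp; exact: mero_dv.
by move=> q; apply: mero_mul; [exact: mero_cst | exact: mero_poly].
Qed.

Let nonconst p (a : C) : ~ pnear p (fun z => U z = a).
Proof.
move=> H; apply: (@nonconst_near a); apply: hol_pnear_near => //; first exact: hol_cst.
by apply: (@mero_identity _ U (fun=> a) p) => // q; exact: mero_cst.
Qed.

(** Degree at least [l + 1] is exactly what [blowup] requires; a bounded [V] is constant by
    Liouville, against [dv U 0 != 0]. *)
Lemma no_entire : (l < (size P).-1)%N -> (forall p, exists2 y, hol y p & pnear p (fun z => U z = y z)) ->
  False.
Proof.
move=> lP /pnear_extend [V [dV UV]].
have dUV p : pnear p (fun z => dv V z = dv U z).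
  apply: pnear_sub (pnear_dv (UV p) (mero_diff (mU p))) => z _ ->; exact: erefl.
have odeV z : dv V z ^+ l = k * P.[V z].
  apply: (@hol_pnear_eq _ (fun z => dv V z ^+ l) (fun z => k * P.[V z]) z).
  - by apply: hol_exp; apply: hol_dv; exact: hol_all.
  - by apply: hol_mulcst; apply: hol_poly; exact: hol_all.
  - by apply: pnear_sub (pnear_and (dUV z) (pnear_and (UV z) (ode z))) => w _ [-> [<- ->]].
have [c [M [c0 M1 H]]] := poly_lower P0.
have kc : 0 < cmod k * c by rewrite mulr_gt0 // cmod_gt0.
have M0 : 0 <= M by lra.
have bV : forall z, cmod (V z) <= M.
  apply: (blowup dV l0 kc M0) => z hz.
  rewrite -(cmodX (dv V z)) odeV cmodM -mulrA; apply: ler_wpM2l; first exact: cmod_ge0.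
  apply: le_trans (H _ hz); rewrite ler_wpM2l ?(ltW c0) //.
  by rewrite ler_weXn2l //; lra.
have cV := liouville dV bV.
by apply: (@nonconst 0 (V 0)); apply: pnear_sub (UV 0) => z _ ->.
Qed.

(** At a pole of order [j.+1] the two sides of the equation have poles of order [j.+2 * l] and
    [j.+1 * (size P).-1]. Where these never agree there is no pole, and [no_entire] applies. *)
Lemma no_pole : (l < (size P).-1)%N ->
  (forall j, (j.+2 * l)%N <> (j.+1 * (size P).-1)%N) -> False.
Proof.
move=> lP ne; apply: no_entire => // p.
have [h|[m [y [hy y0 H]]]|[j [y [hy y0 H]]]] := mero_order (mU p).
- by exists (fun=> 0); [exact: hol_cst | exact: h].
- exists (fun z => (z - p) ^+ m * y z) => //.
  by apply: hol_mul => //; apply: hol_exp; exact: hol_lin.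
case: (ne j); set d := (size P).-1 in lP ne *.
have hh : hol (fun z => homog P (y z) ((z - p) ^+ j.+1)) p.
  by apply: hol_homog => //; apply: hol_exp; exact: hol_lin.
have hd : hol (fun z => (z - p) * dv y z - j.+1%:R * y z) p.
  by apply: hol_sub; [apply: hol_mul; [exact: hol_lin | exact: hol_dv] | exact: hol_mulcst].
apply/esym/(@expo_eq _ (fun z => ((z - p) * dv y z - j.+1%:R * y z) ^+ l)
  (fun z => k * homog P (y z) ((z - p) ^+ j.+1)) p).
- exact: hol_exp.
- exact: hol_mulcst.
- by rewrite expf_neq0 // subrr mul0r sub0r oppr_eq0 mulf_neq0 // pnatr_eq0.
- rewrite subrr expr0n /= homog0 // mulf_neq0 // mulf_neq0 ?lead_coef_eq0 //.
  by rewrite expf_neq0.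
apply: pnear_sub (pnear_and (pnear_move H) (pnear_and (hol_pnear_diff hy) (pnear_and H (ode p)))).
move=> z zp [Ez [dy [Uz]]].
have zj n : (z - p) ^+ n != 0 by rewrite expf_neq0 // subr_eq0.
have -> : dv U z = ((z - p) * dv y z - j.+1%:R * y z) / (z - p) ^+ j.+2.
  apply: dv_eq; apply: der_near (der_pole j.+1 zp dy).
  by apply: filterS Ez => w ->.
rewrite Uz -homogE // expr_div_n -!exprM -/d => E.
have -> : (((z - p) * dv y z - j.+1%:R * y z) ^+ l) =
    (((z - p) * dv y z - j.+1%:R * y z) ^+ l) / (z - p) ^+ (j.+2 * l) * (z - p) ^+ (j.+2 * l).
  by rewrite divfK.
by rewrite E; ring.
Qed.

(** The simple zero [a] of [P] cannot be a value of [U], so [V = 1 / (U - a)] is entire; poles of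
    [U] become zeros of [V]. It solves [V' ^ l = (-1)^l k Q(a + 1/V) V^(2l-1)], where [Q(a + 1/V)]
    stays away from [0] for large [V] and [2l - 1 >= l + 1]; by [blowup] and Liouville [V] is
    constant. *)
Lemma no_omitted Q a : (2 < l)%N -> Q.[a] != 0 -> P = Q * ('X - a%:P) -> False.
Proof.
move=> l3 Qa EP.
have PE w : P.[w] = Q.[w] * (w - a) by rewrite EP hornerM hornerXsubC.
have mUa p : mero (fun z => U z - a) p.
  have := mero_add (mU p) (mero_cst (- a) p); by [].
have Ua p : pnear p (fun z => U z - a != 0).
  have [h|//] := mero_dich (mUa p); case: (@nonconst p a).
  by apply: pnear_sub h => z _ /eqP; rewrite subr_eq0 => /eqP.
have [|V [dV WV]] := @pnear_extend _ (fun z => (U z - a)^-1).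
  move=> p; have [h|[m [y [hy y0 H]]]|[j [y [hy y0 H]]]] := mero_order (mUa p).
  - by exists (fun=> 0); [exact: hol_cst | apply: pnear_sub h => z _ ->; rewrite invr0].
  - case: m H => [|m] H.
      exists (fun z => (y z)^-1); first exact: hol_inv.
      by apply: pnear_sub H => z _ ->; rewrite expr0 mul1r.
    exfalso; have hz : hol (fun z => (z - p) ^+ m.+1 * y z) p.
      by apply: hol_mul => //; apply: hol_exp; exact: hol_lin.
    (* Order of vanishing of [dv U ^+ l] against that of [P.[U]]. For [l >= 3] this is absurd:
       [m = 0] gives [0 = 1], and [m > 0] makes the left side too large. *)
    suff : (m * l)%N = m.+1 by case: m {H hz} => [|m]; nia.
    apply: (@expo_eq _ (fun z => (m.+1%:R * y z + (z - p) * dv y z) ^+ l)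
      (fun z => k * (Q.[a + (z - p) ^+ m.+1 * y z] * y z)) p).
    + apply: hol_exp; apply: hol_add; first exact: hol_mulcst.
      by apply: hol_mul; [exact: hol_lin | exact: hol_dv].
    + apply: hol_mulcst; apply: hol_mul => //; apply: hol_poly.
      by apply: hol_add => //; exact: hol_cst.
    + by rewrite expf_neq0 // subrr mul0r addr0 mulf_neq0 // pnatr_eq0.
    + by rewrite subrr expr0n mul0r addr0 mulf_neq0 // mulf_neq0.
    apply: pnear_sub (pnear_and (pnear_move H) (pnear_and (hol_pnear_diff hy) (pnear_and H (ode p)))).
    move=> z zp [Ez [dy [Uz]]].
    have UE : U z = a + (z - p) ^+ m.+1 * y z by rewrite -Uz addrC subrK.
    have -> : dv U z = (z - p) ^+ m * (m.+1%:R * y z + (z - p) * dv y z).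
      apply: dv_eq; have D := der_add (der_cst a z) (der_zero p m dy).
      apply: der_eq (der_near _ D) (add0r _).
      by apply: filterS Ez => w <-; rewrite addrC subrK.
    rewrite exprMn -exprM => ->; rewrite PE Uz UE; ring.
  - exists (fun z => (y z)^-1 * (z - p) ^+ j.+1).
      by apply: hol_mul; [exact: hol_inv | apply: hol_exp; exact: hol_lin].
    by apply: pnear_sub H => z _ ->; rewrite invfM invrK.
have odeV z : V z != 0 -> dv V z ^+ l = (-1) ^+ l * k * Q.[a + (V z)^-1] * V z ^+ (l + l.-1).
  move=> Vz; have hV : hol V z := hol_all z dV.
  apply: (@hol_pnear_eq _ (fun z => dv V z ^+ l)
    (fun z => (-1) ^+ l * k * Q.[a + (V z)^-1] * V z ^+ (l + l.-1)) z).
  - by apply: hol_exp; exact: hol_dv.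
  - apply: hol_mul; last exact: hol_exp.
    apply: hol_mulcst; apply: hol_poly; apply: hol_add; first exact: hol_cst.
    exact: hol_inv.
  apply: pnear_sub (pnear_and (pnear_move (WV z)) (pnear_and (mero_diff (mU z))
    (pnear_and (Ua z) (pnear_and (WV z) (ode z))))) => w wz [E1 [/dvP dU [Uw [WVw]]]].
  have dw : dv V w = (- dv U w) / (U w - a) ^+ 2.
    have h := @der_inv _ (fun z => U z - a) w _ Uw (der_sub dU (der_cst a w)).
    by rewrite subr0 in h; exact: dv_eq (der_near E1 h).
  rewrite dw expr_div_n [(- dv U w) ^+ l]exprNn => ->.
  rewrite -WVw invrK (addrC a) subrK PE.
  have -> : (U w - a) ^+ 2 ^+ l = (U w - a) ^+ (l + l.-1) * (U w - a).
    by rewrite -exprSr -exprM -addnS prednK // addnn mul2n.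
  have n1 : (U w - a) ^+ (l + l.-1) != 0 by rewrite expf_neq0.
  by rewrite exprVn; field; rewrite Uw n1.
have hQ : hol (fun x => Q.[a + x]) 0.
  by apply: hol_poly; apply: hol_add; [exact: hol_cst | exact: hol_id].
have [|d d0 D] := hol_lower hQ; first by rewrite addr0.
rewrite addr0 in D.
pose M := 1 + d^-1; have i0 : 0 < d^-1 by rewrite invr_gt0.
have M0 : 0 <= M by rewrite /M; lra.
have c0 : 0 < cmod k * (cmod Q.[a] / 2) by rewrite mulr_gt0 ?divr_gt0 // cmod_gt0.
have bV : forall z, cmod (V z) <= M.
  apply: (blowup dV l0 c0 M0) => z; rewrite /M => hz.
  have Vz : V z != 0 by rewrite -cmod_gt0; lra.
  have sgn : cmod ((-1 : C) ^+ l) = 1 by rewrite cmodX cmodN cmod1 expr1n.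
  rewrite -(cmodX (dv V z)) odeV //.
  move: (D (V z)^-1); set q := Q.[a + (V z)^-1] => Dq.
  have -> : cmod ((-1) ^+ l * k * q * V z ^+ (l + l.-1)) = cmod k * cmod q * cmod (V z) ^+ (l + l.-1).
    rewrite cmodM (cmodX (V z)); congr (_ * _); rewrite cmodM; congr (_ * _).
    by rewrite cmodM sgn mul1r.
  apply: ler_pM; rewrite ?exprn_ge0 ?cmod_ge0 ?(ltW c0) //.
    apply: ler_wpM2l; first exact: cmod_ge0.
    by apply: Dq; rewrite subr0 cmodV -[d]invrK ltf_pV2 ?posrE ?cmod_gt0 //; lra.
  apply: ler_weXn2l; first by apply: ltW; apply: lt_trans hz; rewrite ltrDl.
  by rewrite -addn1 leq_add2l -ltnS prednK // ltnW.
have cV := liouville dV bV.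
apply: (@nonconst 0 (a + (V 0)^-1)); apply: pnear_sub (WV 0) => z _.
by rewrite cV => <-; rewrite invrK addrC subrK.
Qed.

Lemma dv_cst_affine g (c : C) : hol g 0 -> (\forall z \near (0 : C), dv g z = c) ->
  \forall z \near (0 : C), g z = c * z + g 0.
Proof.
move=> hg E; have hg2 : hol (fun z => g z - c * z) 0.
  by apply: hol_sub => //; apply: hol_mulcst; exact: hol_id.
have := dv0_cst hg2; rewrite mulr0 subr0 => H.
apply: filterS (H _) => [z <-|]; first by rewrite addrC subrK.
move/nearCP: E => [d d0 D]; case: hg => d' d'0 D'.
apply/nearCP; exists (Num.min d d'); first by rewrite lt_min d0.
move=> z; rewrite lt_min => /andP[/D h1 /D'/dvP h2].
apply: dv_eq; ders; rewrite h1; ring.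
Qed.

(** Differentiating the constant [dv U ^+ l] gives [dv (dv U) = 0] without choosing an [l]-th
    root. *)
Lemma affine_const c : c != 0 -> P = c%:P -> affine f.
Proof.
move=> c0 EP; have hdU := hol_dv hU.
apply: (@affine_left _ f G (dv U 0) (U 0)) => //.
apply: dv_cst_affine => //; apply: dv0_cst => //.
have [d d0 D] := hol_cont_neq0 hdU dU0.
move/nearCP: ode0 => [d1 d10 D1]; case: (hdU) => d2 d20 D2.
pose e := Num.min (Num.min d d1) d2.
apply/nearCP; exists e; first by rewrite !lt_min d0 d10.
move=> z; rewrite !lt_min => /andP[/andP[zd zd1] zd2].
have h1 := der_exp l (dvP (D2 z zd2)).
have h2 : cder z (fun z => dv U z ^+ l) 0.
  apply: der_near (der_cst (k * c) z); apply/nearCP; exists (d1 - cmod (z - 0)); first by lra.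
  by move=> w hw; rewrite D1 ?EP ?hornerC //; have := cmod_tri w z 0; lra.
have /eqP := der_unique h1 h2; rewrite mulf_eq0 => /orP[|/eqP //].
by rewrite mulf_eq0 pnatr_eq0 -[l == 0%N]negbK -lt0n l0 /= expf_eq0 (negPf (D z zd)) andbF.
Qed.

(** [(1 / (U - a))' = - k * c]; [U 0 != a] because [dv U 0 != 0]. *)
Lemma affine_square c a : l = 1%N -> c != 0 -> P = c *: ('X - a%:P) ^+ 2 ->
  affine (fun z => (f z - a)^-1).
Proof.
move=> l1 c0 EP.
have PE w : P.[w] = c * (w - a) ^+ 2 by rewrite EP hornerZ horner_exp hornerXsubC.
move/nearCP: ode0 => [d1 d10 D1].
have U0a : U 0 - a != 0.
  apply/eqP => h; have := D1 0; rewrite subrr cmod0 => /(_ d10).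
  by rewrite l1 expr1 PE h expr0n mulr0 mulr0; apply/eqP.
have hfa : hol (fun z => f z - a) (G 0) by apply: hol_sub => //; exact: hol_cst.
have hUa : hol (fun z => U z - a) 0 by apply: hol_sub => //; exact: hol_cst.
have [d d0 D] := hol_cont_neq0 hUa U0a.
apply: (@affine_left _ (fun z => (f z - a)^-1) G (- (k * c)) ((U 0 - a)^-1)) => //.
- by move=> p; apply: mero_inv; exact: mero_add (mf p) (mero_cst (- a) p).
- exact: hol_inv.
- by rewrite oppr_eq0 mulf_neq0.
apply: (@dv_cst_affine (fun z => (U z - a)^-1)); first exact: hol_inv.
case: (hU) => d2 d20 D2.
apply/nearCP; exists (Num.min (Num.min d d1) d2); first by rewrite !lt_min d0 d10.
move=> z; rewrite !lt_min => /andP[/andP[/D zd /D1 zd1] /D2/dvP zd2].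
have h := @der_inv _ (fun z => U z - a) z _ zd (der_sub zd2 (der_cst a z)).
rewrite (dv_eq h); move: zd1; rewrite l1 expr1 PE subr0 => ->; field; exact: zd.
Qed.
End OneVariableMain.

(** * Characteristics in several variables *)

Section Mixed.
Variable R : realType.
Local Notation C := (Cplx R).
Implicit Types (f g : C -> C) (a b c z w p s t h : C).

Lemma quad_der f z l (d M : R) : 0 < d ->
  (forall w, cmod (w - z) < d -> cmod (f w - f z - l * (w - z)) <= M * cmod (w - z) ^+ 2) ->
  cder z f l.
Proof.
move=> d0 H; apply/cderP => e e0.
have M1 : 0 < `|M| + 1 by have := normr_ge0 M; lra.
exists (Num.min d (e / (`|M| + 1))); first by rewrite lt_min d0 divr_gt0.
move=> w; rewrite lt_min => /andP[/H h1]; rewrite ltr_pdivlMr // => h2.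
apply: le_trans h1 _; rewrite expr2 mulrA; apply: ler_wpM2r; first exact: cmod_ge0.
by have := ler_norm M; have := cmod_ge0 (w - z); nra.
Qed.

(** The second difference quotient at [p] is again holomorphic, so [sup_est] bounds it; the
    resulting constant does not depend on [f], [p], [r] or [S]. *)
Lemma taylor_const : exists2 K : R, 1 <= K & forall f p (r S : R), 0 < r ->
  (forall z, disc p r z -> differentiable f z) -> (forall z, disc p r z -> cmod (f z) <= S) ->
  cmod (dv f p) <= K * S / r /\
  forall z, cmod (z - p) < r / 4 ->
    cmod (f z - f p - dv f p * (z - p)) <= K * S / r ^+ 2 * cmod (z - p) ^+ 2.
Proof.
have [A A1 HA] : exists2 A : R, 1 <= A & forall f p (r S : R), 0 < r ->
    (forall z, disc p r z -> differentiable f z) -> (forall z, disc p r z -> cmod (f z) <= S) ->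
    cmod (dv f p) <= A * S / r.
  exists 256; first by lra.
  move=> f p r S r0 df bf.
  have pp : disc p r p by rewrite /disc subrr cmod0 ltW.
  apply: (dv_est r0 df (fun x hx => bf x (edge_disc hx)) (bf p pp)).
  by rewrite subrr cmod0 divr_gt0.
(* The [32] of [sup_est] times the contour bound [2 * (A + 4) * S / r ^+ 2] for [q2]. *)
exists (64 * (A + 4)); first by lra.
move=> f p r S r0 df bf; have hA := HA f p r S r0 df bf.
have S0 : 0 <= S.
  by apply: le_trans (cmod_ge0 (f p)) (bf p _); rewrite /disc subrr cmod0 ltW.
have Sr : 0 <= S / r by rewrite divr_ge0 // ltW.
split.
  apply: le_trans hA _; rewrite -[A * S / r]mulrA -[64 * _ * S / r]mulrA.
  by apply: ler_wpM2r => //; lra.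
have hf : hol f p by exists r => // z zr; apply: df; rewrite /disc ltW.
pose q := quo f p.
have dq z : disc p r z -> differentiable q z by move=> dz; apply: quo_diff => //; exact: df.
have hq : hol q p by exists r => // z zr; apply: dq; rewrite /disc ltW.
pose q2 := quo q p.
have dq2 z : disc p r z -> differentiable q2 z by move=> dz; apply: quo_diff => //; exact: dq.
have qp : q p = dv f p by rewrite /q /quo eqxx.
have inv2 z : edge p r z -> z != p /\ (cmod (z - p))^-1 <= 2 / r.
  move=> hz; have h := edge_p r0 hz; have r20 : 0 < r / 2 by rewrite divr_gt0.
  have z0 : 0 < cmod (z - p) by apply: lt_le_trans h.
  split; first by rewrite -subr_eq0 -cmod_gt0.
  by rewrite -[2 / r]invrK invf_div lef_pV2 ?posrE.
have bq z : edge p r z -> cmod (q z) <= 4 * S / r.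
  move=> hz; have [zp h] := inv2 z hz; rewrite /q /quo (negPf zp) cmodM cmodV.
  have -> : 4 * S / r = (S + S) * (2 / r) by ring.
  apply: ler_pM; rewrite ?invr_ge0 ?cmod_ge0 //.
  rewrite (le_trans (cmodB _ _)) // lerD ?bf //; first exact: (edge_disc hz).
  by rewrite /disc subrr cmod0 ltW.
have bq2 z : edge p r z -> cmod (q2 z) <= 2 * (A + 4) * S / r ^+ 2.
  move=> hz; have [zp h] := inv2 z hz; rewrite /q2 /quo (negPf zp) cmodM cmodV.
  have -> : 2 * (A + 4) * S / r ^+ 2 = (4 * S / r + A * S / r) * (2 / r).
    by field; rewrite gt_eqF.
  apply: ler_pM; rewrite ?invr_ge0 ?cmod_ge0 //.
  by rewrite (le_trans (cmodB _ _)) // lerD ?bq // qp.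
move=> z hz.
have -> : f z - f p - dv f p * (z - p) = q2 z * (z - p) ^+ 2.
  by rewrite (quoE f p z) -/q (quoE q p z) -/q2 qp; ring.
rewrite cmodM (cmodX (z - p)); apply: ler_wpM2r; first by rewrite exprn_ge0 ?cmod_ge0.
have := sup_est r0 dq2 bq2 hz; congr (_ <= _); ring.
Qed.

Lemma le_scaled_sum3 (y r T u v w : R) : 0 < y -> u <= w -> v <= w -> w <= T * y ->
  y * r + (u + v) <= (2 * T + r + 1) * y.
Proof. by move=> *; lra. Qed.

(** The quotients [q h] tend to the [s]-derivative [a] at rate [T * cmod h], uniformly in [t]. The
    Cauchy estimate in [t] carries this rate over to their derivatives [A h] at [0], which are also
    the difference quotients of [b]. Their limit [L] is then the derivative at [0] of both [a] and
    [b]. *)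
Lemma mixed_partials : exists2 K : R, 1 <= K & forall (psi : C -> C -> C) (r S : R), 0 < r ->
  (forall s t, cmod s <= r -> cmod t <= r -> differentiable (psi^~ t) s /\ differentiable (psi s) t) ->
  (forall s t, cmod s <= r -> cmod t <= r -> cmod (psi s t) <= S) ->
  exists L, [/\ cder (0 : C) (fun t => dv (psi^~ t) 0) L,
    cder (0 : C) (fun s => dv (psi s) 0) L & cmod L <= K * S / r ^+ 2].
Proof.
have [K K1 HK] := taylor_const; exists (2 * K ^+ 2).
  by rewrite expr2; nra.
move=> psi r S r0 dpsi bpsi.
have K0 : 0 <= K by lra.
have S0 : 0 <= S.
  by apply: le_trans (cmod_ge0 (psi 0 0)) (bpsi 0 0 _ _); rewrite cmod0 ltW.
have d0E x : disc 0 r x -> cmod x <= r by rewrite /disc subr0.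
pose a t := dv (psi^~ t) 0; pose b s := dv (psi s) 0.
pose q h t := (psi h t - psi 0 t) / h.
pose A h := (b h - b 0) / h.
pose T := K * S / r ^+ 2.
have T0 : 0 <= T by rewrite /T divr_ge0 ?mulr_ge0 ?exprn_ge0 // ltW.
have c0 : cmod (0 : C) <= r by rewrite cmod0 ltW.
have sl t : cmod t <= r -> cmod (a t) <= K * S / r /\
    forall h, cmod h < r / 4 -> cmod (psi h t - psi 0 t - a t * h) <= T * cmod h ^+ 2.
  move=> tr; have [|s sr|h1 h2] := HK (psi^~ t) 0 r S r0.
  - by move=> s /d0E sr; exact: (proj1 (dpsi s t sr tr)).
  - by apply: bpsi => //; exact: d0E.
  by split=> // h; have := h2 h; rewrite subr0.
have qa h t : h != 0 -> cmod h < r / 4 -> cmod t <= r -> cmod (q h t - a t) <= T * cmod h.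
  move=> h0 hr tr; have [_ /(_ h hr) H] := sl t tr.
  have -> : q h t - a t = (psi h t - psi 0 t - a t * h) / h by rewrite /q; field.
  rewrite cmodM cmodV ler_pdivrMr ?cmod_gt0 //.
  by rewrite -mulrA -expr2.
have dq h t : h != 0 -> cmod h < r / 4 -> cmod t <= r -> cder t (q h) ((dv (psi h) t - dv (psi 0) t) / h).
  move=> h0 hr tr; have hr' : cmod h <= r by lra.
  have [_ /dvP d1] := dpsi h t hr' tr; have [_ /dvP d2] := dpsi 0 t c0 tr.
  have E := der_mul (der_sub d1 d2) (der_cst h^-1 t).
  by apply: der_eq E _; rewrite mulr0 addr0.
have bq h t : h != 0 -> cmod h < r / 4 -> cmod t <= r -> cmod (q h t) <= 2 * K * S / r.
  move=> h0 hr tr; have H := qa h t h0 hr tr; have [Ha _] := sl t tr.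
  have -> : q h t = (q h t - a t) + a t by rewrite subrK.
  rewrite (le_trans (cmodD _ _)) //.
  have -> : 2 * K * S / r = T * r + K * S / r by rewrite /T; field; rewrite gt_eqF.
  rewrite lerD // (le_trans H) // ler_wpM2l //; lra.
have dvq h : h != 0 -> cmod h < r / 4 -> dv (q h) 0 = A h.
  by move=> h0 hr; rewrite (dv_eq (dq h 0 h0 hr c0)).
have AA h h' : h != 0 -> cmod h < r / 4 -> h' != 0 -> cmod h' < r / 4 ->
    cmod (A h - A h') <= K * (T * (cmod h + cmod h')) / r.
  move=> h0 hr h'0 h'r.
  have dd t : cmod t <= r -> cder t (fun t => q h t - q h' t)
      ((dv (psi h) t - dv (psi 0) t) / h - (dv (psi h') t - dv (psi 0) t) / h').
    by move=> tr; exact: der_sub (dq h t h0 hr tr) (dq h' t h'0 h'r tr).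
  have -> : A h - A h' = dv (fun t => q h t - q h' t) 0 by rewrite (dv_eq (dd 0 c0)).
  have [||//] := HK (fun t => q h t - q h' t) 0 r (T * (cmod h + cmod h')) r0.
  - by move=> t /d0E tr; exact: der_diff (dd t tr).
  - move=> t /d0E tr; have -> : q h t - q h' t = (q h t - a t) - (q h' t - a t) by ring.
    by rewrite (le_trans (cmodB _ _)) // mulrDr lerD // qa.
pose D := K * T / r.
have D0 : 0 <= D by apply: divr_ge0; [exact: mulr_ge0 | exact: ltW].
have AA' h h' : h != 0 -> cmod h < r / 4 -> h' != 0 -> cmod h' < r / 4 ->
    cmod (A h - A h') <= D * (cmod h + cmod h').
  by move=> *; rewrite (le_trans (AA _ _ _ _ _ _)) // /D le_eqVlt; apply/orP; left; apply/eqP; ring.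
(* A dyadic sequence of increments; along it the [A h] form a geometric Cauchy sequence. *)
pose e n : R := r / 8 * 2^-1 ^+ n.
have e0 n : 0 < e n by rewrite mulr_gt0 ?divr_gt0 // exprn_gt0 // invr_gt0.
have eS n : e n.+1 = e n / 2 by rewrite /e exprS; ring.
have er n : e n <= r / 8.
  by elim: n => [|n IH]; [rewrite /e expr0 mulr1 | rewrite eS; have := e0 n; lra].
have ee n : cmod (rc (e n)) = e n by rewrite cmod_rc gtr0_norm.
have en0 n : rc (e n) != 0 by rewrite -cmod_gt0 ee.
have er4 n : cmod (rc (e n)) < r / 4 by rewrite ee; have := er n; lra.
have [L HL] : exists L, slim (fun n => A (rc (e n))) L.
  have half : (2^-1 : R) < 1 by lra.
  apply: (@geom_cauchy _ (fun n => A (rc (e n))) (D * (r / 8) * 2) (2^-1)) => //.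
  - by apply: mulr_ge0 => //; apply: mulr_ge0 => //; rewrite divr_ge0 // ltW.
  - move=> n; have := AA' _ _ (en0 n.+1) (er4 n.+1) (en0 n) (er4 n).
    rewrite !ee eS => H; apply: le_trans H _.
    have -> : D * (r / 8) * 2 * 2^-1 ^+ n = D * (2 * e n) by rewrite /e; ring.
    by apply: ler_wpM2l => //; have := e0 n; lra.
have small (x : R) : 0 < x -> exists n, e n < x /\ cmod (A (rc (e n)) - L) <= x.
  move=> x0; have [N HN] := HL x x0.
  have hh : `|2^-1 : R| < 1 by rewrite ger0_norm ?invr_ge0 //; lra.
  have xr : 0 < x / r by rewrite divr_gt0.
  have /cvgrPdist_lt/(_ _ xr)[N' _ HN'] := cvg_expr hh.
  exists (maxn N N'); split; last by apply: HN; exact: leq_maxl.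
  have := HN' (maxn N N') (leq_maxr _ _); rewrite /= sub0r normrN ger0_norm ?exprn_ge0 ?invr_ge0 //.
  rewrite ltr_pdivlMr // /e => h.
  have : 0 <= 2^-1 ^+ maxn N N' :> R by rewrite exprn_ge0 ?invr_ge0.
  by move: (2^-1 ^+ _) h => y *; nra.
have AL h : h != 0 -> cmod h < r / 4 -> cmod (A h - L) <= D * cmod h.
  move=> h0 hr; apply/ler_addgt0Pr => x x0.
  have y0 : 0 < x / (D + 1) by rewrite divr_gt0 //; lra.
  have [n [n1 n2]] := small _ y0.
  have -> : A h - L = (A h - A (rc (e n))) + (A (rc (e n)) - L) by ring.
  rewrite (le_trans (cmodD _ _)) //.
  have := AA' _ _ h0 hr (en0 n) (er4 n); rewrite ee => k1.
  apply: le_trans (lerD k1 n2) _.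
  have k2 : x = D * (x / (D + 1)) + x / (D + 1) by field; apply/eqP; lra.
  rewrite {2}k2 mulrDr -addrA lerD2l lerD2r; apply: ler_wpM2l => //; exact: ltW.
pose M := K * (2 * K * S / r) / r ^+ 2.
have M0 : 0 <= M.
  by rewrite /M !mulr_ge0 ?invr_ge0 ?exprn_ge0 // ltW.
have qT h : h != 0 -> cmod h < r / 4 -> cmod (A h) <= K * (2 * K * S / r) / r /\
    forall t, cmod t < r / 4 -> cmod (q h t - q h 0 - A h * t) <= M * cmod t ^+ 2.
  move=> h0 hr; have [t /d0E tr|t /d0E tr|h1 h2] := HK (q h) 0 r (2 * K * S / r) r0.
  - exact: der_diff (dq h t h0 hr tr).
  - exact: bq.
  by rewrite dvq // in h1 h2; split=> // t; have := h2 t; rewrite subr0.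
exists L; split.
- have r40 : 0 < r / 4 by rewrite divr_gt0.
  apply: (@quad_der _ _ _ _ M r40) => t; rewrite subr0 => tr.
  have tr' : cmod t <= r by lra.
  apply/ler_addgt0Pr => x x0.
  have Z0 : 0 < 2 * T + r + 1 by lra.
  have y0 : 0 < x / (2 * T + r + 1) by rewrite divr_gt0.
  have [n [n1 n2]] := small _ y0.
  have [_ /(_ t tr) k1] := qT _ (en0 n) (er4 n).
  have k2 := qa _ t (en0 n) (er4 n) tr'; have k3 := qa _ 0 (en0 n) (er4 n) c0.
  rewrite ee in k2 k3.
  set h := rc (e n) in k1 k2 k3 n2.
  have alg (x1 x2 x3 x4 x5 : C) : x4 - x5 - L * t = (x1 - x2 - x3 * t) +
    ((x3 - L) * t + ((x2 - x5) - (x1 - x4))) by ring.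
  rewrite (alg (q h t) (q h 0) (A h)).
  rewrite (le_trans (cmodD _ _)) // lerD // (le_trans (cmodD _ _)) // cmodM.
  have k4 : cmod (A h - L) * cmod t <= x / (2 * T + r + 1) * r.
    by apply: ler_pM; rewrite ?cmod_ge0.
  have k5 : T * e n <= T * (x / (2 * T + r + 1)) by apply: ler_wpM2l => //; exact: ltW.
  apply: le_trans (lerD k4 (cmodB _ _)) _.
  have k6 : x = (2 * T + r + 1) * (x / (2 * T + r + 1)) by rewrite mulrC divfK // gt_eqF.
  rewrite [X in _ <= X]k6.
  exact: le_scaled_sum3 y0 k3 k2 k5.
- have r40 : 0 < r / 4 by rewrite divr_gt0.
  apply: (@quad_der _ _ _ _ D r40) => h; rewrite subr0 => hr.
  have [->|h0] := eqVneq h 0; first by rewrite subrr mulr0 subr0 !cmod0 expr0n mulr0.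
  have -> : b h - b 0 - L * h = (A h - L) * h.
    by rewrite /A mulrBl divfK.
  by rewrite cmodM expr2 mulrA; apply: ler_wpM2r; [exact: cmod_ge0 | exact: AL].
apply/ler_addgt0Pr => x x0; have [n [_ n2]] := small x x0.
have [k1 _] := qT _ (en0 n) (er4 n).
have -> : L = A (rc (e n)) - (A (rc (e n)) - L) by ring.
rewrite (le_trans (cmodB _ _)) // lerD // (le_trans k1) //.
by rewrite le_eqVlt; apply/orP; left; apply/eqP; field; rewrite gt_eqF.
Qed.
End Mixed.

(** * Directional and second derivatives in several variables *)

Section Vectors.
Variables (R : realType) (n : nat).
Local Notation C := (Cplx R).
Local Notation V := 'rV[Cplx R]_n.
Implicit Types (u : V -> C) (z v w : V) (t : C).

Definition vnorm v : R := cre `|v|.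
Lemma vnormE v : `|v| = rc (vnorm v).
Proof.
have h : 0 <= (`|v| : C) by exact: normr_ge0.
rewrite /vnorm /rc; move: h; case: (`|v| : C) => a b.
by rewrite lecE /= => /andP[/eqP -> _].
Qed.
Lemma vnormD v w : vnorm (v + w) <= vnorm v + vnorm w.
Proof. by rewrite -rc_le rcD -!vnormE ler_normD. Qed.
Lemma vnormZ t v : vnorm (t *: v) = cmod t * vnorm v.
Proof. by apply: rc_inj; rewrite rcM -!vnormE -cmodE normrZ. Qed.
Lemma vnormN v : vnorm (- v) = vnorm v.
Proof. by apply: rc_inj; rewrite -!vnormE normrN. Qed.
Lemma vnorm_ge0 v : 0 <= vnorm v.
Proof. by rewrite -rc_le -vnormE normr_ge0. Qed.

Lemma nearVP z (P : V -> Prop) : (\forall w \near z, P w) <->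
  exists2 d : R, 0 < d & forall w, vnorm (w - z) < d -> P w.
Proof.
split.
  move=> /nbhs_normP [e /= /rc_gt0[d d0 ->] H]; exists d => // w wd.
  by apply: H; rewrite /= vnormE rc_lt -vnormN opprB.
move=> [d d0 H]; apply/nbhs_normP; exists (rc d); first by rewrite /= -rc0 rc_lt.
by move=> w /=; rewrite vnormE rc_lt -vnormN opprB; exact: H.
Qed.

Lemma contVP u z : {for z, continuous u} -> forall e : R, 0 < e -> exists2 d : R, 0 < d &
  forall w, vnorm (w - z) < d -> cmod (u w - u z) < e.
Proof.
move=> h e e0; apply/nearVP.
by have /(@cvgCP R V (nbhs z) (nbhs_filter z) u (u z))/(_ e e0) := h.
Qed.

Lemma line_der u z v t : differentiable u (z + t *: v) ->
  cder t (fun s => u (z + s *: v)) ('D_v u (z + t *: v)).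
Proof.
move=> /(diff_derivable (v := v)) h.
have E : (fun h => h^-1 *: (u (h *: v + (z + t *: v)) - u (z + t *: v))) =
   (fun h => h^-1 *: (u (z + (h *: (1 : C) + t) *: v) - u (z + t *: v))).
  apply/funext => s; congr (_ *: (u _ - _)).
  by rewrite scalerDl /GRing.scale /= mulr1 addrCA.
apply: DeriveDef; first by move: h; rewrite /derivable E.
by rewrite /derive E.
Qed.

Lemma derive_partial u z v : differentiable u z -> 'D_v u z = \sum_j v 0 j * partial u j z.
Proof.
move=> h; rewrite deriveE // {1}(row_sum_delta v) raddf_sum; apply: eq_bigr => j _.
by rewrite [LHS](linearZ_LR) /partial deriveE.
Qed.

Lemma vnorm_line2 z0 z v w s t (d r N : R) : vnorm (z - z0) < d -> vnorm v <= N -> vnorm w <= N ->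
  cmod s <= r -> cmod t <= r -> vnorm (z + s *: v + t *: w - z0) < d + 2 * (r * N).
Proof.
move=> h1 h2 h3 h4 h5.
have -> : z + s *: v + t *: w - z0 = (z - z0) + (s *: v + t *: w) by rewrite -(addrA z) addrAC.
apply: le_lt_trans (vnormD _ _) _; rewrite ltr_leD //.
apply: le_trans (vnormD _ _) _; rewrite !vnormZ.
have k1 : cmod s * vnorm v <= r * N by apply: ler_pM; rewrite ?cmod_ge0 ?vnorm_ge0.
have k2 : cmod t * vnorm w <= r * N by apply: ler_pM; rewrite ?cmod_ge0 ?vnorm_ge0.
lra.
Qed.

Lemma holV_near u z0 : holomorphic_at u z0 -> exists2 d : R, 0 < d &
  forall z, vnorm (z - z0) < d -> differentiable u z.
Proof. by move=> /nearVP. Qed.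

Lemma second_derivatives u z0 (N : R) : 0 <= N -> holomorphic_at u z0 ->
  exists rho B : R, 0 < rho /\ forall z v w,
    vnorm (z - z0) < rho -> vnorm v <= N -> vnorm w <= N ->
    exists L, [/\ cder (0 : C) (fun t => 'D_v u (z + t *: w)) L,
      cder (0 : C) (fun s => 'D_w u (z + s *: v)) L & cmod L <= B].
Proof.
move=> N0 /holV_near [d1 d10 D1].
have z00 : vnorm (z0 - z0) < d1 by rewrite subrr -[0](scale0r z0) vnormZ cmod0 mul0r.
have [d2 d20 D2] := contVP (differentiable_continuous (D1 _ z00)) ltr01.
pose d := Num.min d1 d2.
have d0 : 0 < d by rewrite lt_min d10.
have Dd z : vnorm (z - z0) < d -> differentiable u z by rewrite lt_min => /andP[/D1].
have Db z : vnorm (z - z0) < d -> cmod (u z) <= cmod (u z0) + 1.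
  rewrite lt_min => /andP[_ /D2 h]; have := cmod_revtri (u z) (u z0); lra.
have [K K1 HK] := mixed_partials R.
(* Two displacements of size at most [r * N <= d / 4], from a point within [d / 2] of [z0], stay
   within [d]. *)
pose r := d / 4 / (N + 1).
have r0 : 0 < r by rewrite /r !divr_gt0 //; lra.
have rN : r * N <= d / 4.
  have -> : r * N = d / 4 * (N / (N + 1)) by rewrite /r; field; apply/eqP; lra.
  have : N / (N + 1) <= 1 by rewrite ler_pdivrMr; lra.
  by move=> h; rewrite -[X in _ <= X]mulr1 ler_pM2l // divr_gt0.
exists (d / 2), (K * (cmod (u z0) + 1) / r ^+ 2); split; first by rewrite divr_gt0.
move=> z v w hz hv hw.
pose psi s t := u (z + s *: v + t *: w).
have inb s t : cmod s <= r -> cmod t <= r -> vnorm (z + s *: v + t *: w - z0) < d.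
  by move=> hs ht; have := vnorm_line2 hz hv hw hs ht; lra.
have comm s t : z + s *: v + t *: w = z + t *: w + s *: v by rewrite addrAC.
have c0 : cmod (0 : C) <= r by rewrite cmod0 ltW.
have ds s t : cmod s <= r -> cmod t <= r ->
    cder s (psi^~ t) ('D_v u (z + s *: v + t *: w)).
  move=> hs ht; have h : differentiable u (z + t *: w + s *: v) by rewrite -comm; apply/Dd/inb.
  have := line_der h; rewrite -comm; congr (is_derive _ _ _ _).
  by apply/funext => x; rewrite /psi comm.
have dt s t : cmod s <= r -> cmod t <= r ->
    cder t (psi s) ('D_w u (z + s *: v + t *: w)).
  by move=> hs ht; apply: line_der; apply/Dd/inb.
have [||L [h1 h2 h3]] := HK psi r (cmod (u z0) + 1) r0.
- by move=> s t hs ht; split; [exact: der_diff (ds s t hs ht) | exact: der_diff (dt s t hs ht)].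
- by move=> s t hs ht; apply/Db/inb.
have nr (x : C) : cmod (x - 0) < r -> cmod x <= r by rewrite subr0 => /ltW.
exists L; split; last exact: h3.
- have E : \forall t \near (0 : C), dv (psi^~ t) 0 = 'D_v u (z + t *: w).
    apply/nearCP; exists r; first exact: r0.
    move=> t /nr ht; have e := dv_eq (ds 0 t c0 ht).
    by rewrite scale0r addr0 in e.
  exact: der_near E h1.
- have E : \forall s \near (0 : C), dv (psi s) 0 = 'D_w u (z + s *: v).
    apply/nearCP; exists r; first exact: r0.
    move=> s /nr hs; have e := dv_eq (dt s 0 hs c0).
    by rewrite scale0r addr0 in e.
  exact: der_near E h2.
Qed.
End Vectors.

(** * Evaluation, derivatives and homogeneity of polynomials *)

Section Mpoly.
Variables (R : realType) (n : nat).
Local Notation C := (Cplx R).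
Local Notation mp := (mpoly.mpoly n (Cplx R)).
Implicit Types (p q : mp) (x y : 'I_n -> C).
Local Notation ev x p := (mpoly.meval x p).
Local Notation pd i p := (mpoly.mderiv i p).

Lemma mpoly_alg_ind (Q : mp -> Prop) : (forall c, Q (mpoly.mpolyC n c)) ->
  (forall i, Q (mpoly.mpolyX C (mpoly.mnm1 i))) ->
  (forall p q, Q p -> Q q -> Q (p + q)) -> (forall p q, Q p -> Q q -> Q (p * q)) ->
  forall p, Q p.
Proof.
move=> QC QX QD QM; elim/mpoly.mpolyind => [|c m p _ _ Qp].
  by have := QC 0; rewrite mpoly.mpolyC0.
apply: (QD) => //; rewrite -mpoly.mul_mpolyC; apply: (QM); first exact: QC.
rewrite mpoly.mpolyXE_id; elim/big_ind: _; [by have := QC 1; rewrite mpoly.mpolyC1 | exact: QM |].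
move=> i _; move: (m i); elim=> [|k IH].
  by rewrite expr0; have := QC 1; rewrite mpoly.mpolyC1.
by rewrite exprS; apply: QM.
Qed.

Lemma ev_pdX x i j : ev x (pd i (mpoly.mpolyX C (mpoly.mnm1 j))) = (j == i)%:R.
Proof.
rewrite mpoly.mderivX mpoly.mevalZ mpoly.mnm1E; case: eqP => [->|_]; last by rewrite mul0r.
have -> : mpoly.mnm_sub (mpoly.mnm1 i) (mpoly.mnm1 i) = mpoly.mnm0.
  by apply/mpoly.mnmP => k; rewrite mpoly.mnmBE mpoly.mnm0E subnn.
by rewrite mpoly.mpolyX0 mpoly.meval1 mulr1.
Qed.

Lemma ev_der (X : 'I_n -> C -> C) (X' : 'I_n -> C) t p :
  (forall i, cder t (X i) (X' i)) ->
  cder t (fun s => ev (fun i => X i s) p)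
    (\sum_i ev (fun i => X i t) (pd i p) * X' i).
Proof.
move=> dX; elim/mpoly_alg_ind: p => [c|j|p q Hp Hq|p q Hp Hq].
- under eq_fun do rewrite mpoly.mevalC.
  apply: der_eq (der_cst c t) _; rewrite big1 // => i _.
  by rewrite mpoly.mderivC mpoly.meval0 mul0r.
- have -> : (fun s => ev (fun i => X i s) (mpoly.mpolyX C (mpoly.mnm1 j))) = X j.
    by apply/funext => s; rewrite mpoly.mevalXU.
  apply: der_eq (dX j) _; rewrite (bigD1 j) //= ev_pdX eqxx mul1r big1 ?addr0 //.
  by move=> i /negPf ij; rewrite ev_pdX eq_sym ij mul0r.
- under eq_fun do rewrite mpoly.mevalD.
  apply: der_eq (der_add Hp Hq) _; rewrite -big_split /=; apply: eq_bigr => i _.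
  by rewrite mpoly.mderivD mpoly.mevalD mulrDl.
- under eq_fun do rewrite mpoly.mevalM.
  apply: der_eq (der_mul Hp Hq) _; rewrite mulr_suml mulr_sumr -big_split /=.
  by apply: eq_bigr => i _; rewrite mpoly.mderivM mpoly.mevalD !mpoly.mevalM mulrDl mulrAC mulrA.
Qed.

Lemma ev_lip p (M : R) : 0 <= M -> exists2 K : R, 0 <= K & forall x y (d : R),
  (forall i, cmod (x i) <= M) -> (forall i, cmod (y i) <= M) -> 0 <= d ->
  (forall i, cmod (x i - y i) <= d) -> cmod (ev x p - ev y p) <= K * d.
Proof.
move=> M0; elim/mpoly_alg_ind: p => [c|j|p q [K K0 HK] [L L0 HL]|p q [K K0 HK] [L L0 HL]].
- by exists 0 => // x y d _ _ _ _; rewrite !mpoly.mevalC subrr cmod0 mul0r.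
- by exists 1 => // x y d _ _ _ h; rewrite !mpoly.mevalXU mul1r.
- exists (K + L); first exact: addr_ge0.
  move=> x y d hx hy d0 h; rewrite !mpoly.mevalD.
  by rewrite opprD addrACA (le_trans (cmodD _ _)) // mulrDl lerD // ?HK ?HL.
(* Products also need a bound on the factors; it follows from their Lipschitz constants by
   comparison with the value at [0]. *)
have bd r (A : R) : (forall x y (d : R), (forall i, cmod (x i) <= M) ->
    (forall i, cmod (y i) <= M) -> 0 <= d ->
    (forall i, cmod (x i - y i) <= d) -> cmod (ev x r - ev y r) <= A * d) ->
    forall x, (forall i, cmod (x i) <= M) -> cmod (ev x r) <= cmod (ev (fun=> 0) r) + A * M.
  move=> H x hx; have h0 : forall i : 'I_n, cmod ((fun=> 0) i : C) <= M by move=> i; rewrite cmod0.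
  have := H x (fun=> 0) M hx h0 M0; have := cmod_revtri (ev x r) (ev (fun=> 0) r).
  move=> h1 h2; have {}h2 : cmod (ev x r - ev (fun=> 0) r) <= A * M.
    by apply: h2 => i; rewrite subr0.
  by rewrite -lerBlDl; apply: le_trans h1 h2.
set P0 := cmod (ev (fun=> 0) p) + K * M; set Q0 := cmod (ev (fun=> 0) q) + L * M.
have P00 : 0 <= P0 by rewrite addr_ge0 ?cmod_ge0 ?mulr_ge0.
have Q00 : 0 <= Q0 by rewrite addr_ge0 ?cmod_ge0 ?mulr_ge0.
exists (K * Q0 + P0 * L); first by rewrite addr_ge0 ?mulr_ge0.
move=> x y d hx hy d0 h; rewrite !mpoly.mevalM.
have -> : ev x p * ev x q - ev y p * ev y q = (ev x p - ev y p) * ev x q + ev y p * (ev x q - ev y q).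
  by rewrite mulrBl mulrBr addrA subrK.
rewrite (le_trans (cmodD _ _)) // !cmodM.
have -> : (K * Q0 + P0 * L) * d = K * d * Q0 + P0 * (L * d) by ring.
by apply: lerD; apply: ler_pM; rewrite ?cmod_ge0 // ?HK ?HL //; [exact: (bd q L) | exact: (bd p K)].
Qed.

Variables (p : mp) (l : nat).
Hypothesis hp : p \is mpoly.ishomog1 l mpoly.mdeg.

Lemma ev_homog x (c : C) : ev (fun i => c * x i) p = c ^+ l * ev x p.
Proof.
rewrite !mpoly.mevalE mulr_sumr; apply: eq_big_seq => m mp.
have hm : mpoly.mdeg m = l := mpoly.dhomog_mf hp mp.
rewrite mulrCA; congr (_ * _); rewrite -hm mpoly.mdegE -prodrXr -big_split /=.
by apply: eq_bigr => i _; rewrite exprMn.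
Qed.

(** Differentiate [c ^+ l * ev x p = ev (c x) p] in [c] at [1]. *)
Lemma ev_euler x : \sum_i ev x (pd i p) * x i = l%:R * ev x p.
Proof.
have h : forall i : 'I_n, cder (1 : C) (fun c => c * x i) (x i).
  by move=> i; apply: der_eq (der_mul (der_id 1) (der_cst (x i) 1)) _; ring.
have h1 := ev_der p h.
have h2 : cder (1 : C) (fun c => c ^+ l * ev x p) (l%:R * ev x p).
  apply: der_eq (der_mul (der_exp l (der_id 1)) (der_cst (ev x p) 1)) _.
  by rewrite !expr1n; ring.
rewrite (_ : (fun c => c ^+ l * ev x p) = (fun c => ev (fun i => c * x i) p)) in h2; last first.
  by apply/funext => c; rewrite ev_homog.
rewrite -(der_unique h1 h2); apply: eq_bigr => i _; congr (_ * _).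
by apply: mpoly.meval_eq => j; rewrite mul1r.
Qed.

(** Differentiate the homogeneity relation along the [i]-th coordinate and cancel one factor [c]. *)
Lemma ev_pd_homog x (c : C) i : (0 < l)%N -> c != 0 ->
  ev (fun i => c * x i) (pd i p) = c ^+ l.-1 * ev x (pd i p).
Proof.
move=> l0 c0.
have h (j : 'I_n) : cder (0 : C) (fun s => x j + s * (j == i)%:R) (j == i)%:R.
  by apply: der_eq (der_add (der_cst _ 0) (der_mul (der_id 0) (der_cst _ 0))) _; ring.
have hc (j : 'I_n) : cder (0 : C) (fun s => c * (x j + s * (j == i)%:R)) (c * (j == i)%:R).
  by apply: der_eq (der_mul (der_cst c 0) (h j)) _; ring.
have h1 := ev_der p hc; have h2 := der_mul (der_cst (c ^+ l) 0) (ev_der p h).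
rewrite (_ : (fun s => c ^+ l * ev (fun j => x j + s * (j == i)%:R) p) =
  (fun s => ev (fun j => c * (x j + s * (j == i)%:R)) p)) in h2; last first.
  by apply/funext => s; rewrite ev_homog.
have := der_unique h1 h2; rewrite mul0r add0r.
have one (F : 'I_n -> C) : \sum_j F j * (j == i)%:R = F i.
  rewrite (bigD1 i) //= eqxx mulr1 big1 ?addr0 // => j /negPf ->; exact: mulr0.
rewrite one; have -> : \sum_j ev (fun k => c * (x k + 0 * (k == i)%:R)) (pd j p) * (c * (j == i)%:R) =
    c * \sum_j ev (fun k => c * x k) (pd j p) * (j == i)%:R.
  rewrite mulr_sumr; apply: eq_bigr => j _; rewrite mulrCA; congr (_ * (_ * _)).
  by apply: mpoly.meval_eq => k; rewrite mul0r addr0.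
have e : c ^+ l = c * c ^+ l.-1 by rewrite -exprS prednK.
rewrite one e -mulrA => /(mulfI c0) ->; congr (_ * _).
by apply: mpoly.meval_eq => k; rewrite mul0r addr0.
Qed.
End Mpoly.

(** * A linear differential inequality for holomorphic germs *)

Section Gronwall.
Variables (R : realType) (n : nat).
Local Notation C := (Cplx R).

Lemma near_all_ord (Q : 'I_n -> C -> Prop) (p : C) :
  (forall j, \forall t \near p, Q j t) -> \forall t \near p, forall j, Q j t.
Proof. by move=> H; apply: (@filter_forall _ _ Q (nbhs p)). Qed.

Lemma near_and (p : C) (P Q : C -> Prop) : (\forall t \near p, P t) ->
  (\forall t \near p, Q t) -> \forall t \near p, P t /\ Q t.
Proof. exact: filterI. Qed.

Lemma pnear_punctured (p : C) (Q : C -> Prop) : (forall z, z != p -> Q z) -> pnear p Q.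
Proof. by move=> h; exists 1 => // z zp _; exact: h. Qed.

Lemma hol_bounded (f : C -> C) p : hol f p -> \forall t \near p, cmod (f t) <= cmod (f p) + 1.
Proof.
move=> /hol_diff/differentiable_continuous/ccontP/(_ _ ltr01)[d d0 D].
apply/nearCP; exists d => // z /D h; have := cmod_revtri (f z) (f p); lra.
Qed.

(* If the [xi j] have a common factor [t ^ m], comparing the lowest order terms
   in the differential inequality shows that they are divisible by [t ^ m.+1]. *)
Lemma gronwall_hol (xi : 'I_n -> C -> C) (La : R) : (forall j, hol (xi j) 0) ->
  (forall j, xi j 0 = 0) ->
  (\forall t \near (0 : C), forall j, cmod (dv (xi j) t) <= La * \sum_i cmod (xi i t)) ->
  forall j, \forall t \near (0 : C), xi j t = 0.
Proof.
move=> hx x0 H.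
have fact m : exists y : 'I_n -> C -> C, forall j, hol (y j) 0 /\ forall t, xi j t = t ^+ m * y j t.
  elim: m => [|m [y Hy]].
    by exists xi => j; split=> // t; rewrite expr0 mul1r.
  suff y0 j : y j 0 = 0.
    exists (fun j => quo (y j) 0) => j; have [hy E] := Hy j; split.
      by case: (hy) => d d0 D; exists d => // z /D dz; apply: quo_diff.
    by move=> t; rewrite E (quoE (y j) 0 t) y0 add0r subr0 exprSr mulrA.
  case: m Hy => [|m] Hy; first by have [_ E] := Hy j; have := E 0; rewrite x0 expr0 mul1r.
  apply/eqP/negPn/negP => yj0; have [hy E] := Hy j.
  (* [dv (xi j) t = t ^+ m * g t] with [g 0 != 0], while the right-hand side is of order
     [t ^+ m.+1]; for [cmod t] below the chosen radius this gives a contradiction. *)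
  pose g t := m.+1%:R * y j t + t * dv (y j) t.
  have hg : hol g 0.
    by apply: hol_add; [exact: hol_mulcst | apply: hol_mul; [exact: hol_id | exact: hol_dv]].
  have g0 : g 0 != 0 by rewrite /g mul0r addr0 mulf_neq0 // pnatr_eq0.
  have [d1 d10 D1] := hol_lower hg g0.
  have /near_pnear L1 : \forall t \near (0 : C), cmod (g 0) / 2 <= cmod (g t).
    by apply/nearCP; exists d1 => // z; exact: D1.
  have /near_pnear L2 : \forall t \near (0 : C), forall i, cmod (y i t) <= cmod (y i 0) + 1.
    by apply: near_all_ord => i; apply: hol_bounded; have [] := Hy i.
  have L3 := hol_pnear_diff hy.
  pose Y : R := \sum_i (cmod (y i 0) + 1).
  have Y0 : 0 <= Y by apply: sumr_ge0 => i _; rewrite addr_ge0 ?cmod_ge0.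
  have c0 : 0 < cmod (g 0) / 2 by rewrite divr_gt0 // cmod_gt0.
  have e0 : 0 < cmod (g 0) / 2 / (`|La| * Y + 1).
    by rewrite divr_gt0 // ltr_pwDr // mulr_ge0.
  have [t [t0 te [h1 [h2 [h3 h4]]]]] :=
    pnear_ex (pnear_and L1 (pnear_and L2 (pnear_and L3 (near_pnear H)))) e0.
  rewrite subr0 in te.
  have dE : dv (xi j) t = t ^+ m * g t.
    have D := der_zero 0 m h3; rewrite subr0 in D; apply: dv_eq.
    apply: der_near D; apply: filterE => w; rewrite subr0 E //.
  have := h4 j; rewrite dE cmodM cmodX.
  have -> : \sum_i cmod (xi i t) = cmod t ^+ m.+1 * \sum_i cmod (y i t).
    rewrite mulr_sumr; apply: eq_bigr => i _; have [_ ->] := Hy i.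
    by rewrite cmodM cmodX.
  have tm : 0 < cmod t ^+ m by rewrite exprn_gt0 // cmod_gt0.
  set s := \sum_i cmod (y i t); rewrite exprS => h5.
  have {}h5 : cmod (g t) <= cmod t * (La * s).
    rewrite -(ler_pM2l tm); apply: le_trans h5 _.
    by rewrite le_eqVlt; apply/orP; left; apply/eqP; ring.
  have Yt : s <= Y by apply: ler_sum => i _; exact: h2.
  have s0 : 0 <= s by apply: sumr_ge0 => i _; exact: cmod_ge0.
  move: te; rewrite ltr_pdivlMr; last by rewrite ltr_pwDr // mulr_ge0.
  apply/negP; rewrite -leNgt; apply: le_trans h1 _; apply: le_trans h5 _.
  apply: ler_wpM2l; first exact: cmod_ge0.
  apply: le_trans (ler_wpM2r s0 (ler_norm La)) _.
  by apply: le_trans (ler_wpM2l (normr_ge0 La) Yt) _; rewrite lerDl.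
(* A germ divisible by every power of [t] cannot have a finite order [m]. *)
move=> j; have [//|[m [q [hq q0 E]]]] := zero_order (hx j).
have [y Hy] := fact m.+1; have [hy Ey] := Hy j.
move/eqP: q0; case.
have hty : hol (fun t => t * y j t) 0 by apply: hol_mul => //; exact: hol_id.
have Eq : pnear 0 (fun t => q t = t * y j t).
  apply: pnear_punctured => t t0; apply: (@mulfI _ (t ^+ m)); first by rewrite expf_neq0.
  by have := E t; rewrite subr0 Ey exprSr mulrA => ->.
by rewrite (hol_pnear_eq hq hty Eq) mul0r.
Qed.
End Gronwall.

(** * The equation and its first derivatives along a characteristic line *)

Section Characteristics.
Variables (R : realType) (n : nat).
Local Notation C := (Cplx R).
Local Notation V := 'rV[Cplx R]_n.
Local Notation ev x p := (mpoly.meval x p).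
Local Notation pd i p := (mpoly.mderiv i p).
Local Notation ee j := (delta_mx 0 j : V).

Lemma der_sum (f : 'I_n -> C -> C) (d : 'I_n -> C) t :
  (forall i, cder t (f i) (d i)) ->
  cder t (fun s => \sum_i f i s) (\sum_i d i).
Proof.
move=> h; move: (index_enum _) => s; elim: s => [|i s IH].
  by under eq_fun do rewrite big_nil; rewrite big_nil; exact: der_cst.
by under eq_fun do rewrite big_cons; rewrite big_cons; exact: der_add.
Qed.

Lemma der_shift (f : C -> C) t L : cder (0 : C) (fun h => f (t + h)) L ->
  cder t f L.
Proof.
move=> /cderP H; apply/cderP => e /H [d d0 D]; exists d => // w wd.
by have := D (w - t); rewrite !subr0 addr0 [t + _]addrC subrK; apply.
Qed.

Variables (l : nat) (H : mpoly.mpoly n C) (P : {poly C}) (u : V -> C) (z0 : V).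
Hypotheses (l0 : (0 < l)%N) (hH : H \is mpoly.ishomog1 l mpoly.mdeg).
Hypothesis hu : holomorphic_at u z0.
Hypothesis pde : \forall z \near z0, ev (fun j => partial u j z) H = P.[u z].

Let x0 (j : 'I_n) : C := partial u j z0.
Hypothesis H0 : ev x0 H != 0.

Definition char_dir : V := \row_i ev x0 (pd i H).
Let b := char_dir.
Let X (j : 'I_n) (t : C) : C := partial u j (z0 + t *: b).

Lemma char_step : exists r B : R, [/\ 0 < r, 0 <= B & forall t, cmod t < r ->
  [/\ cder t (fun t => u (z0 + t *: b)) (\sum_i b 0 i * X i t),
    ev (X^~ t) H = P.[u (z0 + t *: b)] &
  exists L : 'I_n -> 'I_n -> C, [/\ forall i j, cmod (L i j) <= B,
    forall j, cder t (X j) (\sum_i b 0 i * L i j) &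
    forall j, \sum_i ev (X^~ t) (pd i H) * L i j = (P^`()).[u (z0 + t *: b)] * X j t]]].
Proof.
pose N : R := vnorm b + \sum_j vnorm (ee j).
have s0 : 0 <= \sum_j vnorm (ee j) by apply: sumr_ge0 => j _; exact: vnorm_ge0.
have bN : vnorm b <= N by rewrite lerDl.
have eN j : vnorm (ee j) <= N.
  rewrite /N (bigD1 j) //= addrCA lerDl addr_ge0 ?vnorm_ge0 //.
  by apply: sumr_ge0 => k _; exact: vnorm_ge0.
have N0 : 0 <= N by apply: le_trans (vnorm_ge0 b) bN.
have [r1 [B [r10 HB]]] := second_derivatives N0 hu.
have [r2 r20 H2] := holV_near hu.
have [r3 r30 H3] : exists2 d : R, 0 < d & forall z, vnorm (z - z0) < d ->
    ev (fun j => partial u j z) H = P.[u z] by apply/nearVP.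
pose d := Num.min r1 (Num.min r2 r3).
have d0 : 0 < d by rewrite !lt_min r10 r20.
have vb := vnorm_ge0 b.
exists (d / (vnorm b + 1)), `|B|; split=> //; first by rewrite divr_gt0 // ltr_pwDr.
move=> t; rewrite ltr_pdivlMr ?ltr_pwDr // => ht.
set z := z0 + t *: b.
have zd : vnorm (z - z0) < d.
  rewrite /z (addrC z0) addrK vnormZ; apply: le_lt_trans ht.
  by apply: ler_wpM2l; [exact: cmod_ge0 | rewrite lerDl].
have [zr1 zr2 zr3] : [/\ vnorm (z - z0) < r1, vnorm (z - z0) < r2 & vnorm (z - z0) < r3].
  by move: zd; rewrite !lt_min => /and3P[].
have N1 : 0 < N + 1 by rewrite ltr_pwDr.
have dir v : vnorm v <= N -> forall s, cmod (s - 0) < (d - vnorm (z - z0)) / (N + 1) ->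
    vnorm (z + s *: v - z0) < d.
  move=> vN s; rewrite subr0 ltr_pdivlMr // => hs.
  rewrite addrAC; apply: le_lt_trans (vnormD _ _) _; rewrite vnormZ -ltrBrDl.
  apply: le_lt_trans hs; apply: ler_wpM2l; first exact: cmod_ge0.
  by apply: le_trans vN _; rewrite lerDl.
have e0 : 0 < (d - vnorm (z - z0)) / (N + 1) by rewrite divr_gt0 ?subr_gt0.
split.
- rewrite -derive_partial; last exact: H2.
  by apply: line_der; exact: H2.
- exact: H3.
have [L HL] : exists L : 'I_n -> 'I_n -> C, forall i j, cmod (L i j) <= B /\
    cder (0 : C) (fun s => partial u i (z + s *: (ee j))) (L i j).
  have ex (ij : 'I_n * 'I_n) : exists L : C, cmod L <= B /\
      cder (0 : C) (fun s => partial u ij.1 (z + s *: (ee ij.2))) L.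
    by have [L [h1 _ h3]] := HB z (ee ij.1) (ee ij.2) zr1 (eN _) (eN _); exists L.
  have [L HL] := choice ex; exists (fun i j => L (i, j)) => i j; exact: (HL (i, j)).
exists L; split.
- by move=> i j; have [h _] := HL i j; apply: le_trans h (ler_norm B).
(* Symmetry enters here: [M] is the derivative of the [j]-th partial along [b], and also that of the
   [b]-derivative along [e_j]. *)
- move=> j; have [M [h1 h2 _]] := HB z (ee j) b zr1 (eN j) bN.
  have h3 : cder (0 : C) (fun s => 'D_b u (z + s *: (ee j))) (\sum_i b 0 i * L i j).
    have h4 : cder (0 : C) (fun s => \sum_i b 0 i * partial u i (z + s *: (ee j)))
        (\sum_i b 0 i * L i j).
      apply: der_sum => i; have [_ h] := HL i j.
      by apply: der_eq (der_mul (der_cst (b 0 i) 0) h) _; rewrite mul0r add0r.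
    apply: der_near h4; apply/nearCP; exists ((d - vnorm (z - z0)) / (N + 1)) => // s hs.
    rewrite derive_partial //; apply: H2.
    by have := dir _ (eN j) s hs; rewrite !lt_min => /and3P[].
  have eM : M = \sum_i b 0 i * L i j by exact: der_unique h2 h3.
  have eX : (fun h => X j (t + h)) = (fun h => partial u j (z + h *: b)).
    by apply/funext => h; rewrite /X scalerDl addrA.
  have h5 : cder (0 : C) (fun h => X j (t + h)) M by rewrite eX; exact: h1.
  exact: der_eq (der_shift h5) eM.
move=> j.
have h1 := @ev_der R n (fun i s => partial u i (z + s *: ee j)) (L^~ j) 0 H
  (fun i => proj2 (HL i j)).
have zz : z + 0 *: (ee j) = z by rewrite scale0r addr0.
have h2 : cder (0 : C) (fun s => u (z + s *: (ee j))) (X j t).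
  by have := @line_der _ _ u z (ee j) 0; rewrite zz; apply; exact: H2.
have h3 : cder (0 : C) (fun s => P.[u (z + s *: (ee j))]) ((P^`()).[u z] * X j t).
  have := der_comp h2 (der_poly P (u (z + 0 *: (ee j)))); rewrite zz; exact.
have h4 : cder (0 : C) (fun s => ev (fun i => partial u i (z + s *: (ee j))) H)
    ((P^`()).[u z] * X j t).
  apply: der_near h3; apply/nearCP; exists ((d - vnorm (z - z0)) / (N + 1)) => // s hs.
  have hs3 : vnorm (z + s *: ee j - z0) < r3.
    by have := dir _ (eN j) s hs; rewrite !lt_min => /and3P[].
  exact: esym (H3 _ hs3).
have e4 := der_unique h1 h4; cbv beta in e4; rewrite zz in e4; exact: e4.
Qed.
End Characteristics.

Lemma dv_sub_scale (R : realType) (f g : Cplx R -> Cplx R) (a c t : Cplx R) :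
  differentiable f t -> differentiable g t ->
  dv (fun s => f s - g s / a * c) t = dv f t - dv g t / a * c.
Proof.
move=> /dvP df /dvP dg.
have e := der_sub df (der_mul (der_mul dg (der_cst a^-1 t)) (der_cst c t)).
by rewrite (dv_eq e) !mulr0 !addr0.
Qed.

Lemma transversal_combination (R : realType) (c1 Xj Xk Ej Ek xj xk : Cplx R) : xk != 0 ->
  c1 * Xj - Ej - (c1 * Xk - Ek) * (xj / xk) =
  c1 * (Xj - Xk / xk * xj) - (Ej - Ek * (xj / xk)).
Proof. by move=> xk0; field. Qed.

Lemma exprM_balance (R : realType) (c a e : Cplx R) l : (0 < l)%N ->
  (c * (a * e)) ^+ l = a ^+ l * e ^+ l.-1 * (c ^+ l * e).
Proof. by case: l => // l _; rewrite !exprMn /= !exprS; ring. Qed.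

(** * Constancy of the gradient direction and the resulting ODE *)

Section Parallel.
Variables (R : realType) (n : nat).
Local Notation C := (Cplx R).
Local Notation V := 'rV[Cplx R]_n.
Local Notation ev x p := (mpoly.meval x p).
Local Notation pd i p := (mpoly.mderiv i p).
Variables (l : nat) (H : mpoly.mpoly n C) (P : {poly C}) (u : V -> C) (z0 : V).
Hypotheses (l0 : (0 < l)%N) (hH : H \is mpoly.ishomog1 l mpoly.mdeg).
Hypothesis hu : holomorphic_at u z0.
Hypothesis pde : \forall z \near z0, ev (fun j => partial u j z) H = P.[u z].
Let x0 (j : 'I_n) : C := partial u j z0.
Hypothesis H0 : ev x0 H != 0.
Let b := char_dir H u z0.
Let X (j : 'I_n) (t : C) : C := partial u j (z0 + t *: b).

Lemma x0_neq0 : exists k, x0 k != 0.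
Proof.
apply: contrapT => /forallNP h; move/eqP: H0; apply.
have hx j : x0 j = 0 by apply/eqP/negPn/negP; exact: h.
have := ev_homog hH x0 0; rewrite expr0n eqn0Ngt l0 mul0r => <-.
by apply: mpoly.meval_eq => j; rewrite hx mul0r.
Qed.

Lemma X0 j : X j 0 = x0 j.
Proof. by rewrite /X scale0r addr0. Qed.

(* On the line, the component [xi] of the gradient transversal to its initial
   value satisfies a homogeneous linear differential inequality. *)
Lemma gradient_parallel k : x0 k != 0 ->
  \forall t \near (0 : C), forall j, X j t = X k t / x0 k * x0 j.
Proof.
move=> xk; have [r [B [r0 B0 St]]] := char_step hu pde.
have hX j : hol (X j) 0.
  exists r => // t; rewrite subr0 => /St [_ _ [L [_ dX _]]]; exact: der_diff (dX j).
pose la t := X k t / x0 k.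
have hla : hol la 0 by apply: hol_mul => //; exact: hol_cst.
have la0 : la 0 = 1 by rewrite /la X0 divff.
pose xi j t := X j t - la t * x0 j.
have hxi j : hol (xi j) 0.
  by apply: hol_sub => //; apply: hol_mul => //; exact: hol_cst.
have xi0 j : xi j 0 = 0 by rewrite /xi la0 mul1r X0 subrr.
have lan : la 0 != 0 by rewrite la0 oner_eq0.
have [d1 d10 D1] := hol_lower hla lan; rewrite la0 cmod1 in D1.
have N1 : \forall t \near (0 : C), 1 / 2 <= cmod (la t).
  by apply/nearCP; exists d1.
have N2 := near_all_ord (fun j => hol_bounded (hX j)).
have N3 := near_all_ord (fun j => hol_bounded (hol_mul hla (hol_cst 0 (x0 j)))).
have hU : hol (fun t => u (z0 + t *: b)) 0.
  by exists r => // t; rewrite subr0 => /St [dU _ _]; exact: der_diff dU.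
have N4 := hol_bounded (hol_poly (P^`()) hU).
set Q : R := cmod _ + 1 in N4.
pose M : R := \sum_j (cmod (X j 0) + 1) + \sum_j (cmod (la 0 * x0 j) + 1).
have ge1 (F : 'I_n -> R) j : (forall i, 0 <= F i) -> F j <= \sum_i F i.
  by move=> F0; rewrite (bigD1 j) //= lerDl sumr_ge0.
have p0 (f : 'I_n -> C) i : 0 <= cmod (f i) + 1 by rewrite addr_ge0 ?cmod_ge0.
have ps (f : 'I_n -> C) : 0 <= \sum_i (cmod (f i) + 1) by apply: sumr_ge0 => i _; exact: p0.
have M0 : 0 <= M := addr_ge0 (ps (fun j => X j 0)) (ps (fun j => la 0 * x0 j)).
have XM j : cmod (X j 0) + 1 <= M.
  apply: le_trans (ge1 (fun j => cmod (X j 0) + 1) j (p0 (fun j => X j 0))) _.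
  by rewrite lerDl; exact: (ps (fun j => la 0 * x0 j)).
have laM j : cmod (la 0 * x0 j) + 1 <= M.
  apply: le_trans (ge1 (fun j => cmod (la 0 * x0 j) + 1) j (p0 (fun j => la 0 * x0 j))) _.
  by rewrite lerDr; exact: (ps (fun j => X j 0)).
have [K HK] : exists K : 'I_n -> R, forall i, 0 <= K i /\ forall x y (d : R),
    (forall j, cmod (x j) <= M) -> (forall j, cmod (y j) <= M) -> 0 <= d ->
    (forall j, cmod (x j - y j) <= d) -> cmod (ev x (pd i H) - ev y (pd i H)) <= K i * d.
  have ex i : exists K : R, 0 <= K /\ forall x y (d : R),
    (forall j, cmod (x j) <= M) -> (forall j, cmod (y j) <= M) -> 0 <= d ->
    (forall j, cmod (x j - y j) <= d) -> cmod (ev x (pd i H) - ev y (pd i H)) <= K * d.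
    by have [K' h1 h2] := ev_lip (pd i H) M0; exists K'.
  by have [K HK] := choice ex; exists K.
pose KB : R := (\sum_i K i) * B.
have K0 : 0 <= \sum_i K i by apply: sumr_ge0 => i _; have [] := HK i.
have KB0 : 0 <= KB by rewrite mulr_ge0.
pose A : R := \sum_j cmod (x0 j / x0 k).
have A0 : 0 <= A by apply: sumr_ge0 => i _; exact: cmod_ge0.
have Q0 : 0 <= Q by rewrite addr_ge0 ?cmod_ge0.
(* Dividing by [la ^+ l.-1] costs [2 ^+ l.-1], as [cmod la >= 1 / 2]. [Q] bounds the derivative of
   [P] along [u], and [KB * (1 + A)] the errors [E j] and [E k * (x0 j / x0 k)]. *)
pose La : R := 2 ^+ l.-1 * (Q + KB * (1 + A)).
have main : \forall t \near (0 : C), forall j, cmod (dv (xi j) t) <= La * \sum_i cmod (xi i t).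
  have N5 : \forall t \near (0 : C), cmod t < r.
    by apply/nearCP; exists r => // t; rewrite subr0.
  apply: filterS (near_and (near_and N1 N5) (near_and N4 (near_and N2 N3))) => t [[h1 /St [_ _ [L [hL dX EL]]]] [h4 [h2 h3]]] j.
  set s := \sum_i cmod (xi i t).
  have s0 : 0 <= s by apply: sumr_ge0 => i _; exact: cmod_ge0.
  have lat : la t != 0 by rewrite -cmod_gt0; apply: lt_le_trans h1; rewrite divr_gt0.
  (* The gradient of [H] is homogeneous of degree [l.-1], so at [la t * x0] it equals
     [la t ^+ l.-1 * b]; the Lipschitz bound makes [Dl] linear in the transversal components
     [xi]. *)
  pose Dl i := ev (X^~ t) (pd i H) - la t ^+ l.-1 * b 0 i.
  have hD i : cmod (Dl i) <= K i * s.
    have [_ h] := HK i; rewrite /Dl /b mxE -(ev_pd_homog hH) //.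
    apply: h => // m; [exact: le_trans (h2 m) (XM m) | exact: le_trans (h3 m) (laM m) |].
    by apply: (ge1 (fun i => cmod (xi i t))) => m'; exact: cmod_ge0.
  pose E m := \sum_i Dl i * L i m.
  have hE m : cmod (E m) <= KB * s.
    apply: le_trans (cmod_sum _ _ _) _; rewrite /KB mulrAC mulr_suml mulr_suml.
    apply: ler_sum => i _; rewrite cmodM; apply: ler_pM; rewrite ?cmod_ge0 //.
  (* The main term is a multiple of [X m] with a factor independent of [m], so the transversal
     combination turns it into the same multiple of [xi]. *)
  have dXE m : la t ^+ l.-1 * dv (X m) t = (P^`()).[u (z0 + t *: b)] * X m t - E m.
    rewrite (dv_eq (dX m)) -EL mulr_sumr -sumrB; apply: eq_bigr => i _.
    by rewrite /Dl mulrBl opprB addrC subrK mulrA.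
  have dxi : dv (xi j) t = dv (X j) t - dv (X k) t / x0 k * x0 j.
    exact: (dv_sub_scale (x0 k) (x0 j) (der_diff (dX j)) (der_diff (dX k))).
  have key : la t ^+ l.-1 * dv (xi j) t =
      (P^`()).[u (z0 + t *: b)] * xi j t - (E j - E k * (x0 j / x0 k)).
    rewrite dxi mulrBr dXE.
    have -> : la t ^+ l.-1 * (dv (X k) t / x0 k * x0 j) = la t ^+ l.-1 * dv (X k) t * (x0 j / x0 k).
      by rewrite -!mulrA; congr (_ * (_ * _)); rewrite mulrC.
    rewrite dXE; exact: transversal_combination.
  have lb : (1 / 2) ^+ l.-1 <= cmod (la t ^+ l.-1).
    by rewrite cmodX lerXn2r ?nnegrE ?cmod_ge0 // divr_ge0.
  have n1 : cmod (la t ^+ l.-1 * dv (xi j) t) <= (Q + KB * (1 + A)) * s.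
    rewrite key (le_trans (cmodB _ _)) // mulrDl; apply: lerD.
      rewrite cmodM; apply: ler_pM; rewrite ?cmod_ge0 //.
      by apply: (ge1 (fun i => cmod (xi i t))) => m'; exact: cmod_ge0.
    rewrite (le_trans (cmodB _ _)) // mulrDr mulr1 mulrDl; apply: lerD; first exact: hE.
    rewrite cmodM mulrAC; apply: ler_pM; rewrite ?cmod_ge0 ?hE //.
    by apply: (ge1 (fun i => cmod (x0 i / x0 k))) => m'; exact: cmod_ge0.
  have q0 : 0 < (1 / 2 : R) ^+ l.-1 by rewrite exprn_gt0 // divr_gt0.
  rewrite -(ler_pM2l q0); apply: le_trans (_ : cmod (la t ^+ l.-1) * cmod (dv (xi j) t) <= _).
    by apply: ler_wpM2r; first exact: cmod_ge0.
  rewrite -cmodM; apply: le_trans n1 _.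
  rewrite /La !mulrA -exprMn mul1r mulVf ?pnatr_eq0 // expr1n mul1r //.
have Z := near_all_ord (gronwall_hol hxi xi0 main).
apply: filterS Z => t h j; have := h j => /eqP.
by rewrite subr_eq0 => /eqP.
Qed.

(** With gradient [la * x0], Euler's identity gives [U' = la * l * H(x0)] and the equation gives
    [P(U) = la ^ l * H(x0)]; eliminating [la] leaves the constant [l ^ l * H(x0) ^ (l - 1)]. *)
Lemma characteristic_line : let U t := u (z0 + t *: b) in
  [/\ hol U 0, dv U 0 != 0 &
    \forall t \near (0 : C), dv U t ^+ l = l%:R ^+ l * ev x0 H ^+ l.-1 * P.[U t]].
Proof.
move=> U; have [r [B [r0 B0 St]]] := char_step hu pde.
have hU : hol U 0.
  by exists r => // t; rewrite subr0 => /St [dU _ _]; exact: der_diff dU.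
have [k xk] := x0_neq0.
have eul : \sum_i b 0 i * x0 i = l%:R * ev x0 H.
  by rewrite -(ev_euler hH); apply: eq_bigr => i _; rewrite /b mxE.
have dU0 : dv U 0 = l%:R * ev x0 H.
  have [|dU _ _] := St 0; first by rewrite cmod0.
  by rewrite (dv_eq dU) -eul; apply: eq_bigr => i _; rewrite -/(X i 0) X0.
have ln : (l%:R : C) != 0 by rewrite pnatr_eq0 -lt0n.
split; [exact: hU | by rewrite dU0; exact: mulf_neq0 ln H0 |].
have N5 : \forall t \near (0 : C), cmod t < r.
  by apply/nearCP; exists r => // t; rewrite subr0.
apply: filterS (near_and N5 (gradient_parallel xk)) => t [/St [dU Et _] hp].
have e1 : \sum_i b 0 i * partial u i (z0 + t *: b) = X k t / x0 k * (l%:R * ev x0 H).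
  by rewrite -eul mulr_sumr; apply: eq_bigr => i _; rewrite -/(X i t) hp mulrCA.
have e2 : ev (fun j => partial u j (z0 + t *: b)) H = (X k t / x0 k) ^+ l * ev x0 H.
  by rewrite -(ev_homog hH); apply: mpoly.meval_eq => j; rewrite -/(X j t) hp.
have e3 : dv U t = X k t / x0 k * (l%:R * ev x0 H) := etrans (dv_eq dU) e1.
have e4 : P.[U t] = (X k t / x0 k) ^+ l * ev x0 H := etrans (esym Et) e2.
rewrite e3 e4; exact: exprM_balance.
Qed.
End Parallel.

(** * Pseudoprimality *)

Section Conclusion.
Variables (R : realType).
Local Notation C := (Cplx R).
Implicit Types (f : C -> C) (P Q : {poly C}).

Lemma affine_rational f : affine f -> is_rational f.
Proof.
move=> [A [B h]]; exists (A *: 'X + B%:P), 1; split; first exact: oner_neq0.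
move=> z /hol_def hf _; rewrite hornerC divr1 !hornerE.
apply: (@hol_pnear_eq _ f (fun z => A * z + B) z) => //.
by apply: hol_add; [apply: hol_mulcst; exact: hol_id | exact: hol_cst].
Qed.

Lemma inv_affine_rational f a : affine (fun z => (f z - a)^-1) -> is_rational f.
Proof.
move=> [A [B h]]; pose q := A *: 'X + B%:P : {poly C}.
have qE z : q.[z] = A * z + B by rewrite /q !hornerE.
have fE z : pnear z (fun w => f w = a + (q.[w])^-1).
  by apply: pnear_sub (h z) => w _; rewrite qE => <-; rewrite invrK addrC subrK.
have [q0|q0] := eqVneq q 0.
  exists a%:P, 1; split; first exact: oner_neq0.
  move=> z /hol_def hf _; rewrite !hornerC divr1.
  apply: (@hol_pnear_eq _ f (fun=> a) z) => //; first exact: hol_cst.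
  by apply: pnear_sub (fE z) => w _ ->; rewrite q0 horner0 invr0 addr0.
exists (a *: q + 1%:P), q; split=> // z /hol_def hf qz.
have -> : (a *: q + 1%:P).[z] / q.[z] = a + q.[z]^-1.
  by rewrite hornerD hornerZ hornerC mulrDl (mulfK qz) mul1r.
apply: (@hol_pnear_eq _ f (fun w => a + (q.[w])^-1) z) => //.
apply: hol_add; first exact: hol_cst.
by apply: hol_inv => //; apply: hol_poly; exact: hol_id.
Qed.

Lemma simple_root_factor P a : P != 0 -> root P a -> mup a P = 1%N ->
  exists2 Q, Q.[a] != 0 & P = Q * ('X - a%:P).
Proof.
move=> P0 /factor_theorem [Q EP] m1; exists Q => //.
apply/negP => /factor_theorem [Q' EQ].
have : (1 < mup a P)%N by rewrite mup_geq // EP EQ -mulrA -expr2 dvdp_mull.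
by rewrite m1.
Qed.

Lemma double_root_factor P a : P != 0 -> (1 < mup a P)%N ->
  exists Q, P = Q * ('X - a%:P) ^+ 2.
Proof. by move=> P0; rewrite mup_geq // => /dvdpP [Q ->]; exists Q. Qed.

Lemma one_variable (f G : C -> C) P l (k : C) : (forall p, mero f p) -> hol f (G 0) ->
  (forall z, differentiable G z) -> k != 0 -> (0 < l)%N -> P != 0 ->
  (\forall z \near (0 : C), dv (fun z => f (G z)) z ^+ l = k * P.[f (G z)]) ->
  dv (fun z => f (G z)) 0 != 0 ->
  (l = 1%N /\ has_multiple_zero P)
  \/ (l = 2%N /\ (5 <= (size P).-1)%N)
  \/ ((3 <= l)%N /\ zeros_distinct P) -> is_rational f.
Proof.
move=> mf hf dG k0 l0 P0 ode dU0 [[l1 [a ma]]|[[l2 d5]|[l3 zd]]].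
- have [Q EP] := double_root_factor P0 ma.
  have Q0 : Q != 0 by apply/eqP => h; move/eqP: P0; rewrite EP h mul0r.
  have X2 : ('X - a%:P : {poly C}) ^+ 2 != 0 by rewrite expf_neq0 // polyXsubC_eq0.
  have sP : size P = (size Q).+2.
    by rewrite EP size_mul // size_exp_XsubC addnS addn2.
  (* For [l = 1] the order equation [j + 2 = (j + 1) * deg P] has the solution [j = 0] when
     [deg P = 2], so that case is integrated explicitly; from degree 3 on there is none. *)
  have [sQ|sQ] := leqP (size Q) 1.
    have [c EQ] : exists c, Q = c%:P by exists Q`_0; exact: size1_polyC.
    apply: (@inv_affine_rational f a).
    apply: (@affine_square _ f G P l k mf hf dG k0 ode dU0 c a l1).
      by move: Q0; rewrite EQ polyC_eq0.
    by rewrite EP EQ mul_polyC.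
  exfalso; apply: (no_pole mf hf dG k0 l0 P0 ode dU0); rewrite l1 sP /=; first by rewrite ltnS ltnW.
  by move=> j; move: (size Q) sQ => s; nia.
(* [2 * (j + 2) = (j + 1) * d] has no solution for [d >= 5], whereas [d = 4] and [d = 3] allow poles
   of order 1 and 2. *)
- exfalso; apply: (no_pole mf hf dG k0 l0 P0 ode dU0); rewrite l2; first by lia.
  by move=> j; move: (size P).-1 d5 => s; nia.
(* Without a zero [P] is constant and [U] is affine; otherwise any zero is simple and must be
   omitted. *)
have [s1|s1] := eqVneq (size P) 1%N.
  have [c EP] : exists c, P = c%:P by exists P`_0; apply: size1_polyC; rewrite s1.
  apply: affine_rational; apply: (@affine_const _ f G P l k mf hf dG l0 ode dU0 c) => //.
  by move: P0; rewrite EP polyC_eq0.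
have [a ra] := closed_rootP P s1.
have [Q Qa EP] := simple_root_factor P0 ra (zd a ra).
by case: (no_omitted mf hf dG k0 l0 P0 ode dU0 l3 Qa EP).
Qed.
End Conclusion.

Section Pseudoprime.
Variables (R : realType) (n : nat).
Local Notation C := (Cplx R).
Local Notation V := 'rV[Cplx R]_n.
Local Notation ev x p := (mpoly.meval x p).
Implicit Types (f : C -> C) (g u : V -> C) (P : {poly C}).

Lemma holomorphic_near u (z0 : V) : holomorphic_at u z0 -> \forall z \near z0, holomorphic_at u z.
Proof.
move=> /holV_near [d d0 D]; apply/nearVP; exists d => // z zd.
apply/nearVP; exists (d - vnorm (z - z0)); first by rewrite subr_gt0.
move=> w; rewrite ltrBrDr => wz; apply: D; apply: le_lt_trans wz.
have -> : w - z0 = (w - z) + (z - z0) by rewrite addrA subrK.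
exact: vnormD.
Qed.

Lemma near_line (z0 v : V) (Q : V -> Prop) : (\forall z \near z0, Q z) ->
  \forall t \near (0 : C), Q (z0 + t *: v).
Proof.
move=> /nearVP [d d0 D]; have v0 := vnorm_ge0 v.
apply/nearCP; exists (d / (vnorm v + 1)); first by rewrite divr_gt0 // ltr_pwDr.
move=> t; rewrite subr0 ltr_pdivlMr ?ltr_pwDr // => ht; apply: D.
rewrite (addrC z0) addrK vnormZ; apply: le_lt_trans ht.
by apply: ler_wpM2l; [exact: cmod_ge0 | rewrite lerDl].
Qed.

Lemma entire_diff g : entire g -> forall z, differentiable g z.
Proof. by move=> h z; apply: nbhs_singleton (h z). Qed.

Lemma entire_line g (z0 v : V) : entire g -> forall t, differentiable (fun t : C => g (z0 + t *: v)) t.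
Proof. by move=> h t; apply: der_diff; apply: line_der; exact: entire_diff. Qed.

(** If [g] were constant near [z0] on every line, the identity theorem at [t = 1] would make it
    constant everywhere, hence a polynomial. *)
Lemma nonconstant_line g (z0 : V) : entire g -> ~ is_polynomial g ->
  exists v, ~ (\forall t \near (0 : C), g (z0 + t *: v) = g z0).
Proof.
move=> eg np; apply: contrapT => /forallNP H; apply: np.
exists (mpoly.mpolyC n (g z0)) => z _; rewrite mpoly.mevalC.
have {}H : \forall t \near (0 : C), g (z0 + t *: (z - z0)) = g z0 by apply: contrapT; exact: (H).
have dG := entire_line z0 (z - z0) eg.
have E : pnear 1 (fun t : C => g (z0 + t *: (z - z0)) = g z0).
  apply: (@mero_identity _ (fun t : C => g (z0 + t *: (z - z0))) (fun=> g z0) 0).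
  - exact: hol_mero_all.
  - by move=> q; exact: mero_cst.
  - exact: near_pnear.
have := hol_pnear_eq (hol_all 1 dG) (hol_cst 1 (g z0)) E.
by rewrite scale1r addrC subrK.
Qed.

(** Roots are isolated: after splitting off the factor at [U 0], the cofactor stays nonzero near [0]
    by continuity. *)
Lemma root_const P (U : C -> C) : P != 0 -> hol U 0 ->
  (\forall t \near (0 : C), P.[U t] = 0) -> \forall t \near (0 : C), U t = U 0.
Proof.
move=> P0 hU H; have [m [Q Qa EP]] := multiplicity_XsubC P (U 0).
rewrite P0 /= in Qa.
have [d d0 D] := hol_cont_neq0 (hol_poly Q hU) Qa.
have N : \forall t \near (0 : C), Q.[U t] != 0 by apply/nearCP; exists d.
apply: filterS (near_and H N) => t [h1 h2]; move: h1.
rewrite EP hornerM horner_exp hornerXsubC => /eqP.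
by rewrite mulf_eq0 (negPf h2) /= expf_eq0 subr_eq0 => /andP[_ /eqP].
Qed.

Lemma ode_near (U F : C -> C) P l (k p : C) : (\forall t \near p, U t = F t) -> hol U p ->
  (\forall t \near p, dv U t ^+ l = k * P.[U t]) -> \forall t \near p, dv F t ^+ l = k * P.[F t].
Proof.
move=> /near_join E [d d0 D] ode.
have N : \forall t \near p, hol U t.
  apply/nearCP; exists d => // t td; exists (d - cmod (t - p)); first by rewrite subr_gt0.
  by move=> w; rewrite ltrBrDr => wt; apply: D; apply: le_lt_trans wt; exact: cmod_tri.
apply: filterS (near_and (near_and E N) ode) => t [[Et ht] odet].
have <- := nbhs_singleton Et; rewrite -odet; have -> // := dv_near Et ht.
Qed.

(** If [f - a] had no other zero near [G 0], continuity would force [G t = G 0] near [0]. So [f = a]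
    near [G 0], and the identity theorem spreads this. *)
Lemma left_factor_const f (G : C -> C) a : (forall p, mero f p) -> hol f (G 0) -> hol G 0 ->
  ~ (\forall t \near (0 : C), G t = G 0) -> (\forall t \near (0 : C), f (G t) = a) -> affine f.
Proof.
move=> mf hf hG nc H; exists 0, a.
apply: (@mero_identity _ _ _ (G 0)) => //.
  by move=> q; under eq_fun do rewrite mul0r add0r; exact: mero_cst.
apply: pnear_sub (_ : pnear (G 0) (fun z => f z = a)) => [z _ ->|]; first by rewrite mul0r add0r.
have hfa : hol (fun z => f z - a) (G 0) by apply: hol_sub => //; exact: hol_cst.
have [h|[d d0 D]] := zero_dich hfa.
  by apply: near_pnear; apply: filterS h => z /eqP; rewrite subr_eq0 => /eqP.
case: nc; have /differentiable_continuous/ccontP/(_ _ d0)[e e0 E] := hol_diff hG.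
have N : \forall t \near (0 : C), cmod (G t - G 0) < d by apply/nearCP; exists e.
apply: filterS (near_and H N) => t [h1 h2]; apply/eqP/negPn/negP => h3.
by have := D _ h3 h2; rewrite h1 subrr eqxx.
Qed.
End Pseudoprime.

Theorem corollary1p2 (R : realType) (n l hbar : nat)
    (H : mpoly.mpoly n (Cplx R)) (P : {poly Cplx R})
    (u : 'rV[Cplx R]_n -> Cplx R) :
  (1 <= n)%N -> (1 <= l)%N ->
  H != 0 -> H \is mpoly.ishomog1 l mpoly.mdeg ->
  size P = hbar.+1 ->
  meromorphic_solution H P u ->
  (l = 1%N /\ has_multiple_zero P)
  \/ (l = 2%N /\ (5 <= hbar)%N)
  \/ ((3 <= l)%N /\ zeros_distinct P) ->
  pseudoprime u.
Proof.
move=> _ l0 _ hH sP [_ pde] cases f g [mf' [eg|[rf _]] [dD comp]]; last by left.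
have mf := mero_def mf'.
have [pg|npg] := pselect (is_polynomial g); [by right | left].
have P0 : P != 0 by rewrite -size_poly_gt0 sP.
set D := (X in dense X) in dD comp.
(* Openness lets short pieces of lines through a point of [D] stay where [u = f o g] holds. *)
have openD z0 : D z0 -> \forall z \near z0, D z.
  move=> [hu hg hf].
  have hgf : \forall z \near z0, \forall w \near g z, differentiable f w.
    have /hol_def [d d0 Dd] := hf.
    have [e e0 E] := contVP (differentiable_continuous (entire_diff eg z0)) d0.
    apply/nearVP; exists e; first exact: e0.
    move=> z zd.
    have hz := E z zd.
    apply/nearCP.
    exists (d - cmod (g z - g z0)); first by rewrite subr_gt0.
    move=> w; rewrite ltrBrDr => hw; apply: Dd; apply: le_lt_trans hw.
    exact: cmod_tri.
  have [d1 d10 D1] : exists2 d : R, 0 < d & forall z, vnorm (z - z0) < d -> holomorphic_at u z.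
    by apply/nearVP; exact: holomorphic_near.
  have [d2 d20 D2] : exists2 d : R, 0 < d & forall z, vnorm (z - z0) < d ->
      \forall w \near g z, differentiable f w by apply/nearVP.
  apply/nearVP; exists (Num.min d1 d2); first by rewrite lt_min d10.
  move=> z; rewrite lt_min => /andP[z1 z2]; split; [exact: D1 z z1 | exact: eg | exact: D2 z z2].
have pdeD z0 : D z0 -> \forall z \near z0, mpoly.meval (fun j => partial u j z) H = P.[u z].
  by move=> /openD; apply: filterS => z [hu _ _]; exact: pde.
have compD z0 v : D z0 -> \forall t \near (0 : Cplx R), u (z0 + t *: v) = f (g (z0 + t *: v)).
  by move=> /openD/(near_line v); apply: filterS => t; exact: comp.
have hfG z0 v : D z0 -> hol f (g (z0 + (0 : Cplx R) *: v)).
  by move=> [_ _ hf]; rewrite scale0r addr0; apply/hol_def.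
have [[z0 [Dz Hz]]|noz] := pselect (exists z0, D z0 /\ mpoly.meval (fun j => partial u j z0) H != 0).
  have hu : holomorphic_at u z0 by case: Dz.
  have [hU dU0 ode] := characteristic_line l0 hH hu (pdeD z0 Dz) Hz.
  set b := char_dir H u z0 in hU dU0 ode.
  set k := _ * _ in ode.
  have E := compD z0 b Dz.
  have k0 : k != 0.
    by apply: mulf_neq0; apply: expf_neq0 => //; rewrite pnatr_eq0 -lt0n.
  apply: (@one_variable _ f (fun t => g (z0 + t *: b)) P l k mf (hfG z0 b Dz)
    (entire_line z0 b eg) k0 l0 P0).
  - exact: (ode_near E hU ode).
  - by rewrite -(dv_near E hU).
  - by rewrite sP.
have [z0 Dz] : exists z0, D z0.
  have [|z0 [_ Dz]] := dD setT _ openT; first by exists 0.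
  by exists z0.
have PD z : D z -> P.[u z] = 0.
  move=> Dz'; have [hu _ _] := Dz'; rewrite -pde //.
  by apply/eqP/negPn/negP => h; apply: noz; exists z.
(* On this line [f o g] is a holomorphic germ of roots of [P], hence constant while [g] is not, so
   [f] is constant. *)
have [v nv] := nonconstant_line z0 eg npg.
pose G (t : Cplx R) := g (z0 + t *: v).
have hG : hol G 0 by apply: hol_all; exact: entire_line.
apply: affine_rational; apply: (@left_factor_const _ f G (f (G 0)) mf (hfG z0 v Dz) hG).
  by move=> h; apply: nv; apply: filterS h => t; rewrite /G scale0r addr0.
apply: (@root_const _ P (fun t => f (G t)) P0); first by apply: hol_comp => //; exact: hfG.
have N := near_line v (openD z0 Dz).
by apply: filterS (near_and N (compD z0 v Dz)) => t [/PD h <-].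
Qed.
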